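(* Let $n\ge1$ be a natural number and put $$c_n:=i\,2^n\pi^{\frac{n+1}{2}}\,\Gamma\!\left(\tfrac{n+1}{2}\right).$$ (1) Let $s_0\in\mathbb{R}$. The Fourier transforms with respect to $x\in\mathbb{R}^{n+1}$, in the sense of tempered distributions, of the slice monogenic Cauchy kernels $S_L^{-1}(s_0,x)=(s_0-\bar x)(s_0^2-2x_0s_0+|x|^2)^{-1}$ and $S_R^{-1}(s_0,x)=(s_0^2-2x_0s_0+|x|^2)^{-1}(s_0-\bar x)$ are equal and given by $$\mathrm{F}[S_L^{-1}(s_0,\cdot)](\xi)=\mathrm{F}[S_R^{-1}(s_0,\cdot)](\xi)=c_n\,\frac{\bar\xi}{(\xi_0^2+|\underline{\xi}|^2)^{\frac{n+1}{2}}}\;e^{-is_0\xi_0},\qquad \xi=\xi_0+\underline{\xi}\neq0.$$ (2) For each such $\xi$ the term $e^{-is_0\xi_0}$, $s_0\in\mathbb{R}$, extends to the intrinsic entire slice monogenic function $s\mapsto e^{-is\xi_0}$ of the paravector $s=s_0+\underline{s}\in\mathbb{R}^{n+1}$. Correspondingly, the Fourier transforms of the Cauchy kernels extend from real $s$ to $s\in\mathbb{R}^{n+1}$ as $$\mathrm{F}[S_L^{-1}(s,\cdot)](\xi)=c_n\,\frac{\bar\xi}{(\xi_0^2+|\underline{\xi}|^2)^{\frac{n+1}{2}}}\;e^{-is\xi_0},\qquad \xi\neq0,$$ $$\mathrm{F}[S_R^{-1}(s,\cdot)](\xi)=c_n\,e^{-is\xi_0}\,\frac{\bar\xi}{(\xi_0^2+|\underline{\xi}|^2)^{\frac{n+1}{2}}},\qquad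 \xi\neq0,$$ where the extension $\mathrm{F}[S_L^{-1}(s,\cdot)](\xi)$ is right slice monogenic in $s$ and the extension $\mathrm{F}[S_R^{-1}(s,\cdot)](\xi)$ is left slice monogenic in $s$.
   Context: $\mathbb{R}_n$ denotes the real Clifford algebra over $n$ imaginary units $e_1,\dots,e_n$ with $e_\ell e_m+e_me_\ell=0$ for $\ell\neq m$ and $e_\ell^2=-1$. A point $(x_0,\dots,x_n)\in\mathbb{R}^{n+1}$ is identified with the paravector $x=x_0+\underline{x}$, $\underline{x}=\sum_{\ell=1}^n x_\ell e_\ell$; $\bar x=x_0-\underline{x}$, $|x|^2=\sum_{\ell=0}^n x_\ell^2$; likewise $\xi=\xi_0+\underline{\xi}$, $\bar\xi=\xi_0-\underline{\xi}$. The symbol $i$ is the complex imaginary unit, commuting with all $e_\ell$; Fourier transforms take values in the complexified Clifford algebra $\mathbb{C}\otimes\mathbb{R}_n$. $\mathbb{S}=\{\underline{x}: |\underline{x}|=1\}$, so $I^2=-1$ for $I\in\mathbb{S}$. Fourier transform: for $f\in\mathcal{S}(\mathbb{R}^{n+1})$, $\mathrm{F}[f](\xi)=\int_{\mathbb{R}^{n+1}}f(x)e^{-i(x,\xi)}dx$ with $(x,\xi)=\sum_{j=0}^n x_j\xi_j$. Since the kernels are not in $L^1(\mathbb{R}^{n+1})$, their Fourier transforms for real $s$ are meant in the distributional sense: a locally integrable function $G$ is the Fourier transform of $g$ if $\int g(x)\,\mathrm{F}[\varphi](x)\,dx=\int G(\xi)\varphi(\xi)\,d\xi$ for all $\varphi\in\mathcal{S}(\mathbb{R}^{n+1})$.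 For a nonreal paravector $s$, $\mathrm{F}[S_L^{-1}(s,\cdot)](\xi)$ and $\mathrm{F}[S_R^{-1}(s,\cdot)](\xi)$ denote, for fixed $\xi$, the right, respectively left, slice monogenic extensions in $s$ of the functions obtained for real $s$. Slice monogenic functions: let $U\subseteq\mathbb{R}^{n+1}$ be open and axially symmetric (i.e. $x_0+I|\underline{x}|\in U$ for all $x\in U$, $I\in\mathbb{S}$), and $\mathcal{U}=\{(u,v)\in\mathbb{R}^2: u+\mathbb{S}v\subset U\}$. A function $f$ on $U$ is left (resp. right) slice monogenic if $f(u+Iv)=f_0(u,v)+If_1(u,v)$ (resp. $f_0(u,v)+f_1(u,v)I$) for all $u+Iv\in U$, $I\in\mathbb{S}$, where $f_0,f_1$ are Clifford-algebra-valued $C^1$ functions on $\mathcal{U}$ with $f_0(u,-v)=f_0(u,v)$, $f_1(u,-v)=-f_1(u,v)$, satisfying $\partial_uf_0-\partial_vf_1=0$ and $\partial_vf_0+\partial_uf_1=0$. Here values are allowed in $\mathbb{C}\otimes\mathbb{R}_n$. Such an $f$ is called intrinsic if $f_0,f_1$ are scalar-valued (real-valued for $\mathbb{R}_n$-valued functions; complex-valued here, because of the presence of $i$), and entire if $U=\mathbb{R}^{n+1}$. *)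

(* Defs.v *)
From HB Require Import structures.
From mathcomp Require Import all_boot all_order all_algebra.
From mathcomp Require Import complex ring.
From mathcomp Require Import all_classical all_reals all_analysis.

Set Implicit Arguments.
Unset Strict Implicit.
Unset Printing Implicit Defensive.
Import Order.TTheory GRing.Theory Num.Theory.
Import numFieldNormedType.Exports.

Local Open Scope classical_set_scope.
Local Open Scope ring_scope.

(** [clifford K n] is K (x) R_n: the coefficient of the basis blade
    e_A = e_a1 ... e_ak (A = {a1 < ... < ak}) is the value at A.  Blades multiply
    by e_A e_B = blade_sign A B * e_(A symdiff B); since e_l e_m = - e_m e_l for
    l <> m and e_l ^ 2 = -1, there is one factor -1 for every pair (a, b) in
    A x B with b <= a. *)

Section CliffordDef.
Variables (K : comNzRingType) (n : nat).

(* A wrapper, because {ffun _ -> K} carries the pointwise product. *)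
Record clifford := Clifford { cl_coef : {ffun {set 'I_n} -> K} }.

HB.instance Definition _ := [isNew for cl_coef].
HB.instance Definition _ := [Choice of clifford by <:].

Definition cl_fun (x : clifford) : {set 'I_n} -> K := cl_coef x.
Coercion cl_fun : clifford >-> Funclass.

Implicit Types (A B C : {set 'I_n}) (x y z : clifford).

Definition symdiff A B : {set 'I_n} := (A :\: B) :|: (B :\: A).

Definition blade_sign A B : K :=
  \prod_(a in A) \prod_(b in B | (b <= a)%N) (-1).

Definition mk_clifford (f : {set 'I_n} -> K) : clifford := Clifford [ffun A => f A].

Lemma mk_cliffordE f A : mk_clifford f A = f A.
Proof. exact: ffunE. Qed.

Lemma cliffordP x y : (forall A, x A = y A) <-> x = y.
Proof.
by split=> [xy|->//]; case: x y xy => [x] [y] xy; congr Clifford; apply/ffunP.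
Qed.

Definition clifford_zero : clifford := mk_clifford (fun=> 0).
Definition clifford_opp x : clifford := mk_clifford (fun A => - x A).
Definition clifford_add x y : clifford := mk_clifford (fun A => x A + y A).
Definition clifford_scale (k : K) x : clifford := mk_clifford (fun A => k * x A).

Definition blade A : clifford := mk_clifford (fun B => (B == A)%:R).

Definition clifford_one : clifford := blade finset.set0.

(* For a given C the only B with symdiff A B = C is symdiff A C. *)
Definition clifford_mul x y : clifford := mk_clifford (fun C =>
  \sum_(A : {set 'I_n})
     blade_sign A (symdiff A C) * x A * y (symdiff A C)).

Fact clifford_addA : associative clifford_add.
Proof. by move=> x y z; apply/cliffordP => A; rewrite !mk_cliffordE addrA. Qed.

Fact clifford_addC : commutative clifford_add.
Proof. by move=> x y; apply/cliffordP => A; rewrite !mk_cliffordE addrC. Qed.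

Fact clifford_add0 : left_id clifford_zero clifford_add.
Proof. by move=> x; apply/cliffordP => A; rewrite !mk_cliffordE add0r. Qed.

Fact clifford_addN : left_inverse clifford_zero clifford_opp clifford_add.
Proof. by move=> x; apply/cliffordP => A; rewrite !mk_cliffordE addNr. Qed.

HB.instance Definition _ := GRing.isZmodule.Build clifford
  clifford_addA clifford_addC clifford_add0 clifford_addN.

Lemma cl_coef0 A : (0 : clifford) A = 0.
Proof. exact: mk_cliffordE. Qed.

Lemma cl_coefN x A : (- x) A = - x A.
Proof. exact: mk_cliffordE. Qed.

Lemma cl_coefD x y A : (x + y) A = x A + y A.
Proof. exact: mk_cliffordE. Qed.

Fact clifford_scaleA k l x :
  clifford_scale k (clifford_scale l x) = clifford_scale (k * l) x.
Proof. by apply/cliffordP => A; rewrite !mk_cliffordE mulrA. Qed.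

Fact clifford_scale1 : left_id 1 clifford_scale.
Proof. by move=> x; apply/cliffordP => A; rewrite !mk_cliffordE mul1r. Qed.

Fact clifford_scaleDr : right_distributive clifford_scale +%R.
Proof.
by move=> k x y; apply/cliffordP => A; rewrite cl_coefD !mk_cliffordE mulrDr.
Qed.

Fact clifford_scaleDl x : {morph clifford_scale^~ x : k l / k + l}.
Proof.
by move=> k l; apply/cliffordP => A; rewrite cl_coefD !mk_cliffordE mulrDl.
Qed.

HB.instance Definition _ := GRing.Zmodule_isLmodule.Build K clifford
  clifford_scaleA clifford_scale1 clifford_scaleDr clifford_scaleDl.

Lemma cl_coefZ k x A : (k *: x) A = k * x A.
Proof. exact: mk_cliffordE. Qed.

Lemma in_symdiff a A B : (a \in symdiff A B) = (a \in A) (+) (a \in B).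
Proof. by rewrite !inE; case: (a \in A); case: (a \in B). Qed.

Lemma symdiffK A : involutive (symdiff A).
Proof. by move=> B; apply/setP => a; rewrite !in_symdiff addKb. Qed.

Lemma symdiffA A B C : symdiff A (symdiff B C) = symdiff (symdiff A B) C.
Proof. by apply/setP => a; rewrite !in_symdiff addbA. Qed.

Lemma symdiffC A B : symdiff A B = symdiff B A.
Proof. by apply/setP => a; rewrite !in_symdiff addbC. Qed.

Lemma symdiff0 A : symdiff A finset.set0 = A.
Proof. by apply/setP => a; rewrite in_symdiff inE addbF. Qed.

Lemma prod_symdiff (f : 'I_n -> K) A B : (forall a, f a * f a = 1) ->
  \prod_(a in symdiff A B) f a = \prod_(a in A) f a * \prod_(a in B) f a.
Proof.
move=> ff; rewrite [LHS]big_mkcond [X in _ = X * _]big_mkcond.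
rewrite [X in _ = _ * X]big_mkcond -big_split; apply: eq_bigr => a _ /=.
by rewrite in_symdiff; case: (a \in A); case: (a \in B); rewrite ?mulr1 ?mul1r.
Qed.

Lemma prodN1_sq (I : finType) (P : pred I) :
  (\prod_(i | P i) (-1 : K)) * (\prod_(i | P i) (-1)) = 1.
Proof. by rewrite -big_split big1 // => i _; rewrite /= mulrNN mulr1. Qed.

Lemma blade_signDl A B C :
  blade_sign (symdiff A B) C = blade_sign A C * blade_sign B C.
Proof. by rewrite /blade_sign prod_symdiff // => a; exact: prodN1_sq. Qed.

Lemma blade_signDr A B C :
  blade_sign A (symdiff B C) = blade_sign A B * blade_sign A C.
Proof.
rewrite /blade_sign -big_split; apply: eq_bigr => a _ /=.
have E (D : {set 'I_n}) : \prod_(b in D | (b <= a)%N) (-1 : K) =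
    \prod_(b in D) (if (b <= a)%N then -1 else 1).
  by rewrite -big_mkcondr.
by rewrite !E prod_symdiff // => b; case: ifP; rewrite ?mulrNN mulr1.
Qed.

Lemma blade_sign0l A : blade_sign finset.set0 A = 1.
Proof. by rewrite /blade_sign big1 // => a; rewrite inE. Qed.

Lemma blade_sign0r A : blade_sign A finset.set0 = 1.
Proof. by rewrite /blade_sign big1 // => a _; rewrite big1 // => b; rewrite inE. Qed.

Lemma clifford_mulA : associative clifford_mul.
Proof.
move=> x y z; apply/cliffordP => D; rewrite !mk_cliffordE.
under eq_bigr => A _.
  rewrite mk_cliffordE mulr_sumr (reindex_inj (can_inj (symdiffK A))) /=.
  over.
rewrite exchange_big /=; apply: eq_bigr => B _.
rewrite mk_cliffordE mulr_sumr mulr_suml; apply: eq_bigr => A _.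
have -> : symdiff (symdiff A B) (symdiff A D) = symdiff B D.
  by apply/setP => a; rewrite !in_symdiff;
     case: (a \in A); case: (a \in B); case: (a \in D).
have -> : symdiff A D = symdiff (symdiff A B) (symdiff B D).
  by apply/setP => a; rewrite !in_symdiff;
     case: (a \in A); case: (a \in B); case: (a \in D).
rewrite blade_signDr.
have -> : blade_sign B (symdiff B D) =
    blade_sign A (symdiff B D) * blade_sign (symdiff A B) (symdiff B D).
  by rewrite -blade_signDl symdiffK.
by ring.
Qed.

Lemma clifford_mul1l : left_id clifford_one clifford_mul.
Proof.
move=> x; apply/cliffordP => C; rewrite mk_cliffordE (bigD1 finset.set0) //= big1.
  by rewrite blade_sign0l symdiffC symdiff0 mk_cliffordE eqxx !mul1r addr0.
by move=> A /negPf A0; rewrite mk_cliffordE A0 mulr0 mul0r.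
Qed.

Lemma clifford_mul1r : right_id clifford_one clifford_mul.
Proof.
move=> x; apply/cliffordP => C; rewrite mk_cliffordE (bigD1 C) //= big1.
  have -> : symdiff C C = finset.set0.
    by apply/setP => a; rewrite in_symdiff inE addbb.
  by rewrite blade_sign0r mk_cliffordE eqxx mul1r mulr1 addr0.
move=> A AC; rewrite !mk_cliffordE; case: eqP => [E|_]; last by rewrite mulr0.
by move: AC; rewrite -[C](symdiffK A) E symdiff0 eqxx.
Qed.

Lemma clifford_mulDl : left_distributive clifford_mul +%R.
Proof.
move=> x y z; apply/cliffordP => C; rewrite !mk_cliffordE -big_split.
by apply: eq_bigr => A _ /=; rewrite mk_cliffordE mulrDr mulrDl.
Qed.

Lemma clifford_mulDr : right_distributive clifford_mul +%R.
Proof.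
move=> x y z; apply/cliffordP => C; rewrite !mk_cliffordE -big_split.
by apply: eq_bigr => A _ /=; rewrite mk_cliffordE mulrDr.
Qed.

Lemma clifford_one_neq0 : clifford_one != 0.
Proof.
by apply/eqP => /cliffordP/(_ finset.set0)/eqP; rewrite !mk_cliffordE eqxx oner_eq0.
Qed.

HB.instance Definition _ := GRing.Zmodule_isNzRing.Build clifford
  clifford_mulA clifford_mul1l clifford_mul1r clifford_mulDl clifford_mulDr
  clifford_one_neq0.

Lemma clifford_scaleAl (k : K) x y : k *: (x * y) = (k *: x) * y.
Proof.
apply/cliffordP => C; rewrite !mk_cliffordE mulr_sumr.
by apply: eq_bigr => A _; rewrite mk_cliffordE !mulrA (mulrC k).
Qed.

HB.instance Definition _ :=
  GRing.Lmodule_isLalgebra.Build K clifford clifford_scaleAl.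

Lemma clifford_scaleAr (k : K) x y : k *: (x * y) = x * (k *: y).
Proof.
apply/cliffordP => C; rewrite !mk_cliffordE mulr_sumr.
by apply: eq_bigr => A _; rewrite cl_coefZ; ring.
Qed.

HB.instance Definition _ :=
  GRing.Lalgebra_isAlgebra.Build K clifford clifford_scaleAr.

Definition cl_unit (l : 'I_n) : clifford := blade [set l]%SET.

Lemma blade_mul A B : blade A * blade B = blade_sign A B *: blade (symdiff A B).
Proof.
apply/cliffordP => C; rewrite !mk_cliffordE (bigD1 A) //= big1 => [|D /negPf DA].
  rewrite !mk_cliffordE eqxx mulr1 addr0.
  have -> : (symdiff A C == B) = (C == symdiff A B).
    by apply/eqP/eqP => [<-|->]; rewrite symdiffK.
  by case: eqP => [->|]; rewrite ?symdiffK // !mulr0.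
by rewrite mk_cliffordE DA mulr0 mul0r.
Qed.

Lemma cl_unit_sq (l : 'I_n) : cl_unit l * cl_unit l = -1.
Proof.
rewrite blade_mul /blade_sign big_set1 (eq_bigl (pred1 l)); last first.
  by move=> b; rewrite inE /=; case: eqP => [->|//]; rewrite leqnn.
rewrite big_pred1_eq scaleN1r; congr (- _); rewrite -[RHS]/(blade _).
by congr blade; apply/setP => a; rewrite in_symdiff addbb inE.
Qed.

Lemma cl_unit_anticomm (l m : 'I_n) : l != m ->
  cl_unit l * cl_unit m + cl_unit m * cl_unit l = 0.
Proof.
move=> lm; rewrite !blade_mul symdiffC -scalerDl.
have E (p q : 'I_n) :
    blade_sign [set p]%SET [set q]%SET = if (q <= p)%N then -1 else 1.
  by rewrite /blade_sign big_set1 big_mkcondr big_set1.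
rewrite !E; move: lm; rewrite -(inj_eq val_inj) neq_ltn => /orP[] h.
  by rewrite leqNgt h (ltnW h) /= subrr scale0r.
by rewrite (ltnW h) leqNgt h /= addNr scale0r.
Qed.

End CliffordDef.

Section TupleLebesgueStep.
Variables (R : realType) (m : nat).

Definition tcons (p : measurableTypeR R * m.-tuple (measurableTypeR R)) :
    m.+1.-tuple (measurableTypeR R) :=
  [the m.+1.-tuple (measurableTypeR R) of p.1 :: p.2].

Lemma measurable_tcons : measurable_fun [set: _] tcons.
Proof. exact: measurable_cons. Qed.

Variable mu : {sigma_finite_measure set (m.-tuple (measurableTypeR R)) -> \bar R}.

Definition tuple_lebesgue_step : set (m.+1.-tuple (measurableTypeR R)) -> \bar R :=
  pushforward ((@lebesgue_measure R) \x mu)%E tcons.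

Let step0 : tuple_lebesgue_step set0 = 0%E.
Proof. by rewrite /tuple_lebesgue_step /pushforward preimage_set0 measure0. Qed.

Let step_ge0 A : (0 <= tuple_lebesgue_step A)%E.
Proof. by rewrite /tuple_lebesgue_step /pushforward measure_ge0. Qed.

Let step_sigma_additive : semi_sigma_additive tuple_lebesgue_step.
Proof.
exact: (@measure_semi_sigma_additive _ _ _
  (measure_function_pushforward__canonical__measure_function_Measure
    ((@lebesgue_measure R) \x mu)%E measurable_tcons)).
Qed.

HB.instance Definition _ := isMeasure.Build _ _ _ tuple_lebesgue_step
  step0 step_ge0 step_sigma_additive.

Lemma tuple_lebesgue_step_sigma_finite : sigma_finite setT tuple_lebesgue_step.
Proof.
have /sigma_finiteP[F [FT ndF Ffin]] := sigma_finiteT (@lebesgue_measure R).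
have /sigma_finiteP[G [GT ndG Gfin]] := sigma_finiteT mu.
pose split (t : m.+1.-tuple (measurableTypeR R)) :
  measurableTypeR R * m.-tuple (measurableTypeR R) := (thead t, [tuple of behead t]).
have msplit : measurable_fun setT split.
  apply: measurable_fun_pair; last exact: measurable_behead.
  exact: measurable_tnth.
have tconsK : cancel tcons split.
  by move=> [x t]; rewrite /split theadE; congr pair; exact/val_inj.
exists (fun k => split @^-1` (F k `*` G k)).
  rewrite -preimage_bigcup -[LHS](preimage_setT split); congr (_ @^-1` _).
  rewrite -setXTT FT GT predeqE => -[x y]; split.
    move=> [/= [i _ Fx] [j _ Gy]]; exists (maxn i j) => //; split.
    - by move: x Fx; exact/subsetPset/ndF/leq_maxl.
    - by move: y Gy; exact/subsetPset/ndG/leq_maxr.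
  by move=> [i _ []/= ? ?]; split; exists i.
move=> k; have [mF Foo] := Ffin k; have [mG Goo] := Gfin k; split.
  by rewrite -[X in measurable X]setTI; apply: msplit => //; exact: measurableX.
rewrite /tuple_lebesgue_step /pushforward.
rewrite (_ : tcons @^-1` _ = F k `*` G k); last first.
  rewrite -comp_preimage (_ : split \o tcons = id) ?preimage_id //.
  exact/funext/tconsK.
by rewrite product_measure1E // lte_mul_pinfty // ge0_fin_numE.
Qed.

HB.instance Definition _ := Measure_isSigmaFinite.Build _ _ _ tuple_lebesgue_step
  tuple_lebesgue_step_sigma_finite.

End TupleLebesgueStep.

(* The m-fold product of the one-dimensional Lebesgue measure. *)
Fixpoint tuple_lebesgue (R : realType) (m : nat) :
    {sigma_finite_measure set (m.-tuple (measurableTypeR R)) -> \bar R} :=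
  match m with
  | 0 => [the {sigma_finite_measure set _ -> \bar R} of \d_[tuple]]
  | m'.+1 => [the {sigma_finite_measure set _ -> \bar R} of
              tuple_lebesgue_step (tuple_lebesgue R m')]
  end.

Section Integration.
Variables (R : realType) (n m : nat).
Local Open Scope complex_scope.
Implicit Types (D : set 'rV[R]_m).

Definition row_of_tuple (t : m.-tuple (measurableTypeR R)) : 'rV[R]_m :=
  \row_j tnth t j.

Definition integrable_on D (f : 'rV[R]_m -> R) : Prop :=
  (tuple_lebesgue R m).-integrable (row_of_tuple @^-1` D)
    (fun t => (f (row_of_tuple t))%:E).

Definition rv_integral (f : 'rV[R]_m -> R) : R :=
  \int[tuple_lebesgue R m]_t f (row_of_tuple t).

Definition cx_integrable_on D (f : 'rV[R]_m -> R[i]) : Prop :=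
  integrable_on D (fun x => complex.Re (f x)) /\
  integrable_on D (fun x => complex.Im (f x)).

Definition cx_integral (f : 'rV[R]_m -> R[i]) : R[i] :=
  rv_integral (fun x => complex.Re (f x)) +i* rv_integral (fun x => complex.Im (f x)).

Definition cl_integrable_on D (f : 'rV[R]_m -> clifford R[i] n) : Prop :=
  forall A, cx_integrable_on D (fun x => f x A).

Definition cl_integral (f : 'rV[R]_m -> clifford R[i] n) : clifford R[i] n :=
  mk_clifford (fun A => cx_integral (fun x => f x A)).

Definition cl_locally_integrable (f : 'rV[R]_m -> clifford R[i] n) : Prop :=
  forall K : set 'rV[R]_m, compact K -> cl_integrable_on K f.

End Integration.

Section Fourier.
Variables (R : realType) (n m : nat).
Local Open Scope complex_scope.

Definition partials (s : seq 'I_m) (f : 'rV[R]_m -> R) : 'rV[R]_m -> R :=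
  foldr (fun j g x => 'D_(delta_mx 0 j) g x) f s.

Definition real_schwartz (f : 'rV[R]_m -> R) : Prop :=
  (forall s x, differentiable (partials s f) x) /\
  (forall (k : nat) s, exists M : R,
     forall x, `|x| ^+ k * `|partials s f x| <= M).

Definition schwartz (f : 'rV[R]_m -> R[i]) : Prop :=
  real_schwartz (fun x => complex.Re (f x)) /\
  real_schwartz (fun x => complex.Im (f x)).

Definition dotprod (x y : 'rV[R]_m) : R := \sum_(j < m) x 0 j * y 0 j.

Definition expi (t : R) : R[i] := cos t +i* sin t.

Definition fourier (f : 'rV[R]_m -> R[i]) (xi : 'rV[R]_m) : R[i] :=
  cx_integral (fun x => f x * expi (- dotprod x xi)).

(* Integrability is required explicitly because the integral of a
   non-integrable function is a junk value. *)
Definition is_fourier_transform (g G : 'rV[R]_m -> clifford R[i] n) : Prop :=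
  cl_locally_integrable G /\
  forall phi, schwartz phi ->
    [/\ cl_integrable_on setT (fun x => fourier phi x *: g x),
        cl_integrable_on setT (fun xi => phi xi *: G xi)
      & cl_integral (fun x => fourier phi x *: g x) =
        cl_integral (fun xi => phi xi *: G xi)].

End Fourier.

Definition Gamma (R : realType) (a : R) : R :=
  \int[@lebesgue_measure R]_(t in `]0, +oo[) (t `^ (a - 1) * expR (- t)).

(** A paravector x = x_0 + underline x of R^(n+1) is x : 'rV[R]_n.+1, with x_0
    at index 0 and the coefficient of the l-th imaginary unit at [lift 0 l]. *)

Section Paravectors.
Variables (R : realType) (n : nat).
Local Open Scope complex_scope.
Local Notation CC := (clifford R[i] n).

Definition enorm (k : nat) (v : 'rV[R]_k) : R := Num.sqrt (\sum_j v 0 j ^+ 2).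

Definition imag_part (x : 'rV[R]_n.+1) : 'rV[R]_n := \row_l x 0 (lift 0 l).

Definition cl_vector (v : 'rV[R]_n) : CC := \sum_(l < n) (v 0 l)%:C *: cl_unit _ l.

Definition paravector (x : 'rV[R]_n.+1) : CC :=
  ((x 0 0)%:C)%:A + cl_vector (imag_part x).

Definition pconj (x : 'rV[R]_n.+1) : 'rV[R]_n.+1 :=
  \row_j if j == 0 then x 0 j else - x 0 j.

Definition real_point (s0 : R) : 'rV[R]_n.+1 := s0 *: delta_mx 0 0.

Definition imag_sphere : set 'rV[R]_n := [set I | enorm I = 1].

(* u + I v; for I in [imag_sphere] one has cl_vector I ^+ 2 = -1. *)
Definition slice_point (u v : R) (I : 'rV[R]_n) : 'rV[R]_n.+1 :=
  \row_j oapp (fun l => v * I 0 l) u (unlift 0 j).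

(* S_L^(-1)(s0, x) and S_R^(-1)(s0, x) for real s0, where
   s0^2 - 2 x_0 s0 + |x|^2 is a scalar; the value at x = s0 is 0. *)
Definition SL_kernel (s0 : R) (x : 'rV[R]_n.+1) : CC :=
  ((s0%:C)%:A - paravector (pconj x)) *
  (((s0 ^+ 2 - 2 * x 0 0 * s0 + enorm x ^+ 2)^-1)%:C)%:A.

Definition SR_kernel (s0 : R) (x : 'rV[R]_n.+1) : CC :=
  (((s0 ^+ 2 - 2 * x 0 0 * s0 + enorm x ^+ 2)^-1)%:C)%:A *
  ((s0%:C)%:A - paravector (pconj x)).

(* The power series of exp; limits are taken in each real coordinate. *)
Definition cl_exp (a : CC) : CC :=
  let S N := \sum_(0 <= k < N) (k`!%:R)^-1 *: a ^+ k in
  mk_clifford (fun A => limn (fun N => complex.Re (S N A)) +i*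
                        limn (fun N => complex.Im (S N A))).

End Paravectors.

Section SliceMonogenic.
Variables (R : realType) (n : nat).
Local Open Scope complex_scope.
Local Notation CC := (clifford R[i] n).
Implicit Types (U : set 'rV[R]_n.+1) (D : set (R * R)).

Definition axially_symmetric U : Prop :=
  forall x I, U x -> imag_sphere I ->
    U (slice_point (x 0 0) (enorm (imag_part x)) I).

Definition uv_domain U : set (R * R) :=
  [set z | forall I, imag_sphere I -> U (slice_point z.1 z.2 I)].

Definition eu : R * R := (1, 0).
Definition ev : R * R := (0, 1).

Definition C1_on D (h : R * R -> R) : Prop :=
  forall w, w = eu \/ w = ev -> forall z, D z ->
    derivable h z w /\ {for z, continuous (fun z' => 'D_w h z')}.

Definition cl_C1_on D (f : R * R -> CC) : Prop :=
  forall A, C1_on D (fun z => complex.Re (f z A)) /\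
            C1_on D (fun z => complex.Im (f z A)).

Definition cl_derive (w : R * R) (f : R * R -> CC) (z : R * R) : CC :=
  mk_clifford (fun A => 'D_w (fun z' => complex.Re (f z' A)) z +i*
                        'D_w (fun z' => complex.Im (f z' A)) z).

Definition slice_pair D (f0 f1 : R * R -> CC) : Prop :=
  [/\ cl_C1_on D f0, cl_C1_on D f1,
      forall u v, D (u, v) ->
        f0 (u, - v) = f0 (u, v) /\ f1 (u, - v) = - f1 (u, v)
    & forall z, D z ->
        cl_derive eu f0 z - cl_derive ev f1 z = 0 /\
        cl_derive ev f0 z + cl_derive eu f1 z = 0].

Definition left_components U (f : 'rV[R]_n.+1 -> CC) (f0 f1 : R * R -> CC) : Prop :=
  slice_pair (uv_domain U) f0 f1 /\
  forall u v I, imag_sphere I -> U (slice_point u v I) ->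
    f (slice_point u v I) = f0 (u, v) + cl_vector I * f1 (u, v).

Definition right_components U (f : 'rV[R]_n.+1 -> CC) (f0 f1 : R * R -> CC) : Prop :=
  slice_pair (uv_domain U) f0 f1 /\
  forall u v I, imag_sphere I -> U (slice_point u v I) ->
    f (slice_point u v I) = f0 (u, v) + f1 (u, v) * cl_vector I.

Definition left_slice_monogenic U (f : 'rV[R]_n.+1 -> CC) : Prop :=
  [/\ open U, axially_symmetric U & exists f0 f1, left_components U f f0 f1].

Definition right_slice_monogenic U (f : 'rV[R]_n.+1 -> CC) : Prop :=
  [/\ open U, axially_symmetric U & exists f0 f1, right_components U f f0 f1].

(* With scalar components, left and right slice monogenicity coincide. *)
Definition intrinsic_slice_monogenic U (f : 'rV[R]_n.+1 -> CC) : Prop :=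
  [/\ open U, axially_symmetric U & exists f0 f1 : R * R -> R[i],
      left_components U f (fun z => (f0 z)%:A) (fun z => (f1 z)%:A)].

Definition left_slice_extension (f : R -> CC) (F : 'rV[R]_n.+1 -> CC) : Prop :=
  left_slice_monogenic setT F /\ forall s0, F (real_point n s0) = f s0.

Definition right_slice_extension (f : R -> CC) (F : 'rV[R]_n.+1 -> CC) : Prop :=
  right_slice_monogenic setT F /\ forall s0, F (real_point n s0) = f s0.

End SliceMonogenic.

Definition c_const (R : realType) (n : nat) : R[i] :=
  Complex 0 1 *
  Complex (2 ^+ n * pi `^ (n.+1%:R / 2) * Gamma (n.+1%:R / 2)) 0.

(* Main.v *)
Require Import Defs.
From HB Require Import structures.
From mathcomp Require Import all_boot all_order all_algebra.
From mathcomp Require Import complex ring lra.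
From mathcomp Require Import all_classical all_reals all_analysis.
From mathcomp Require Import measurable_realfun.
Set Implicit Arguments.
Unset Strict Implicit.
Unset Printing Implicit Defensive.
Import Order.TTheory GRing.Theory Num.Theory.
Import numFieldNormedType.Exports.

Local Open Scope classical_set_scope.
Local Open Scope ring_scope.
Local Open Scope complex_scope.

(** The Fourier transform.  Put y = x - s0.  Since s0 is real, the coefficients
    of S_L^(-1)(s0, x) = S_R^(-1)(s0, x) are 0 or, up to a sign, the functions
    y_j / |y|^2, and the translation by s0 turns into the phase
    e^(- i s0 xi_0).  So one has to find the Fourier transform of y_j / |y|^2 on
    R^(n+1).  Write
      1 / |y|^2 = int_0^oo e^(- |y|^2 / (4 u)) / (4 u^2) du
    ([integral_newton_density]).  For fixed u the Fourier transform of y_j times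
    a Gaussian is again xi_j times a Gaussian ([gauss_coord], [gauss_wave]),
    and the integral over u of the transformed Gaussians is Euler's integral: it
    is Gamma((n+1)/2) |xi|^(-(n+1)) up to powers of 2 and pi
    ([integral_euler_density]).  This produces the constant c_n.

    All integrals are real: a complex exponential is replaced by the waves
    cos (x . xi + al), the sine being the wave with phase - pi / 2.  In the weak
    formulation the interchanges of integrals are three applications of Fubini's
    theorem ([wave_integral_pairing]).  They rest on two facts: the Fourier
    transform of a Schwartz function is integrable, because integration by parts
    shows that it stays bounded after multiplication by the product of the
    1 + x_j^2
    ([integrable_schwartz_wave]); and xi_j / |xi|^(n+1) is integrable against a
    Gaussian, because n >= 1 ([integrable_gaussian_riesz]).

    The extension to paravectors.  For I in the sphere, J = cl_vector I satisfies
    J^2 = -1, so (1 + i J) / 2 and (1 - i J) / 2 are complementary idempotents.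
    They diagonalize - i t (u + J v), and the exponential series is computed in
    closed form ([cl_exp_slice]); its two components satisfy the Cauchy-Riemann
    equations and stay so after multiplication by a constant
    ([slice_pair_exp]).  The extension is unique because two slice monogenic
    functions that agree on the real axis have components whose differences
    satisfy the Cauchy-Riemann equations and vanish for v = 0; such functions
    vanish ([cauchy_riemann_eq0]). *)

(** * Uniqueness for the Cauchy-Riemann equations *)

Lemma is_derive_continuous {R : realType} (f : R -> R) (x df : R) :
  is_derive x 1 f df -> {for x, continuous f}.
Proof. by move=> [Hf _]; apply/differentiable_continuous/derivable1_diffP. Qed.

Section ContinuousArithmetic.
Context {R : realType} {T : topologicalType}.
Implicit Types f g : T -> R.

Lemma contD f g : continuous f -> continuous g -> continuous (fun x => f x + g x).
Proof. by move=> cf cg x; apply: cvgD; [exact: cf | exact: cg]. Qed.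

Lemma contM f g : continuous f -> continuous g -> continuous (fun x => f x * g x).
Proof. by move=> cf cg x; apply: cvgM; [exact: cf | exact: cg]. Qed.

Lemma contN f : continuous f -> continuous (fun x => - f x).
Proof. by move=> cf x; apply: cvgN; exact: cf. Qed.

Lemma contB f g : continuous f -> continuous g -> continuous (fun x => f x - g x).
Proof. by move=> cf cg x; apply: cvgB; [exact: cf | exact: cg]. Qed.

Lemma cont_cst (c : R) : continuous (fun _ : T => c).
Proof. by move=> x; exact: cvg_cst. Qed.

End ContinuousArithmetic.
Arguments cont_cst {R T} c.

Section CauchyRiemannUniqueness.
Context {R : realType}.
Notation mu := (@lebesgue_measure R).

Lemma bounded_rectangle (f : R * R -> R) (p q r s : R) : continuous f ->
  exists M : R, forall x y : R, p <= x <= q -> r <= y <= s -> `|f (x, y)| <= M.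
Proof.
move=> cf.
have cK : compact (`[p, q] `*` `[r, s]).
  by apply: compact_setX; exact: segment_compact.
have : compact ((fun z => f z) @` (`[p, q] `*` `[r, s])).
  apply: continuous_compact => //; exact: continuous_subspaceT.
move=> /compact_bounded[M [_ HM]].
exists (M + 1) => x y xpq yrs; apply: (HM (M + 1)); first by rewrite ltrDl.
by exists (x, y) => //=; split; rewrite /= in_itv.
Qed.

Lemma mvt_bound (f df : R -> R) (a b M : R) : a <= b ->
  (forall x : R, a <= x <= b -> is_derive x 1 f (df x)) ->
  (forall x : R, a <= x <= b -> `|df x| <= M) ->
  `|f b - f a| <= M * (b - a).
Proof.
move=> ab Hf HM.
have [||c cab ->] := @MVT_segment R f df a b ab.
- by move=> x; rewrite in_itv /= => /andP[/ltW ax /ltW xb]; apply: Hf; rewrite ax.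
- apply: continuous_in_subspaceT => x; rewrite inE /= in_itv /= => xab.
  exact: is_derive_continuous (Hf x xab).
- rewrite normrM (ger0_norm (_ : 0 <= b - a)) ?subr_ge0//.
  by rewrite ler_wpM2r ?subr_ge0// HM// -in_itv.
Qed.

Lemma bound_from_axis (f df : R -> R) (v0 M v : R) : 0 <= v0 -> 0 <= M ->
  f 0 = 0 -> -1 <= v <= v0 + 1 ->
  (forall x : R, is_derive x 1 f (df x)) ->
  (forall x : R, -1 <= x <= v0 + 1 -> `|df x| <= M) -> `|f v| <= M * (v0 + 1).
Proof.
move=> v0_ge0 M0 f0 /andP[v1 v2] Hf HM.
have [v_ge0|v_lt0] := lerP 0 v.
  have Bd : forall x : R, 0 <= x <= v -> `|df x| <= M.
    by move=> x /andP[x1 x2]; apply: HM; apply/andP; split; lra.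
  have := mvt_bound v_ge0 (fun x _ => Hf x) Bd; rewrite f0 !subr0 => /le_trans; apply.
  by rewrite ler_wpM2l//; lra.
have Bd : forall x : R, v <= x <= 0 -> `|df x| <= M.
  by move=> x /andP[x1 x2]; apply: HM; apply/andP; split; lra.
have := mvt_bound (ltW v_lt0) (fun x _ => Hf x) Bd.
rewrite f0 sub0r normrN => /le_trans; apply.
by rewrite ler_wpM2l//; lra.
Qed.

Lemma segment_integrable (f : R -> R) (p q : R) : continuous f ->
  mu.-integrable `[p, q] (EFin \o f).
Proof.
move=> cf; apply: continuous_compact_integrable; first exact: segment_compact.
exact: continuous_subspaceT.
Qed.

Lemma Rintegral_segment_cst (p q c : R) : p <= q ->
  (\int[mu]_(u in `[p, q]) c)%R = c * (q - p).
Proof.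
move=> pq; rewrite Rintegral_cst//= lebesgue_measure_itv /= lte_fin.
move: pq; rewrite le_eqVlt => /predU1P[->|pq]; first by rewrite ltxx subrr.
by rewrite pq.
Qed.

Lemma Rintegral_segment_lower (f : R -> R) (p r s q c : R) : continuous f ->
  p <= r -> r <= s -> s <= q ->
  (forall u : R, p <= u <= q -> 0 <= f u) ->
  (forall u : R, r <= u <= s -> c <= f u) ->
  c * (s - r) <= (\int[mu]_(u in `[p, q]) f u)%R.
Proof.
move=> cf pr rs sq f0 fc.
have sub : `[r, s]%classic `<=` `[p, q]%classic.
  by move=> u; rewrite /= !in_itv /= => /andP[ru us]; rewrite (le_trans pr ru) (le_trans us sq).
have DE : `[p, q]%classic = `[r, s] `|` (`[p, q] `\` `[r, s]) by rewrite setDUK.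
have mD : measurable (`[p, q] `\` `[r, s] : set R) by exact: measurableD.
rewrite DE Rintegral_setU//; last 2 first.
- by rewrite -DE; exact: segment_integrable.
- by apply/disj_setPS => u [? [_ ?]].
rewrite -[leLHS]addr0; apply: lerD; last first.
  by apply: Rintegral_ge0 => u []; rewrite /= in_itv /= => /f0.
have ic : mu.-integrable `[r, s] (EFin \o (fun=> c)).
  by apply: segment_integrable; exact: cst_continuous.
rewrite -Rintegral_segment_cst//; apply: le_Rintegral ic (segment_integrable _ _ cf) _ => //.
Qed.

(** Here a + i b is holomorphic in z = u + i v and vanishes on the real axis.
    Put w = (u0 + i v0).  Multiplied by e^(- l (z - w)^2) it has the real part A
    and the imaginary part B, and the integral T of A over the segment
    |u - u0| <= d at height v has a derivative in v that consists of boundary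
    terms.  These are of order e^(- l), as d = v0 + 1 exceeds |v - v0| for
    0 <= v <= v0, so T = O (e^(- l)) at height v0.  But there the weight is the
    real Gaussian e^(- l (u - u0)^2); if a (u0, v0) > 0, it would give a lower
    bound of order e^(- l h^2 / 4) with h <= 1, which is impossible for large l.
    The argument uses only C^1 functions and integrals over segments. *)
Section GaussianWeight.
Variables (a b au av : R -> R -> R).
Hypothesis Ha1 : forall u v : R, is_derive u 1 (a^~ v) (au u v).
Hypothesis Ha2 : forall u v : R, is_derive v 1 (a u) (av u v).
Hypothesis Hb1 : forall u v : R, is_derive u 1 (b^~ v) (- av u v).
Hypothesis Hb2 : forall u v : R, is_derive v 1 (b u) (au u v).
Hypothesis cau : continuous (fun z : R * R => au z.1 z.2).
Hypothesis cav : continuous (fun z : R * R => av z.1 z.2).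
Hypothesis a0 : forall u, a u 0 = 0.
Hypothesis b0 : forall u, b u 0 = 0.
Variables (u0 v0 : R).
Hypothesis v0_ge0 : 0 <= v0.

Let d := v0 + 1.
Let E (l u v : R) :=
  expR (- l * ((u - u0) * (u - u0) - (v - v0) * (v - v0))).
Let th (l u v : R) := 2 * l * (u - u0) * (v - v0).
Let A l u v := E l u v * (a u v * cos (th l u v) + b u v * sin (th l u v)).
Let B l u v := E l u v * (b u v * cos (th l u v) - a u v * sin (th l u v)).
Let A' l u v := E l u v * (2 * l * (v - v0) * (a u v * cos (th l u v) + b u v * sin (th l u v))
  + (av u v * cos (th l u v) + au u v * sin (th l u v))
  + 2 * l * (u - u0) * (b u v * cos (th l u v) - a u v * sin (th l u v))).

Let dA (l u v : R) : is_derive v 1 (A l u) (A' l u v).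
Proof.
have := Ha2 u v; have := Hb2 u v => h1 h2.
apply: is_derive_eq.
by rewrite /A' /E /th /GRing.scale /=; ring.
Qed.

Let dB (l u v : R) : is_derive u 1 ((B l)^~ v) (- A' l u v).
Proof.
have := Ha1 u v; have := Hb1 u v => h1 h2.
apply: is_derive_eq.
by rewrite /A' /E /th /GRing.scale /=; ring.
Qed.

Let cA' (l v : R) : continuous (fun u => A' l u v).
Proof.
have c_sec (f : R * R -> R) : continuous f -> continuous (fun u => f (u, v)).
  move=> cf u; apply: (@continuous_comp _ _ _ (fun u : R => (u, v)) f u _ (cf (u, v))).
  by apply: differentiable_continuous; exact: differentiable_pair.
have c1 : continuous (fun u => au u v) := c_sec _ cau.
have c2 : continuous (fun u => av u v) := c_sec _ cav.
have cd (f df : R -> R) : (forall x : R, is_derive x 1 f (df x)) -> continuous f.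
  by move=> Hf x; apply: is_derive_continuous (Hf x).
have ca := cd _ _ (Ha1 ^~ v); have cb := cd _ _ (Hb1 ^~ v).
have dc (f : R -> R) : (forall x : R, derivable f x 1) -> continuous f.
  by move=> Hf x; apply/differentiable_continuous/derivable1_diffP.
have cE : continuous (fun u => E l u v) by apply: dc => x; exact: ex_derive.
have cc : continuous (fun u => cos (th l u v)) by apply: dc => x; exact: ex_derive.
have cs : continuous (fun u => sin (th l u v)) by apply: dc => x; exact: ex_derive.
have cu : continuous (fun u : R => 2 * l * (u - u0)) by apply: dc => x; exact: ex_derive.
exact: (contM cE (contD (contD (contM (cont_cst _)
  (contD (contM ca cc) (contM cb cs))) (contD (contM c2 cc) (contM c1 cs)))
  (contM cu (contB (contM cb cc) (contM ca cs))))).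
Qed.

(** On the rectangle a and b are bounded by their partial derivatives in v, as
    they vanish on the axis. *)
Let bounded_data : exists2 M : R, 0 <= M &
  forall u v : R, u0 - d <= u <= u0 + d -> -1 <= v <= v0 + 1 ->
  [/\ `|au u v| <= M, `|av u v| <= M, `|a u v| <= M & `|b u v| <= M].
Proof.
have hv0 : 0 <= v0 := v0_ge0.
have [M1 H1] := bounded_rectangle (u0 - d) (u0 + d) (-1) (v0 + 1) cau.
have [M2 H2] := bounded_rectangle (u0 - d) (u0 + d) (-1) (v0 + 1) cav.
pose M : R := `|M1| + `|M2|.
have H1' (u v : R) : u0 - d <= u <= u0 + d -> -1 <= v <= v0 + 1 -> `|au u v| <= M.
  move=> hu hv; apply: le_trans (H1 u v hu hv) _.
  by rewrite (le_trans (ler_norm _))// lerDl.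
have H2' (u v : R) : u0 - d <= u <= u0 + d -> -1 <= v <= v0 + 1 -> `|av u v| <= M.
  move=> hu hv; apply: le_trans (H2 u v hu hv) _.
  by rewrite (le_trans (ler_norm _))// lerDr.
have M0 : 0 <= M by rewrite addr_ge0.
exists (M + M * (v0 + 1)).
  by rewrite addr_ge0// mulr_ge0//; lra.
have le1 : M <= M + M * (v0 + 1) by rewrite lerDl mulr_ge0//; lra.
have le2 : M * (v0 + 1) <= M + M * (v0 + 1) by rewrite lerDr.
move=> u v hu hv; split.
- exact: le_trans (H1' _ _ hu hv) le1.
- exact: le_trans (H2' _ _ hu hv) le1.
- apply: le_trans le2; apply: (bound_from_axis (df := av u) hv0) => // x hx; exact: H2'.
- apply: le_trans le2; apply: (bound_from_axis (df := au u) hv0) => // x hx; exact: H1'.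
Qed.

Let cA (l v : R) : continuous (fun u => A l u v).
Proof.
have cd (f df : R -> R) : (forall x : R, is_derive x 1 f (df x)) -> continuous f.
  by move=> Hf x; apply: is_derive_continuous (Hf x).
have ca := cd _ _ (Ha1 ^~ v); have cb := cd _ _ (Hb1 ^~ v).
have dc (f : R -> R) : (forall x : R, derivable f x 1) -> continuous f.
  by move=> Hf x; apply/differentiable_continuous/derivable1_diffP.
have cE : continuous (fun u => E l u v) by apply: dc => x; exact: ex_derive.
have cc : continuous (fun u => cos (th l u v)) by apply: dc => x; exact: ex_derive.
have cs : continuous (fun u => sin (th l u v)) by apply: dc => x; exact: ex_derive.
exact: (contM cE (contD (contM ca cc) (contM cb cs))).
Qed.

Let D : set R := `[u0 - d, u0 + d].

Let continuous_integrable (f : R -> R) : continuous f -> mu.-integrable D (EFin \o f).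
Proof. exact: segment_integrable. Qed.

Let T (l v : R) := (\int[mu]_(u in D) A l u v)%R.

(** Differentiation under the integral sign; by the Cauchy-Riemann equations the
    integrand A' is minus the u-derivative of B. *)
Let dT (l v : R) : 0 <= l -> 0 <= v <= v0 ->
  is_derive v 1 (T l) (- (B l (u0 + d) v - B l (u0 - d) v)).
Proof.
move=> l0 /andP[v1 v2]; have hv0 : 0 <= v0 := v0_ge0.
have [M M0 HM] := bounded_data.
have Iv : `]-1, (v0 + 1)[%classic v by rewrite /= in_itv /=; apply/andP; split; lra.
pose K := expR (l * (v0 + 1) ^+ 2) * (2 * l * (v0 + 1) * (M + M) + (M + M) + 2 * l * d * (M + M)).
have d0 : 0 <= d by rewrite /d; lra.
have K0 : 0 <= K.
  by rewrite mulr_ge0 ?expR_ge0// !addr_ge0 ?mulr_ge0// ?addr_ge0//; lra.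
have intA x : `]-1, (v0 + 1)[%classic x -> mu.-integrable D (EFin \o (fun u => A l u x)).
  by move=> _; exact: continuous_integrable.
have derA (x y : R) : `]-1, (v0 + 1)[%classic x -> D y -> derivable (A l y) x 1.
  by move=> _ _; have [] := dA l y x.
have intK : mu.-integrable D (EFin \o cst K).
  by apply: continuous_integrable; exact: cst_continuous.
have dAE x y : partial1of2 (fun v u => A l u v) x y = A' l y x.
  by rewrite partial1of2E; have [_ ->] := dA l y x.
have bK (x y : R) : `]-1, (v0 + 1)[%classic x -> D y ->
    `|partial1of2 (fun v u => A l u v) x y| <= cst K y.
  rewrite /D /= !in_itv /= => /andP[x1 x2] hy.
  have hx : -1 <= x <= v0 + 1 by rewrite !ltW.
  have [h1 h2 h3 h4] := HM _ _ hy hx.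
  rewrite dAE /A' /K normrM.
  have trig (p q t : R) : `|p| <= M -> `|q| <= M -> `|p * cos t + q * sin t| <= M + M.
    move=> hp hq; apply: le_trans (ler_normD _ _) _; rewrite !normrM.
    by apply: lerD; rewrite -[leRHS]mulr1 ler_pM ?normr_ge0// ler_norml ?cos_geN1 ?cos_le1 ?sin_geN1 ?sin_le1.
  have trig' (p q t : R) : `|p| <= M -> `|q| <= M -> `|p * cos t - q * sin t| <= M + M.
    by move=> hp hq; rewrite -mulNr; apply: trig => //; rewrite normrN.
  have nxv : `|x - v0| <= v0 + 1 by rewrite ler_norml; apply/andP; split; lra.
  have nyu : `|y - u0| <= d by rewrite ler_norml; move/andP: hy => [? ?]; apply/andP; split; lra.
  apply: ler_pM => //.
    rewrite ger0_norm ?expR_ge0// /E ler_expR mulNr -mulrN ler_wpM2l//.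
    rewrite opprB lerBlDr -!expr2.
    rewrite -[(x - v0) ^+ 2]real_normK ?num_real// ler_wpDr ?sqr_ge0//.
    by rewrite lerXn2r ?nnegrE//; lra.
  apply: le_trans (ler_normD _ _) _; apply: lerD.
    apply: le_trans (ler_normD _ _) _; apply: lerD; last exact: trig.
    rewrite normrM; apply: ler_pM => //; last exact: trig.
    by rewrite normrM (ger0_norm (_ : 0 <= 2 * l)) ?mulr_ge0// ler_wpM2l// mulr_ge0.
  rewrite normrM; apply: ler_pM => //; last exact: trig'.
  by rewrite normrM (ger0_norm (_ : 0 <= 2 * l)) ?mulr_ge0// ler_wpM2l// mulr_ge0.
have mD : measurable D by exact: measurable_itv.
have cNA' := contN (@cA' l v).
have dT := @derivable_under_integral _ _ _ mu (fun v u => A l u v) D mD v _ _ Iv intA derA (cst K) (fun _ => K0) intK bK.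
have := @differentiation_under_integral _ _ _ mu (fun v u => A l u v) D mD v _ _ Iv intA derA (cst K) (fun _ => K0) intK bK.
rewrite derive1E => HT; apply: DeriveDef; first exact: dT.
rewrite {}HT /Rintegral.
under eq_integral do rewrite dAE -[A' _ _ _]opprK EFinN.
rewrite integralN /=; last first.
  exact: integrable_add_def (continuous_integrable cNA').
rewrite fineN; congr (- _).
have cB : continuous (fun u => B l u v).
  by move=> u; exact: is_derive_continuous (dB l u v).
rewrite (@continuous_FTC2 _ _ (fun u => B l u v)) ?EFinB//.
- by rewrite /d; lra.
- exact: continuous_subspaceT cNA'.
- split; first by move=> u _; have [] := dB l u v.
  + by apply: cvg_at_right_filter; exact: cB.
  + by apply: cvg_at_left_filter; exact: cB.
- by move=> u _; rewrite derive1E; have [_ ->] := dB l u v.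
Qed.

Lemma zero_on_axis_npos : a u0 v0 <= 0.
Proof.
rewrite leNgt; apply/negP => apos; have hv0 : 0 <= v0 := v0_ge0.
have [M M0 HM] := bounded_data.
have d0 : 1 <= d by rewrite /d; lra.
have bB (l v s : R) : 0 <= l -> 0 <= v <= v0 -> s = u0 + d \/ s = u0 - d ->
    `|B l s v| <= expR (- l) * (M + M).
  move=> l0 /andP[v1 v2] hs.
  have sd : (s - u0) * (s - u0) = d * d by case: hs => ->; ring.
  have hs' : u0 - d <= s <= u0 + d by case: hs => ->; apply/andP; split; lra.
  have hv : -1 <= v <= v0 + 1 by apply/andP; split; lra.
  have [_ _ h3 h4] := HM s v hs' hv.
  rewrite /B normrM; apply: ler_pM => //.
    rewrite ger0_norm ?expR_ge0// /E ler_expR sd mulNr lerN2.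
    have p1 : 0 <= v * (2 * v0 - v) by apply: mulr_ge0; lra.
    apply: ler_peMr => //; rewrite /d.
    rewrite (_ : _ - _ = 1 + 2 * v0 + v * (2 * v0 - v)); last by ring.
    by lra.
  apply: le_trans (ler_normB _ _) _; rewrite !normrM.
  by apply: lerD; rewrite -[leRHS]mulr1 ler_pM ?normr_ge0// ler_norml ?cos_geN1 ?cos_le1 ?sin_geN1 ?sin_le1.
(* T vanishes at height 0; integrate its derivative up to v0 *)
have TT (l : R) : 0 <= l -> T l v0 <= 4 * M * v0 * expR (- l).
  move=> l0.
  have T0 : T l 0 = 0.
    rewrite /T (_ : (fun u => A l u 0) = (fun=> 0)); last first.
      by apply/funext => u; rewrite /A a0 b0 !mul0r addr0 mulr0.
    by rewrite Rintegral_segment_cst ?mul0r//; lra.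
  have B4 : forall v : R, 0 <= v <= v0 -> `|- (B l (u0 + d) v - B l (u0 - d) v)| <= expR (- l) * (4 * M).
    move=> v hv; rewrite normrN; apply: le_trans (ler_normB _ _) _.
    have h1 := bB l v _ l0 hv (or_introl erefl).
    have h2 := bB l v _ l0 hv (or_intror erefl).
    by lra.
  have := mvt_bound hv0 (fun v hv => dT l0 hv) B4.
  rewrite T0 !subr0 => /ler_normlW; lra.
have ca : continuous (fun u => a u v0).
  by move=> u; exact: is_derive_continuous (Ha1 u v0).
pose dl := a u0 v0 / 2.
have dl0 : 0 < dl by rewrite divr_gt0.
have [e0 /= e0_gt0 He] : \forall u \near u0, dl < a u v0.
  have dla : dl < a u0 v0 by rewrite /dl; lra.
  exact: (cvgr_gt _ (ca u0) _ dla).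
pose h : R := Num.min 1 (e0 / 2).
have h0 : 0 < h by rewrite lt_min ltr01 divr_gt0.
have h1 : h <= 1 by rewrite ge_min lexx.
have hd (u : R) : `|u - u0| <= h -> dl <= a u v0.
  move=> uh; apply/ltW/He => /=; rewrite distrC (le_lt_trans uh)//.
  by rewrite gt_min; apply/orP; right; lra.
have TA (l : R) : T l v0 = (\int[mu]_(u in `[u0 - d, u0 + d]) (expR (- l * ((u - u0) * (u - u0))) * a u v0))%R.
  apply: eq_Rintegral => u _; rewrite /A /E /th subrr mulr0 subr0.
  by rewrite mulr0 cos0 sin0 mulr1 mulr0 addr0.
(* the integrand is at least dl e^(- l h^2 / 4) for |u - u0| <= h / 2, it is
   nonnegative for |u - u0| <= h, and at least - M e^(- l h^2) elsewhere *)
have lower (l : R) : 0 <= l ->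
    expR (- l * (h * h / 4)) * dl * h <= T l v0 + M * expR (- l * (h * h)) * (2 * d).
  move=> l0; rewrite TA.
  pose f (u : R) := expR (- l * ((u - u0) * (u - u0))) * a u v0.
  have cf : continuous f.
    apply: contM ca => u; apply/differentiable_continuous/derivable1_diffP.
    exact: ex_derive.
  have E1 : M * expR (- l * (h * h)) * (2 * d) =
      (\int[mu]_(u in `[u0 - d, u0 + d]) (M * expR (- l * (h * h))))%R.
    by rewrite Rintegral_segment_cst; [congr (_ * _); ring | lra].
  rewrite E1 -RintegralD//; [|exact: segment_integrable | by apply: segment_integrable; exact: cst_continuous].
  have hE : h = (u0 + h / 2) - (u0 - h / 2) by lra.
  rewrite [X in _ * X <= _]hE; apply: Rintegral_segment_lower.
  - exact: contD cf (cont_cst _).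
  - by lra.
  - by lra.
  - by lra.
  - move=> u hu; have [uh|uh] := lerP `|u - u0| h.
      rewrite /f addr_ge0 ?mulr_ge0 ?expR_ge0//.
      by rewrite (le_trans (ltW dl0))// hd.
    have hv : -1 <= v0 <= v0 + 1 by apply/andP; split; lra.
    have [_ _ + _] := HM u v0 hu hv; rewrite ler_norml => /andP[aM _].
    have e1 : expR (- l * ((u - u0) * (u - u0))) <= expR (- l * (h * h)).
      rewrite ler_expR ler_wnM2l ?oppr_le0// -!expr2 -[leRHS]real_normK ?num_real//.
      by rewrite lerXn2r ?nnegrE ?(ltW h0)// ltW.
    have e2 := expR_ge0 (- l * ((u - u0) * (u - u0))).
    by rewrite /f; nra.
  - move=> u /andP[ur us].
    have uh : `|u - u0| <= h / 2 by rewrite ler_norml; apply/andP; split; lra.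
    rewrite -[leLHS]addr0 lerD ?mulr_ge0 ?expR_ge0//.
    rewrite /f ler_pM ?expR_ge0 ?(ltW dl0)//; last by apply: hd; lra.
    rewrite ler_expR ler_wnM2l ?oppr_le0// -expr2 -[leLHS]real_normK ?num_real//.
    rewrite (_ : h * h / 4 = (h / 2) ^+ 2); last by field.
    by rewrite lerXn2r ?nnegrE// divr_ge0// ltW.
pose K := 4 * M * v0 + 2 * d * M.
have K0 : 0 <= K by rewrite addr_ge0 ?mulr_ge0//; lra.
have hh : 0 < h * h by rewrite mulr_gt0.
have main (l : R) : 0 <= l -> l * (h * h * (3 / 4) * (dl * h)) <= K.
  move=> l0; have h2 := lower l l0; have h3 := TT l l0.
  have h4 : expR (- l) <= expR (- l * (h * h))
    by rewrite ler_expR mulNr lerN2 ler_piMr// mulr_ile1// ltW.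
  have h5 : expR (- l * (h * h / 4)) * (dl * h) <= K * expR (- l * (h * h)).
    have : 4 * M * v0 * expR (- l) <= 4 * M * v0 * expR (- l * (h * h)).
      by rewrite ler_wpM2l// !mulr_ge0.
    move: h2; rewrite mulrA => h2 h6; rewrite /K; lra.
  have : expR (l * (h * h)) * (expR (- l * (h * h / 4)) * (dl * h)) <=
         expR (l * (h * h)) * (K * expR (- l * (h * h))).
    by rewrite ler_wpM2l ?expR_ge0.
  rewrite [X in X <= _ -> _]mulrA -expRD [X in _ <= X -> _]mulrCA -expRD.
  rewrite (_ : l * (h * h) + - l * (h * h) = 0) ?expR0 ?mulr1; last by ring.
  move=> /(le_trans _); apply.
  rewrite (_ : l * (h * h) + - l * (h * h / 4) = l * (h * h * (3 / 4))); last by field.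
  rewrite mulrA ler_wpM2r//; first by rewrite ltW ?mulr_gt0.
  by apply: le_trans (expR_ge1Dx _); rewrite lerDr.
pose c := h * h * (3 / 4) * (dl * h).
have c0 : 0 < c by rewrite !mulr_gt0.
have l0 : 0 <= (K + 1) / c by apply: divr_ge0; [exact: addr_ge0 | exact: ltW].
by have := main _ l0; rewrite -/c divfK ?gt_eqF//; lra.
Qed.

End GaussianWeight.

(** [zero_on_axis_npos] applied to the real parts of f, - f, - i f and i f, where
    f = a + i b. *)
Lemma cauchy_riemann_eq0 (a b au av : R -> R -> R) :
  (forall u v : R, is_derive u 1 (a^~ v) (au u v)) ->
  (forall u v : R, is_derive v 1 (a u) (av u v)) ->
  (forall u v : R, is_derive u 1 (b^~ v) (- av u v)) ->
  (forall u v : R, is_derive v 1 (b u) (au u v)) ->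
  continuous (fun z : R * R => au z.1 z.2) ->
  continuous (fun z : R * R => av z.1 z.2) ->
  (forall u, a u 0 = 0) -> (forall u, b u 0 = 0) ->
  forall u v, 0 <= v -> a u v = 0 /\ b u v = 0.
Proof.
move=> Ha1 Ha2 Hb1 Hb2 cau cav a0 b0 u v v0.
have dN (f : R -> R) (x df : R) : is_derive x 1 f df -> is_derive x 1 (fun y => - f y) (- df).
  by move=> ?; exact: is_deriveN.
have cNu := contN cau; have cNv := contN cav.
have z0 (f : R -> R) : (forall u, f u = 0) -> forall u, - f u = 0.
  by move=> f0 x; rewrite f0 oppr0.
have dN' (f : R -> R) (x df : R) : is_derive x 1 f (- df) -> is_derive x 1 (fun y => - f y) df.
  by move=> ?; rewrite -[df]opprK; exact: is_deriveN.
have nn (f df : R -> R) : (forall x : R, is_derive x 1 f (df x)) -> forall x : R, is_derive x 1 f (- - df x).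
  by move=> H x; rewrite opprK.
split; apply/eqP; rewrite eq_le; apply/andP; split.
- exact: (zero_on_axis_npos Ha1 Ha2 Hb1 Hb2 cau cav a0 b0).
- rewrite -oppr_le0.
  exact: (@zero_on_axis_npos (fun u v => - a u v) (fun u v => - b u v)
    (fun u v => - au u v) (fun u v => - av u v)
    (fun u v => dN _ _ _ (Ha1 u v)) (fun u v => dN _ _ _ (Ha2 u v))
    (fun u v => dN _ _ _ (Hb1 u v)) (fun u v => dN _ _ _ (Hb2 u v)) cNu cNv
    (z0 _ a0) (z0 _ b0) u v v0).
- exact: (@zero_on_axis_npos b (fun u v => - a u v)
    (fun u v => - av u v) (fun u v => au u v)
    Hb1 Hb2 (fun u v => dN _ _ _ (Ha1 u v)) (fun u v => dN _ _ _ (Ha2 u v)) cNv cau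
    b0 (z0 _ a0) u v v0).
- rewrite -oppr_le0.
  exact: (@zero_on_axis_npos (fun u v => - b u v) a
    (fun u v => av u v) (fun u v => - au u v)
    (fun u v => dN' _ _ _ (Hb1 u v)) (fun u v => dN _ _ _ (Hb2 u v))
    (fun u v => nn _ _ (Ha1 ^~ v) u)
    Ha2 cav cNu (z0 _ b0) a0 u v v0).
Qed.

End CauchyRiemannUniqueness.

(** * The complex exponential as a limit of partial sums *)

Section ExponentialSums.
Context {F : numFieldType}.
Implicit Types (x w z : F).

Definition exp_sum N z : F := \sum_(0 <= k < N) (k`!%:R)^-1 * z ^+ k.

Let t j z : F := (j`!%:R)^-1 * z ^+ j.

Let fact_neq0 k : k`!%:R != 0 :> F.
Proof. by rewrite pnatr_eq0 -lt0n fact_gt0. Qed.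

Let binomial_term k x w : t k (x + w) = \sum_(0 <= j < k.+1) t (k - j) x * t j w.
Proof.
rewrite /t exprDn mulr_sumr big_mkord; apply: eq_bigr => j _.
have jk : (j <= k)%N by rewrite -ltnS.
have E : ('C(k, j) * (j`! * (k - j)`!))%N%:R = k`!%:R :> F by rewrite bin_fact.
rewrite -mulr_natr -E !natrM !invfM.
have b0 : 'C(k, j)%:R != 0 :> F by rewrite pnatr_eq0 -lt0n bin_gt0.
by field; rewrite b0 !fact_neq0.
Qed.

(** The product of two partial sums contains the square of index pairs, the partial
    sum at x + w only the triangle l + j < N. *)
Lemma exp_sumM N x w : exp_sum N x * exp_sum N w - exp_sum N (x + w) =
  \sum_(0 <= j < N) \sum_(0 <= l < N | (N <= l + j)%N)
    ((l`!%:R)^-1 * x ^+ l) * ((j`!%:R)^-1 * w ^+ j).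
Proof.
rewrite [RHS](_ : _ = \sum_(0 <= j < N) \sum_(0 <= l < N | (N <= l + j)%N) t l x * t j w)//.
have -> : exp_sum N (x + w) =
    \sum_(0 <= j < N) \sum_(0 <= l < N | ~~ (N <= l + j)%N) t l x * t j w.
  rewrite /exp_sum; under eq_bigr do rewrite -/(t _ _) binomial_term.
  have step k : (0 <= k < N)%N -> \sum_(0 <= j < k.+1) t (k - j) x * t j w =
      \sum_(0 <= j < N | (j <= k)%N) t (k - j) x * t j w.
    move=> /andP[_ kN]; rewrite (@big_nat_widen _ _ _ 0 k.+1 N)//.
  rewrite (eq_big_nat _ _ step) (@exchange_big_dep_nat _ _ _ _ _ _ _ _ _ predT)//=.
  apply: eq_big_nat => j /andP[_ jN].
  rewrite (@big_cat_nat _ _ _ j)//=; last exact: ltnW.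
  rewrite big_nat_cond big1 ?add0r; last first.
    by move=> i /andP[/andP[_ ij]]; rewrite leqNgt ij.
  rewrite -{1}[j]add0n big_addn.
  rewrite (@big_nat_widen _ _ _ 0 (N - j) N) ?leq_subr//=.
  apply: eq_big => [i|i _]; last by rewrite addnK.
  by rewrite leq_addl -ltnNge ltn_subRL addnC.
rewrite /exp_sum mulr_sumr -sumrB; apply: eq_bigr => j _.
rewrite mulr_suml (bigID (fun l => (N <= l + j)%N)) /= addrK.
by [].
Qed.

(** All terms of the defect have nonnegative coefficients, so it is dominated by the
    defect at the norms, which concerns the real exponential. *)
Lemma norm_exp_sumM N x w :
  `|exp_sum N x * exp_sum N w - exp_sum N (x + w)| <=
  exp_sum N `|x| * exp_sum N `|w| - exp_sum N (`|x| + `|w|).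
Proof.
rewrite !exp_sumM; apply: le_trans (ler_norm_sum _ _ _) _; apply: ler_sum => j _.
apply: le_trans (ler_norm_sum _ _ _) _; apply: ler_sum => l _.
by rewrite !normrM !normfV !normr_nat !normrX.
Qed.

End ExponentialSums.

Section ComplexExponential.
Context {R : realType}.
Implicit Types (z : R[i]) (x y : R).

Definition cexp z : R[i] := (expR (complex.Re z))%:C * expi (complex.Im z).

Lemma exp_sum_real N x : exp_sum N x%:C = (exp_sum N x)%:C :> R[i].
Proof.
rewrite /exp_sum rmorph_sum; apply: eq_bigr => k _.
by rewrite rmorphM fmorphV rmorph_nat rmorphXn.
Qed.

Lemma exp_sum_cvg x : exp_sum N x @[N --> \oo] --> expR x.
Proof.
rewrite (_ : (fun N => exp_sum N x) = series (exp_coeff x)).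
  exact: is_cvg_series_exp_coeff.
apply/funext => N; rewrite /exp_sum /series /=; apply: eq_bigr => k _.
by rewrite /exp_coeff /= mulrC.
Qed.

Lemma Re_sum (I : Type) (r : seq I) (P : pred I) (f : I -> R[i]) :
  complex.Re (\sum_(j <- r | P j) f j) = \sum_(j <- r | P j) complex.Re (f j).
Proof. exact: (@raddf_sum (Rcomplex R) R (@complex.Re R)). Qed.

Lemma Im_sum (I : Type) (r : seq I) (P : pred I) (f : I -> R[i]) :
  complex.Im (\sum_(j <- r | P j) f j) = \sum_(j <- r | P j) complex.Im (f j).
Proof. exact: (@raddf_sum (Rcomplex R) R (@complex.Im R)). Qed.

Lemma expi_coeff k y : (k`!%:R)^-1 * (y *i) ^+ k = cos_coeff y k +i* sin_coeff y k.
Proof.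
have yi : y *i = y%:C * 'i%C by apply/eqP; rewrite eq_complex /= !(mulr0, mul0r, mulr1, subr0, addr0) !eqxx.
have ik : 'i%C ^+ k = ((~~ odd k)%:R * (-1) ^+ k./2) +i* ((odd k)%:R * (-1) ^+ k.-1./2) :> R[i].
  have i2 j : 'i%C ^+ j.*2 = ((-1) ^+ j)%:C :> R[i].
    by rewrite -mul2n exprM sqr_i rmorphXn rmorphN1.
  rewrite -[k]odd_double_half; case: (odd k); rewrite ?add1n ?add0n /=.
    rewrite odd_double /= !doubleK exprS i2; apply/eqP.
    by rewrite eq_complex /=; apply/andP; split; apply/eqP; ring.
  by rewrite i2 odd_double /= mul0r mul1r doubleK.
rewrite yi exprMn ik /cos_coeff /sin_coeff /= -exprnP -rmorphXn /=.
rewrite -[k`!%:R](rmorph_nat (real_complex R)) -fmorphV; apply/eqP.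
by rewrite eq_complex /=; apply/andP; split; apply/eqP; rewrite ?fctE; ring.
Qed.

Lemma norm_realC x : `|x%:C : R[i]| = `|x|%:C.
Proof. by rewrite normc_def /= expr0n /= addr0 sqrtr_sqr. Qed.

Lemma norm_imagC y : `|y *i : R[i]| = `|y|%:C.
Proof. by rewrite normc_def /= expr0n /= add0r sqrtr_sqr. Qed.

Lemma norm_Re_le z x : `|z| <= x%:C -> `|complex.Re z| <= x.
Proof. by move=> zx; rewrite -lecR; apply: le_trans zx; exact: normc_ge_Re. Qed.

Lemma norm_Im_le z x : `|z| <= x%:C -> `|complex.Im z| <= x.
Proof.
move=> zx; rewrite -[complex.Im z]opprK -ReiNIm normrN; apply: norm_Re_le.
by rewrite normrM norm_imagC normr1 mulr1.
Qed.

(** The partial sums at x + i y differ from the product of those at x and at i y by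
    a defect that tends to zero, since it does so for the real exponential; the
    sums at i y are those of cos and sin. *)
Lemma exp_sum_cexp z :
  complex.Re (exp_sum N z) @[N --> \oo] --> complex.Re (cexp z) /\
  complex.Im (exp_sum N z) @[N --> \oo] --> complex.Im (cexp z).
Proof.
case: z => x y.
have E : x +i* y = x%:C + y *i by apply/eqP; rewrite eq_complex /= addr0 add0r !eqxx.
pose r N := exp_sum N `|x| * exp_sum N `|y| - exp_sum N (`|x| + `|y|).
have r0 : r N @[N --> \oo] --> 0.
  rewrite -(subrr (expR `|x| * expR `|y|)) -{2}expRD.
  apply: cvgB; last exact: exp_sum_cvg.
  by apply: cvgM; exact: exp_sum_cvg.
pose D N : R[i] := exp_sum N x%:C * exp_sum N (y *i) - exp_sum N (x%:C + y *i).
have Dr N : `|D N| <= (r N)%:C.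
  apply: le_trans (norm_exp_sumM _ _ _) _.
  by rewrite norm_realC norm_imagC -rmorphD !exp_sum_real -rmorphM -rmorphB.
have small (f : nat -> R) : (forall N, `|f N| <= r N) -> f N @[N --> \oo] --> 0.
  move=> fr; apply: (@squeeze_cvgr _ _ _ _ (fun N => - r N) r) => //.
    by apply: nearW => N; rewrite -ler_norml fr.
  by rewrite -oppr0; exact: cvgN.
have DE N : exp_sum N (x +i* y) = exp_sum N x%:C * exp_sum N (y *i) - D N.
  by rewrite E /D subKr.
have yE N : exp_sum N (y *i) = series (cos_coeff y) N +i* series (sin_coeff y) N.
  rewrite /exp_sum; under eq_bigr do rewrite expi_coeff.
  by apply/eqP; rewrite eq_complex Re_sum Im_sum !eqxx.
have cvgC : series (cos_coeff y) N @[N --> \oo] --> cos y.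
  by rewrite unlock; exact: is_cvg_series_cos_coeff.
have cvgS : series (sin_coeff y) N @[N --> \oo] --> sin y.
  by rewrite unlock; exact: is_cvg_series_sin_coeff.
split.
  rewrite (_ : (fun N => _) = (fun N => exp_sum N x * series (cos_coeff y) N - complex.Re (D N))); last first.
    apply/funext => N; rewrite DE yE exp_sum_real.
    by case: (D N) => d1 d2 /=; rewrite mul0r subr0.
  rewrite /cexp /= mul0r subr0 -[X in _ --> X]subr0; apply: cvgB.
    by apply: cvgM => //; exact: exp_sum_cvg.
  by apply: small => N; exact: norm_Re_le.
rewrite (_ : (fun N => _) = (fun N => exp_sum N x * series (sin_coeff y) N - complex.Im (D N))); last first.
  apply/funext => N; rewrite DE yE exp_sum_real.
  by case: (D N) => d1 d2 /=; rewrite mul0r addr0.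
rewrite /cexp /= mul0r addr0 -[X in _ --> X]subr0; apply: cvgB.
  by apply: cvgM => //; exact: exp_sum_cvg.
by apply: small => N; exact: norm_Im_le.
Qed.

End ComplexExponential.

(** * The Clifford exponential on a slice *)

Section CliffordExponential.
Context {R : realType} {n : nat}.
Local Notation CC := (clifford R[i] n).
Implicit Types (I : 'rV[R]_n) (A : {set 'I_n}).

Lemma cl_coef_sum (J : Type) (r : seq J) (P : pred J) (F : J -> CC) A :
  (\sum_(j <- r | P j) F j) A = \sum_(j <- r | P j) F j A.
Proof.
by apply: (big_morph (fun x : CC => x A)) => [x y|]; rewrite ?cl_coefD ?cl_coef0.
Qed.

Lemma real_pointE (s0 : R) I : slice_point s0 0 I = real_point n s0.
Proof.
apply/rowP => j; rewrite !mxE; case: unliftP => [l ->|->] /=.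
  by rewrite mul0r mulr0.
by rewrite mulr1.
Qed.

Lemma paravector_slice (u v : R) I :
  paravector (slice_point u v I) = (u%:C)%:A + v%:C *: cl_vector I.
Proof.
rewrite /paravector !mxE unlift_none /=; congr (_ + _).
rewrite /cl_vector scaler_sumr; apply: eq_bigr => l _.
by rewrite !mxE liftK /= scalerA rmorphM.
Qed.

(** Symmetrize the double sum: off the diagonal the anticommutators vanish. *)
Lemma cl_vector_sq I : cl_vector I * cl_vector I = - (\sum_l (I 0 l ^+ 2)%:C)%:A.
Proof.
have two_neq0 : (2 : R[i]) != 0 by rewrite pnatr_eq0.
apply: (scalerI two_neq0); rewrite !scaler_nat !mulr2n.
rewrite /cl_vector mulr_suml; under eq_bigr do rewrite mulr_sumr.
rewrite [X in X + _]exchange_big -big_split /= -opprD -scalerDl -big_split /=.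
rewrite scaler_suml -sumrN; apply: eq_bigr => l _.
rewrite -big_split /= (bigD1 l)//= big1 => [|m ml].
  rewrite addr0 -!scalerAl -!scalerAr cl_unit_sq !scalerA -!scalerDl -rmorphM.
  by rewrite scalerN expr2 -rmorphD.
rewrite -!scalerAl -!scalerAr !scalerA [X in X *: _ + _]mulrC -scalerDr.
by rewrite addrC cl_unit_anticomm ?scaler0// eq_sym.
Qed.

Lemma imag_unit_sq I : imag_sphere I -> cl_vector I * cl_vector I = -1.
Proof.
rewrite /imag_sphere /= /enorm cl_vector_sq => nI.
have -> : \sum_l (I 0 l ^+ 2)%:C = 1 :> R[i].
  rewrite -rmorph_sum /=; congr (_%:C); rewrite -[LHS]sqr_sqrtr ?nI ?expr1n//.
  by apply: sumr_ge0 => l _; exact: sqr_ge0.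
by rewrite scale1r.
Qed.

(** On the ideals generated by complementary idempotents the argument acts by the
    scalars p and q, so the series decouples into two scalar ones. *)
Lemma cl_exp_diag (p q : R[i]) (e f : CC) :
  e * e = e -> f * f = f -> e * f = 0 -> f * e = 0 -> e + f = 1 ->
  cl_exp (p *: e + q *: f) = cexp p *: e + cexp q *: f.
Proof.
move=> ee ff ef fe ef1.
have powE k : (p *: e + q *: f) ^+ k = p ^+ k *: e + q ^+ k *: f.
  elim: k => [|k IH]; first by rewrite !expr0 !scale1r.
  rewrite exprS IH mulrDl !mulrDr -!scalerAl -!scalerAr ee ff ef fe.
  by rewrite !scaler0 addr0 add0r !scalerA -!exprS.
have SE N : \sum_(0 <= k < N) (k`!%:R)^-1 *: (p *: e + q *: f) ^+ k =
    exp_sum N p *: e + exp_sum N q *: f.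
  rewrite /exp_sum !scaler_suml -big_split /=; apply: eq_bigr => k _.
  by rewrite powE scalerDr !scalerA.
apply/cliffordP => A; rewrite mk_cliffordE cl_coefD !cl_coefZ.
have [pr pi] := exp_sum_cexp p; have [qr qi] := exp_sum_cexp q.
rewrite (_ : (fun N => complex.Re _) = fun N =>
    (complex.Re (exp_sum N p) * complex.Re (e A) - complex.Im (exp_sum N p) * complex.Im (e A)) +
    (complex.Re (exp_sum N q) * complex.Re (f A) - complex.Im (exp_sum N q) * complex.Im (f A))); last first.
  apply/funext => N; rewrite SE cl_coefD !cl_coefZ.
  by case: (exp_sum N p) (exp_sum N q) (e A) (f A) => [? ?] [? ?] [? ?] [? ?].
rewrite (_ : (fun N => complex.Im _) = fun N =>
    (complex.Re (exp_sum N p) * complex.Im (e A) + complex.Im (exp_sum N p) * complex.Re (e A)) +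
    (complex.Re (exp_sum N q) * complex.Im (f A) + complex.Im (exp_sum N q) * complex.Re (f A))); last first.
  apply/funext => N; rewrite SE cl_coefD !cl_coefZ.
  by case: (exp_sum N p) (exp_sum N q) (e A) (f A) => [? ?] [? ?] [? ?] [? ?].
have cM (u : nat -> R) (l c : R) : u N @[N --> \oo] --> l -> u N * c @[N --> \oo] --> l * c.
  by move=> ul; apply: cvgM ul _; exact: cvg_cst.
rewrite (cvg_lim _ (cvgD (cvgB (cM _ _ _ pr) (cM _ _ _ pi)) (cvgB (cM _ _ _ qr) (cM _ _ _ qi))))//.
rewrite (cvg_lim _ (cvgD (cvgD (cM _ _ _ pr) (cM _ _ _ pi)) (cvgD (cM _ _ _ qr) (cM _ _ _ qi))))//.
by case: (cexp p) (cexp q) (e A) (f A) => [? ?] [? ?] [? ?] [? ?].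
Qed.

(** The components of s |-> exp (- i t s): with J = cl_vector I one has
    exp (- i t (u + J v)) = exp (- i t u) (cosh (t v) - i J sinh (t v)). *)
Definition exp_comp0 (t : R) (z : R * R) : R[i] :=
  expi (- (t * z.1)) * ((expR (t * z.2) + expR (- (t * z.2))) / 2)%:C.
Definition exp_comp1 (t : R) (z : R * R) : R[i] :=
  expi (- (t * z.1)) * (((expR (- (t * z.2)) - expR (t * z.2)) / 2) *i).

(** The idempotents are e = (1 + i J) / 2 and f = (1 - i J) / 2; since
    i J = e - f, the argument acts by - t v - i t u and by t v - i t u. *)
Lemma cl_exp_slice (t u v : R) I : imag_sphere I ->
  cl_exp (- ('i%C * t%:C) *: paravector (slice_point u v I)) =
  (exp_comp0 t (u, v))%:A + cl_vector I * (exp_comp1 t (u, v))%:A.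
Proof.
move=> /imag_unit_sq JJ; rewrite paravector_slice; set J := cl_vector I.
pose h : R[i] := 2^-1.
have hh : h + h = 1 by rewrite /h -mulr2n -[X in X *+ _]mul1r -mulrnAr -mulr_natr mulVf ?pnatr_eq0// mul1r.
pose e : CC := h *: (1 + 'i%C *: J); pose f : CC := h *: (1 - 'i%C *: J).
have iJ : ('i%C *: J) * ('i%C *: J) = 1.
  by rewrite -scalerAl -scalerAr scalerA JJ -expr2 sqr_i scaleN1r opprK.
have sq (K : CC) : K * K = 1 -> (h *: (1 + K)) * (h *: (1 + K)) = h *: (1 + K).
  move=> KK; rewrite -scalerAl -scalerAr scalerA mulrDl !mulrDr KK !mul1r !mulr1.
  by rewrite [K + 1]addrC -mulr2n -scaler_nat scalerA; congr (_ *: _);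
     rewrite -mulrA mulVf ?mulr1// pnatr_eq0.
have ee : e * e = e by exact: sq.
have ff : f * f = f by apply: (sq (- ('i%C *: J))); rewrite mulrNN.
have ef : e * f = 0.
  rewrite -scalerAl -scalerAr mulrDl !mulrBr iJ !mul1r mulr1.
  by rewrite addrC subrKA subrr !scaler0.
have fe : f * e = 0.
  rewrite -scalerAl -scalerAr mulrBl !mulrDr iJ !mul1r mulr1.
  by rewrite [X in _ - X]addrC subrr !scaler0.
have ef1 : e + f = 1.
  by rewrite -scalerDr addrACA subrr addr0 scalerDr -scalerDl hh scale1r.
have lin (a b : R[i]) : a *: e + b *: f = (h * (a + b))%:A + (h * (a - b) * 'i%C) *: J.
  rewrite /e /f !scalerDr !scalerN !scalerA addrACA -scaleNr -[X in X + _ = _]scalerDl -[X in _ + X = _]scalerDl.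
  by congr (_ *: _ + _ *: _); ring.
pose p : R[i] := (- (t * v)) +i* (- (t * u)).
pose q : R[i] := (t * v) +i* (- (t * u)).
have hE : h = (2^-1)%:C by rewrite fmorphV rmorph_nat.
have -> : - ('i%C * t%:C) *: (u%:C%:A + v%:C *: J) = p *: e + q *: f.
  rewrite lin scalerDr !scalerA hE /p /q; congr (_ *: _ + _ *: _);
  by apply/eqP; rewrite eq_complex /=; apply/andP; split; apply/eqP; field.
rewrite (cl_exp_diag _ _ ee ff ef fe ef1) lin -scalerAr mulr1.
rewrite hE /p /q /exp_comp0 /exp_comp1 /cexp /expi /=; congr (_ *: _ + _ *: _);
by apply/eqP; rewrite eq_complex /=; apply/andP; split; apply/eqP; field.
Qed.

End CliffordExponential.

Section PartialDerivatives.
Context {R : realType}.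

Lemma is_derive_eu (h : R * R -> R) (u v d : R) :
  is_derive (u, v) (eu R) h d <-> is_derive u 1 (fun t => h (t, v)) d.
Proof.
have E : (fun t : R => t^-1 *: (((fun t => h (t, v)) \o shift u) (t *: 1) - h (u, v))) =
         (fun t : R => t^-1 *: ((h \o shift (u, v)) (t *: eu R) - h (u, v))).
  apply/funext => t; rewrite /= /eu; congr (_ *: (h _ - _)).
  by congr pair; rewrite /= /GRing.scale /= mulr0 add0r.
by split=> -[Hd He]; (split; [rewrite /derivable in Hd *|rewrite -He /derive]); rewrite ?E// -E.
Qed.

Lemma is_derive_ev (h : R * R -> R) (u v d : R) :
  is_derive (u, v) (ev R) h d <-> is_derive v 1 (fun t => h (u, t)) d.
Proof.
have E : (fun t : R => t^-1 *: (((fun t => h (u, t)) \o shift v) (t *: 1) - h (u, v))) =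
         (fun t : R => t^-1 *: ((h \o shift (u, v)) (t *: ev R) - h (u, v))).
  apply/funext => t; rewrite /= /ev; congr (_ *: (h _ - _)).
  by congr pair; rewrite /= /GRing.scale /= mulr0 add0r.
by split=> -[Hd He]; (split; [rewrite /derivable in Hd *|rewrite -He /derive]); rewrite ?E// -E.
Qed.

End PartialDerivatives.

(** * Slice monogenicity of the exponential *)

Lemma cl_deriveE (R : realType) (n : nat) (w : R * R) (f : R * R -> clifford R[i] n) z A :
  cl_derive w f z A = 'D_w (fun z' => complex.Re (f z' A)) z +i*
                      'D_w (fun z' => complex.Im (f z' A)) z.
Proof. exact: mk_cliffordE. Qed.

Lemma eq_cl_derive (R : realType) (n : nat) (w w' : R * R) (f f' : R * R -> clifford R[i] n) z :
  (forall A, 'D_w (fun z' => complex.Re (f z' A)) z = 'D_w' (fun z' => complex.Re (f' z' A)) z) ->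
  (forall A, 'D_w (fun z' => complex.Im (f z' A)) z = 'D_w' (fun z' => complex.Im (f' z' A)) z) ->
  cl_derive w f z = cl_derive w' f' z.
Proof.
by move=> ReE ImE; apply/cliffordP => A; rewrite [LHS]cl_deriveE [RHS]cl_deriveE ReE ImE.
Qed.

Lemma eqN_cl_derive (R : realType) (n : nat) (w w' : R * R) (f f' : R * R -> clifford R[i] n) z :
  (forall A, 'D_w (fun z' => complex.Re (f z' A)) z = - 'D_w' (fun z' => complex.Re (f' z' A)) z) ->
  (forall A, 'D_w (fun z' => complex.Im (f z' A)) z = - 'D_w' (fun z' => complex.Im (f' z' A)) z) ->
  cl_derive w f z = - cl_derive w' f' z.
Proof.
move=> ReE ImE; apply/cliffordP => A.
by rewrite [LHS]cl_deriveE [RHS]cl_coefN [X in _ = - X]cl_deriveE ReE ImE.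
Qed.

Section SliceExponential.
Context {R : realType} {n : nat}.
Local Notation CC := (clifford R[i] n).
Variable t : R.

Let ch (v : R) := (expR (t * v) + expR (- (t * v))) / 2.
Let sh (v : R) := (expR (- (t * v)) - expR (t * v)) / 2.
(** P0 c d and P1 c d are the real parts of the two components of the exponential
    multiplied by the constant c + i d; as Im w = Re (- i w), the imaginary parts are
    P0 d (- c) and P1 d (- c).  Q0 and Q1 are the u-derivatives. *)
Let P0 (c d : R) (z : R * R) :=
  (cos (- (t * z.1)) * c - sin (- (t * z.1)) * d) * ch z.2.
Let P1 (c d : R) (z : R * R) :=
  - (cos (- (t * z.1)) * d + sin (- (t * z.1)) * c) * sh z.2.
Let Q0 (c d : R) (z : R * R) :=
  t * (cos (- (t * z.1)) * d + sin (- (t * z.1)) * c) * ch z.2.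
Let Q1 (c d : R) (z : R * R) :=
  t * (cos (- (t * z.1)) * c - sin (- (t * z.1)) * d) * sh z.2.

Let P0u c d (z : R * R) : is_derive z (eu R) (P0 c d) (Q0 c d z).
Proof.
case: z => u v; apply/is_derive_eu; rewrite /P0 /Q0 /=; move: (ch v) => k.
apply: is_derive_eq; by rewrite /= /GRing.scale /=; field.
Qed.

Let P0v c d (z : R * R) : is_derive z (ev R) (P0 c d) (- Q1 c d z).
Proof.
case: z => u v; apply/is_derive_ev; rewrite /P0 /ch /=; apply: is_derive_eq.
by rewrite /Q1 /sh /= /GRing.scale /=; field.
Qed.

Let P1u c d (z : R * R) : is_derive z (eu R) (P1 c d) (Q1 c d z).
Proof.
case: z => u v; apply/is_derive_eu; rewrite /P1 /Q1 /=; move: (sh v) => k.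
apply: is_derive_eq; by rewrite /= /GRing.scale /=; field.
Qed.

Let P1v c d (z : R * R) : is_derive z (ev R) (P1 c d) (Q0 c d z).
Proof.
case: z => u v; apply/is_derive_ev; rewrite /P1 /sh /=; apply: is_derive_eq.
by rewrite /Q0 /ch /= /GRing.scale /=; field.
Qed.

Let derivable_continuous (f : R -> R) : (forall x : R, derivable f x 1) -> continuous f.
Proof. by move=> df x; apply/differentiable_continuous/derivable1_diffP. Qed.

Let cont1 (f : R -> R) : continuous f -> continuous (fun z : R * R => f z.1).
Proof. by move=> cf z; apply: (@continuous_comp _ _ _ fst f z _ (cf z.1)); exact: cvg_fst. Qed.

Let cont2 (f : R -> R) : continuous f -> continuous (fun z : R * R => f z.2).
Proof. by move=> cf z; apply: (@continuous_comp _ _ _ snd f z _ (cf z.2)); exact: cvg_snd. Qed.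

Let c_cos : continuous (fun z : R * R => cos (- (t * z.1))).
Proof. by apply: (@cont1 (fun u => cos (- (t * u)))); apply: derivable_continuous => x; exact: ex_derive. Qed.

Let c_sin : continuous (fun z : R * R => sin (- (t * z.1))).
Proof. by apply: (@cont1 (fun u => sin (- (t * u)))); apply: derivable_continuous => x; exact: ex_derive. Qed.

Let c_ch : continuous (fun z : R * R => ch z.2).
Proof. by apply: (@cont2 ch); apply: derivable_continuous => x; rewrite /ch; exact: ex_derive. Qed.

Let c_sh : continuous (fun z : R * R => sh z.2).
Proof. by apply: (@cont2 sh); apply: derivable_continuous => x; rewrite /sh; exact: ex_derive. Qed.

Let cQ0 c d : continuous (Q0 c d).
Proof.
exact: (contM (contM (cont_cst t) (contD (contM c_cos (cont_cst d)) (contM c_sin (cont_cst c)))) c_ch).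
Qed.

Let cQ1 c d : continuous (Q1 c d).
Proof.
exact: (contM (contM (cont_cst t) (contB (contM c_cos (cont_cst c)) (contM c_sin (cont_cst d)))) c_sh).
Qed.

Let C1_of_partials (D : set (R * R)) (h hu hv : R * R -> R) :
  (forall z, is_derive z (eu R) h (hu z)) -> (forall z, is_derive z (ev R) h (hv z)) ->
  continuous hu -> continuous hv -> C1_on D h.
Proof.
move=> Hu Hv cu cv w; case=> -> z _.
  split; first by have [] := Hu z.
  have -> : 'D_(eu R) h = hu by apply/funext => z'; have [_ ->] := Hu z'.
  exact: cu.
split; first by have [] := Hv z.
have -> : 'D_(ev R) h = hv by apply/funext => z'; have [_ ->] := Hv z'.
exact: cv.
Qed.

Let ReP0 (g : CC) A : (fun z => complex.Re ((exp_comp0 t z *: g) A)) =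
  P0 (complex.Re (g A)) (complex.Im (g A)).
Proof.
apply/funext => z; rewrite cl_coefZ /exp_comp0 /expi /P0 /ch.
by case: (g A) => c d /=; ring.
Qed.

Let ImP0 (g : CC) A : (fun z => complex.Im ((exp_comp0 t z *: g) A)) =
  P0 (complex.Im (g A)) (- complex.Re (g A)).
Proof.
apply/funext => z; rewrite cl_coefZ /exp_comp0 /expi /P0 /ch.
by case: (g A) => c d /=; ring.
Qed.

Let ReP1 (g : CC) A : (fun z => complex.Re ((exp_comp1 t z *: g) A)) =
  P1 (complex.Re (g A)) (complex.Im (g A)).
Proof.
apply/funext => z; rewrite cl_coefZ /exp_comp1 /expi /P1 /sh.
by case: (g A) => c d /=; ring.
Qed.

Let ImP1 (g : CC) A : (fun z => complex.Im ((exp_comp1 t z *: g) A)) =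
  P1 (complex.Im (g A)) (- complex.Re (g A)).
Proof.
apply/funext => z; rewrite cl_coefZ /exp_comp1 /expi /P1 /sh.
by case: (g A) => c d /=; ring.
Qed.

(** Multiplication of the components by a fixed Clifford number g preserves the
    Cauchy-Riemann equations because these hold coefficientwise. *)
Lemma slice_pair_exp (D : set (R * R)) (g : CC) :
  slice_pair D (fun z => exp_comp0 t z *: g) (fun z => exp_comp1 t z *: g).
Proof.
have C0 c d : C1_on D (P0 c d).
  exact: (C1_of_partials (P0u c d) (P0v c d) (@cQ0 c d) (contN (@cQ1 c d))).
have C1 c d : C1_on D (P1 c d).
  exact: (C1_of_partials (P1u c d) (P1v c d) (@cQ1 c d) (@cQ0 c d)).
split.
- by move=> A; rewrite ReP0 ImP0.
- by move=> A; rewrite ReP1 ImP1.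
- move=> u v _; rewrite -scaleNr; split; congr (_ *: _).
    by rewrite /exp_comp0 /= mulrN opprK addrC.
  rewrite /exp_comp1 /expi /= mulrN opprK; apply/eqP; rewrite eq_complex /=.
  by apply/andP; split; apply/eqP; field.
- have dE (w : R * R) (f f' : R * R -> R) (z : R * R) (d : R) :
    f = f' -> is_derive z w f' d -> 'D_w f z = d by move=> -> [_ ->].
  move=> z _; split.
    apply/eqP; rewrite subr_eq0; apply/eqP; apply: eq_cl_derive => A.
      by rewrite (dE _ _ _ _ _ (ReP0 g A) (P0u _ _ z)) (dE _ _ _ _ _ (ReP1 g A) (P1v _ _ z)).
    by rewrite (dE _ _ _ _ _ (ImP0 g A) (P0u _ _ z)) (dE _ _ _ _ _ (ImP1 g A) (P1v _ _ z)).
  apply/eqP; rewrite addr_eq0; apply/eqP; apply: eqN_cl_derive => A.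
    by rewrite (dE _ _ _ _ _ (ReP0 g A) (P0v _ _ z)) (dE _ _ _ _ _ (ReP1 g A) (P1u _ _ z)).
  by rewrite (dE _ _ _ _ _ (ImP0 g A) (P0v _ _ z)) (dE _ _ _ _ _ (ImP1 g A) (P1u _ _ z)).
Qed.

End SliceExponential.

(** * Uniqueness of slice monogenic extensions *)

Section SliceUniqueness.
Context {R : realType} {n : nat}.
Local Notation CC := (clifford R[i] n).

Lemma uv_domainT (z : R * R) : uv_domain (setT : set 'rV[R]_n.+1) z.
Proof. by move=> I _. Qed.

Let component_eq (a b a' b' : R * R -> R) (D : set (R * R)) : (forall z, D z) ->
  C1_on D a -> C1_on D b -> C1_on D a' -> C1_on D b' ->
  (forall z, 'D_(eu R) a z - 'D_(ev R) b z = 0) ->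
  (forall z, 'D_(ev R) a z + 'D_(eu R) b z = 0) ->
  (forall z, 'D_(eu R) a' z - 'D_(ev R) b' z = 0) ->
  (forall z, 'D_(ev R) a' z + 'D_(eu R) b' z = 0) ->
  (forall u, a (u, 0) = a' (u, 0)) -> (forall u, b (u, 0) = b' (u, 0)) ->
  forall u v, 0 <= v -> a (u, v) = a' (u, v) /\ b (u, v) = b' (u, v).
Proof.
move=> DT Ca Cb Ca' Cb' H1 H2 H1' H2' a0 b0 u v v0.
have der (f g : R * R -> R) w : C1_on D f -> C1_on D g -> w = eu R \/ w = ev R ->
    forall z, is_derive z w (fun z => f z - g z) ('D_w f z - 'D_w g z).
  move=> Cf Cg hw z; have [df _] := Cf w hw z (DT z); have [dg _] := Cg w hw z (DT z).
  by apply: is_deriveB; exact: derivableP.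
have cont (f g : R * R -> R) w : C1_on D f -> C1_on D g -> w = eu R \/ w = ev R ->
    continuous (fun z => 'D_w f z - 'D_w g z).
  move=> Cf Cg hw; apply: contB => z.
  - by have [_] := Cf w hw z (DT z).
  - by have [_] := Cg w hw z (DT z).
have hu : eu R = eu R \/ eu R = ev R by left.
have hv : ev R = eu R \/ ev R = ev R by right.
have [] := @cauchy_riemann_eq0 R (fun u v => a (u, v) - a' (u, v)) (fun u v => b (u, v) - b' (u, v))
  (fun u v => 'D_(eu R) a (u, v) - 'D_(eu R) a' (u, v))
  (fun u v => 'D_(ev R) a (u, v) - 'D_(ev R) a' (u, v)) _ _ _ _ _ _ _ _ u v v0.
- by move=> x y; apply/(is_derive_eu (fun z => a z - a' z)); exact: der.
- by move=> x y; apply/(is_derive_ev (fun z => a z - a' z)); exact: der.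
- move=> x y; apply/(is_derive_eu (fun z => b z - b' z)).
  rewrite opprB addrC; have := der b b' _ Cb Cb' hu (x, y).
  have /eqP := H2 (x, y); rewrite addrC addr_eq0 => /eqP ->.
  by have /eqP := H2' (x, y); rewrite addrC addr_eq0 => /eqP ->; rewrite opprK addrC.
- move=> x y; apply/(is_derive_ev (fun z => b z - b' z)).
  have := der b b' _ Cb Cb' hv (x, y).
  have /eqP := H1 (x, y); rewrite subr_eq0 => /eqP ->.
  by have /eqP := H1' (x, y); rewrite subr_eq0 => /eqP ->.
- have -> : (fun z : R * R => 'D_(eu R) a (z.1, z.2) - 'D_(eu R) a' (z.1, z.2)) =
      (fun z => 'D_(eu R) a z - 'D_(eu R) a' z) by apply/funext => -[].
  exact: cont.
- have -> : (fun z : R * R => 'D_(ev R) a (z.1, z.2) - 'D_(ev R) a' (z.1, z.2)) =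
      (fun z => 'D_(ev R) a z - 'D_(ev R) a' z) by apply/funext => -[].
  exact: cont.
- by move=> x; rewrite a0 subrr.
- by move=> x; rewrite b0 subrr.
by move=> /eqP; rewrite subr_eq0 => /eqP -> /eqP; rewrite subr_eq0 => /eqP ->.
Qed.

(** f1 is odd in v. *)
Lemma slice_pair_axis (D : set (R * R)) (f0 f1 : R * R -> CC) :
  (forall z, D z) -> slice_pair D f0 f1 -> forall u, f1 (u, 0) = 0.
Proof.
move=> DT [_ _ pf _] u; apply/cliffordP => A; rewrite [RHS]cl_coef0.
have [_] := pf u 0 (DT _); rewrite oppr0 => /cliffordP/(_ A).
rewrite [RHS]cl_coefN => /eqP.
by rewrite -addr_eq0 -mulr2n mulrn_eq0 /= => /eqP.
Qed.

Lemma slice_pair_unique (D : set (R * R)) (f0 f1 g0 g1 : R * R -> CC) :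
  (forall z, D z) -> slice_pair D f0 f1 -> slice_pair D g0 g1 ->
  (forall u, f0 (u, 0) = g0 (u, 0)) ->
  forall u v, 0 <= v -> f0 (u, v) = g0 (u, v) /\ f1 (u, v) = g1 (u, v).
Proof.
move=> DT Sf Sg fg u v v0.
have f10 := slice_pair_axis DT Sf; have g10 := slice_pair_axis DT Sg.
case: Sf Sg => [Cf0 Cf1 _ CRf] [Cg0 Cg1 _ CRg].
have CR (h0 h1 : R * R -> CC) : (forall z, D z ->
    cl_derive (eu R) h0 z - cl_derive (ev R) h1 z = 0 /\
    cl_derive (ev R) h0 z + cl_derive (eu R) h1 z = 0) -> forall A,
    [/\ forall z, 'D_(eu R) (fun z => complex.Re (h0 z A)) z - 'D_(ev R) (fun z => complex.Re (h1 z A)) z = 0,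
        forall z, 'D_(ev R) (fun z => complex.Re (h0 z A)) z + 'D_(eu R) (fun z => complex.Re (h1 z A)) z = 0,
        forall z, 'D_(eu R) (fun z => complex.Im (h0 z A)) z - 'D_(ev R) (fun z => complex.Im (h1 z A)) z = 0 &
        forall z, 'D_(ev R) (fun z => complex.Im (h0 z A)) z + 'D_(eu R) (fun z => complex.Im (h1 z A)) z = 0].
  move=> H A.
  have Hm z : 'D_(eu R) (fun z => complex.Re (h0 z A)) z +i* 'D_(eu R) (fun z => complex.Im (h0 z A)) z =
      'D_(ev R) (fun z => complex.Re (h1 z A)) z +i* 'D_(ev R) (fun z => complex.Im (h1 z A)) z.
    have [/eqP + _] := H z (DT z); rewrite subr_eq0 => /eqP/cliffordP/(_ A).
    by rewrite [LHS]cl_deriveE [RHS]cl_deriveE.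
  have Hp z : 'D_(ev R) (fun z => complex.Re (h0 z A)) z +i* 'D_(ev R) (fun z => complex.Im (h0 z A)) z =
      - ('D_(eu R) (fun z => complex.Re (h1 z A)) z +i* 'D_(eu R) (fun z => complex.Im (h1 z A)) z).
    have [_ /eqP] := H z (DT z); rewrite addr_eq0 => /eqP/cliffordP/(_ A).
    by rewrite [LHS]cl_deriveE [RHS]cl_coefN [X in _ = - X -> _]cl_deriveE.
  split=> z; [have [-> _] := Hm z | have [-> _] := Hp z | have [_ ->] := Hm z | have [_ ->] := Hp z];
  by rewrite ?subrr ?addNr.
have K A : f0 (u, v) A = g0 (u, v) A /\ f1 (u, v) A = g1 (u, v) A.
  have [f1r f2r f1i f2i] := CR _ _ CRf A.
  have [g1r g2r g1i g2i] := CR _ _ CRg A.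
  have [Cf0r Cf0i] := Cf0 A; have [Cf1r Cf1i] := Cf1 A.
  have [Cg0r Cg0i] := Cg0 A; have [Cg1r Cg1i] := Cg1 A.
  have [r0 r1] : complex.Re (f0 (u, v) A) = complex.Re (g0 (u, v) A) /\
                 complex.Re (f1 (u, v) A) = complex.Re (g1 (u, v) A).
    apply: (component_eq DT Cf0r Cf1r Cg0r Cg1r f1r f2r g1r g2r _ _ u v0) => x.
    - by rewrite fg.
    - by rewrite f10 g10.
  have [i0 i1] : complex.Im (f0 (u, v) A) = complex.Im (g0 (u, v) A) /\
                 complex.Im (f1 (u, v) A) = complex.Im (g1 (u, v) A).
    apply: (component_eq DT Cf0i Cf1i Cg0i Cg1i f1i f2i g1i g2i _ _ u v0) => x.
    - by rewrite fg.
    - by rewrite f10 g10.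
  by split; apply/eqP; rewrite eq_complex ?r0 ?r1 ?i0 ?i1 !eqxx.
by split; apply/cliffordP => A; have [] := K A.
Qed.

Hypothesis n_gt0 : (0 < n)%N.

(** If the vector part of s vanishes, any unit vector serves, and one exists
    because n > 0. *)
Lemma slice_point_exists (s : 'rV[R]_n.+1) :
  exists (I : 'rV[R]_n) (v : R), [/\ imag_sphere I, 0 <= v & s = slice_point (s 0 0) v I].
Proof.
have en_ge0 (w : 'rV[R]_n) : 0 <= \sum_j w 0 j ^+ 2.
  by apply: sumr_ge0 => j _; exact: sqr_ge0.
have enZ (k : R) (w : 'rV[R]_n) : enorm (k *: w) = `|k| * enorm w.
  rewrite /enorm -sqrtr_sqr -sqrtrM ?sqr_ge0//; congr Num.sqrt.
  by rewrite mulr_sumr; apply: eq_bigr => j _; rewrite mxE exprMn.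
have spE v (I : 'rV[R]_n) : imag_part s = v *: I -> s = slice_point (s 0 0) v I.
  move=> sI; apply/rowP => j; rewrite !mxE; case: unliftP => [l ->|-> //] /=.
  by have /rowP/(_ l) := sI; rewrite !mxE.
have [s0|s0] := eqVneq (enorm (imag_part s)) 0.
  exists (delta_mx 0 (Ordinal n_gt0)), 0; split => //.
    rewrite /imag_sphere /= /enorm (bigD1 (Ordinal n_gt0))//= big1 => [|j jn].
      by rewrite !mxE !eqxx expr1n addr0 sqrtr1.
    by rewrite !mxE (negPf jn) andbF expr0n.
  apply: spE; rewrite scale0r; apply/rowP => l; rewrite [RHS]mxE.
  move/eqP: s0; rewrite sqrtr_eq0 => s0; apply/eqP; rewrite -sqrf_eq0.
  have : \sum_j imag_part s 0 j ^+ 2 = 0 by apply/eqP; rewrite eq_le s0 en_ge0.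
  by move/psumr_eq0P => H; rewrite H// => j _; exact: sqr_ge0.
exists ((enorm (imag_part s))^-1 *: imag_part s), (enorm (imag_part s)).
have e0 : 0 <= enorm (imag_part s) by exact: sqrtr_ge0.
split=> //.
  by rewrite /imag_sphere /= enZ normfV (ger0_norm e0) mulVf.
by apply: spE; rewrite scalerA mulfV// scale1r.
Qed.

Lemma right_slice_extension_unique (f : R -> CC) (F G : 'rV[R]_n.+1 -> CC) :
  right_slice_extension f F -> right_slice_extension f G -> F = G.
Proof.
move=> [[_ _ [f0 [f1 [Sf Ff]]]] Fr] [[_ _ [g0 [g1 [Sg Gg]]]] Gr].
apply/funext => s; have [I [v [I1 v0 ->]]] := slice_point_exists s.
rewrite Ff// Gg//; have DT := uv_domainT.
have fg u : f0 (u, 0) = g0 (u, 0).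
  have := Fr u; rewrite -Gr -(real_pointE u I) Ff// Gg//.
  by rewrite (slice_pair_axis DT Sf) (slice_pair_axis DT Sg) mul0r !addr0.
by have [-> ->] := slice_pair_unique DT Sf Sg fg (s 0 0) v0.
Qed.

Lemma left_slice_extension_unique (f : R -> CC) (F G : 'rV[R]_n.+1 -> CC) :
  left_slice_extension f F -> left_slice_extension f G -> F = G.
Proof.
move=> [[_ _ [f0 [f1 [Sf Ff]]]] Fr] [[_ _ [g0 [g1 [Sg Gg]]]] Gr].
apply/funext => s; have [I [v [I1 v0 ->]]] := slice_point_exists s.
rewrite Ff// Gg//; have DT := uv_domainT.
have fg u : f0 (u, 0) = g0 (u, 0).
  have := Fr u; rewrite -Gr -(real_pointE u I) Ff// Gg//.
  by rewrite (slice_pair_axis DT Sf) (slice_pair_axis DT Sg) mulr0 !addr0.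
by have [-> ->] := slice_pair_unique DT Sf Sg fg (s 0 0) v0.
Qed.

End SliceUniqueness.

Section KernelExtensions.
Context {R : realType} {n : nat}.
Local Notation CC := (clifford R[i] n).
Hypothesis n_gt0 : (0 < n)%N.
Variable t : R.

Let e (s : 'rV[R]_n.+1) : CC := cl_exp (- ('i%C * t%:C) *: paravector s).

Lemma cl_exp_intrinsic : intrinsic_slice_monogenic setT e.
Proof.
split; [exact: openT | by [] | exists (exp_comp0 t), (exp_comp1 t); split].
  exact: slice_pair_exp.
by move=> u v I I1 _; rewrite /e (cl_exp_slice _ _ _ I1).
Qed.

Lemma cl_exp_real_point (s0 : R) : e (real_point n s0) = (expi (- (s0 * t)))%:A.
Proof.
have [I [v [I1 v0 _]]] := slice_point_exists n_gt0 (0 : 'rV[R]_n.+1).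
rewrite -(real_pointE s0 I) /e (cl_exp_slice _ _ _ I1).
rewrite /exp_comp0 /exp_comp1 /= !mulr0 oppr0 expR0 subrr mul0r.
rewrite (_ : (1 + 1) / 2 = 1 :> R); last by field.
by rewrite complexr0 (rmorph0 (real_complex R)) (rmorph1 (real_complex R)) mulr1 mulr0 scale0r mulr0 addr0 mulrC.
Qed.

Lemma exp_right_extension (g : CC) (f : R -> CC) :
  (forall s0, f s0 = g * (expi (- (s0 * t)))%:A) ->
  unique (right_slice_extension f) (fun s => g * e s).
Proof.
move=> fE; have ext : right_slice_extension f (fun s => g * e s).
  split=> [|s0]; last by rewrite cl_exp_real_point fE.
  split; [exact: openT | by [] |].
  exists (fun z => exp_comp0 t z *: g), (fun z => exp_comp1 t z *: g); split.
    exact: slice_pair_exp.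
  move=> u v I I1 _; rewrite /e (cl_exp_slice _ _ _ I1) mulrDr.
  by rewrite -!scalerAr !mulr1 -scalerAl.
by split=> // F; exact: right_slice_extension_unique.
Qed.

Lemma exp_left_extension (g : CC) (f : R -> CC) :
  (forall s0, f s0 = (expi (- (s0 * t)))%:A * g) ->
  unique (left_slice_extension f) (fun s => e s * g).
Proof.
move=> fE; have ext : left_slice_extension f (fun s => e s * g).
  split=> [|s0]; last by rewrite cl_exp_real_point fE.
  split; [exact: openT | by [] |].
  exists (fun z => exp_comp0 t z *: g), (fun z => exp_comp1 t z *: g); split.
    exact: slice_pair_exp.
  move=> u v I I1 _; rewrite /e (cl_exp_slice _ _ _ I1) mulrDl.
  by rewrite -!scalerAr mulr1 -!scalerAl mul1r.
by split=> // F; exact: left_slice_extension_unique.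
Qed.

End KernelExtensions.

(** * Lebesgue measure on tuples *)

Section TupleLebesgue.
Context {R : realType}.
Local Open Scope ereal_scope.
Notation mu := (@lebesgue_measure R).
Notation RT := (measurableTypeR R).
Notation tl := (tuple_lebesgue R).

(** The shifted measure has the same values on intervals. *)
Lemma lebesgue_measure_shift (a : R) (A : set RT) : measurable A ->
  mu ((fun x : RT => x + a)%R @^-1` A) = mu A.
Proof.
have mshift : measurable_fun setT (fun x : RT => (x + a)%R : RT).
  by apply: measurable_funD => //; exact: measurable_cst.
move=> mA.
pose nu : {measure set RT -> \bar R} := measure_function_pushforward__canonical__measure_function_Measure mu mshift.
rewrite -[LHS]/(nu A); apply/esym; apply: (@lebesgue_measure_unique R nu) => // X.
move=> [[x y] /= _ <-].
rewrite /nu /= /pushforward /=.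
have -> : (fun x0 : RT => (x0 + a)%R) @^-1` `]x, y] = `](x - a)%R, (y - a)%R]%classic.
  by apply/seteqP; split => z /=; rewrite !in_itv /= ltrBlDr lerBrDr.
by rewrite !lebesgue_measure_itv /= !lte_fin ltrD2r; case: ifP => // _;
  rewrite !EFinN -!EFinB; congr EFin; rewrite opprB addrA subrK.
Qed.

Lemma ge0_integral_shift (a : R) (f : RT -> \bar R) : measurable_fun setT f ->
  (forall x, 0 <= f x) -> \int[mu]_x f (x + a)%R = \int[mu]_x f x.
Proof.
move=> mf f0.
have mshift : measurable_fun setT (fun x : RT => (x + a)%R : RT).
  by apply: measurable_funD => //; exact: measurable_cst.
have := @ge0_integral_pushforward _ _ _ _ R _ mshift mu setT f measurableT mf (fun x _ => f0 x).
rewrite preimage_setT => <-; apply/esym.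
apply: (@eq_measure_integral _ _ _ setT (measure_function_pushforward__canonical__measure_function_Measure mu mshift) mu) => A mA _.
by apply/esym; exact: lebesgue_measure_shift.
Qed.

Lemma ge0_integral_tuple_step m (f : m.+1.-tuple RT -> \bar R) :
  measurable_fun setT f -> (forall t, 0 <= f t) ->
  \int[tl m.+1]_t f t = \int[mu]_x \int[tl m]_t f (tcons (x, t)).
Proof.
move=> mf f0.
have mt := @measurable_tcons R m.
have := @ge0_integral_pushforward _ _ _ _ R _ mt (mu \x tl m) setT f measurableT mf (fun x _ => f0 x).
rewrite preimage_setT => H.
have -> : \int[tl m.+1]_t f t = \int[mu \x tl m]_z (f \o @tcons R m) z.
  rewrite -H.
  exact: (@eq_measure_integral _ _ _ setT (measure_function_pushforward__canonical__measure_function_Measure (mu \x tl m) mt) (tl m.+1)).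
rewrite (@fubini_tonelli1 _ _ _ _ R mu (tl m) (f \o @tcons R m))//.
- exact: measurableT_comp.
- by move=> z; exact: f0.
Qed.

Definition tshift m (a t : m.-tuple RT) : m.-tuple RT :=
  [tuple (tnth t j + tnth a j)%R | j < m].

Lemma measurable_tshift m (a : m.-tuple RT) : measurable_fun setT (tshift a).
Proof.
apply/measurable_fun_tnthP => j /=.
rewrite (_ : _ \o _ = fun t : m.-tuple RT => (tnth t j + tnth a j)%R); last first.
  by apply/funext => t /=; rewrite tnth_mktuple.
by apply: measurable_funD => //; exact: measurable_tnth.
Qed.

Lemma tnth_tcons0 m (p : RT * m.-tuple RT) : tnth (tcons p) ord0 = p.1.
Proof. by rewrite /tcons tnth0. Qed.

Lemma tnth_tconsS m (p : RT * m.-tuple RT) i : tnth (tcons p) (lift ord0 i) = tnth p.2 i.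
Proof. by rewrite /tcons tnthS. Qed.

Lemma tshift_tcons m (a0 x : R) (a t : m.-tuple RT) :
  tshift (tcons (a0, a)) (tcons (x, t)) = tcons ((x + a0)%R, tshift a t).
Proof.
apply: eq_from_tnth => j; rewrite tnth_mktuple.
by case: (unliftP ord0 j) => [i ->|->]; rewrite ?tnth_tcons0// !tnth_tconsS tnth_mktuple.
Qed.

Lemma ge0_integral_tshift m (a : m.-tuple RT) (f : m.-tuple RT -> \bar R) :
  measurable_fun setT f -> (forall t, 0 <= f t) ->
  \int[tl m]_t f (tshift a t) = \int[tl m]_t f t.
Proof.
elim: m a f => [|m IH] a f mf f0.
  by apply: eq_integral => t _; congr f; rewrite (tuple0 t) (tuple0 (tshift _ _)).
have -> : a = tcons (thead a, [tuple of behead a]) by rewrite {1}[a]tuple_eta; exact/val_inj.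
move: (thead a) [tuple of behead a] => a0 a'.
rewrite [LHS]ge0_integral_tuple_step//; last first.
  by apply: (measurableT_comp mf); exact: measurable_tshift.
rewrite [RHS](ge0_integral_tuple_step mf f0).
have mft : measurable_fun setT (f \o @tcons R m).
  by apply: measurableT_comp => //; exact: measurable_tcons.
transitivity (\int[mu]_x \int[tl m]_t f (tcons ((x + a0)%R, t))).
  apply: eq_integral => x _; under eq_integral do rewrite tshift_tcons.
  apply: (IH a' (fun t => f (tcons ((x + a0)%R, t)))) => //.
  by apply: (measurableT_comp mft); exact: measurable_pair1.
apply: (@ge0_integral_shift a0 (fun x => \int[tl m]_t f (tcons (x, t)))).
- exact: (measurable_fun_fubini_tonelli_F (m2 := tl m) _ mft (fun z => f0 (tcons z))).
- by move=> x; exact: integral_ge0.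
Qed.

Lemma integral_tshift m (a : m.-tuple RT) (f : m.-tuple RT -> \bar R) :
  measurable_fun setT f -> \int[tl m]_t f (tshift a t) = \int[tl m]_t f t.
Proof.
move=> mf; rewrite integralE [RHS]integralE; congr (_ - _).
  rewrite -(ge0_integral_tshift a (measurable_funepos mf))//.
  by apply: eq_integral => t _; rewrite !funeposE.
rewrite -(ge0_integral_tshift a (measurable_funeneg mf))//.
by apply: eq_integral => t _; rewrite !funenegE.
Qed.

Lemma integrable_tshift m (a : m.-tuple RT) (f : m.-tuple RT -> \bar R) :
  (tl m).-integrable setT f -> (tl m).-integrable setT (fun t => f (tshift a t)).
Proof.
move=> /integrableP[mf foo]; apply/integrableP; split.
  by apply: (measurableT_comp mf); exact: measurable_tshift.
rewrite (@ge0_integral_tshift _ a (fun t => `|f t|))//.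
exact: measurableT_comp mf.
Qed.

Lemma integral_tuple0 (f : 0.-tuple RT -> \bar R) : measurable_fun setT f ->
  \int[tl 0]_t f t = f [tuple].
Proof. by move=> mf; rewrite integral_dirac// diracT mul1e. Qed.

Lemma measurable_prod_tuple m (h : R -> R) : measurable_fun setT h ->
  measurable_fun setT (fun t : m.-tuple RT => \prod_(j < m) h (tnth t j))%R.
Proof.
move=> mh; apply: measurable_prod => j _.
by apply: (measurableT_comp mh); exact: measurable_tnth.
Qed.

(** Tonelli's theorem, one coordinate at a time. *)
Lemma integral_prod_tuple m (h : R -> R) (c : R) : measurable_fun setT h ->
  (forall x, 0 <= h x)%R -> \int[mu]_x (h x)%:E = c%:E ->
  \int[tl m]_t (\prod_(j < m) h (tnth t j))%:E = (c ^+ m)%:E.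
Proof.
move=> mh h0 hc.
have c0 : (0 <= c)%R by rewrite -lee_fin -hc; apply: integral_ge0 => x _; rewrite lee_fin.
elim: m => [|m IH].
  rewrite integral_tuple0; first by rewrite big_ord0.
  by apply/measurable_EFinP; exact: measurable_prod_tuple.
rewrite ge0_integral_tuple_step; last 2 first.
- by apply/measurable_EFinP; exact: measurable_prod_tuple.
- by move=> t; rewrite lee_fin prodr_ge0.
transitivity (\int[mu]_x ((h x)%:E * (c ^+ m)%:E)).
  apply: eq_integral => x _; rewrite -IH.
  rewrite -ge0_integralZl//; last 3 first.
  - by apply/measurable_EFinP; exact: measurable_prod_tuple.
  - by move=> t _; rewrite lee_fin prodr_ge0.
  - by rewrite lee_fin.
  apply: eq_integral => t _; rewrite big_ord_recl tnth_tcons0 EFinM; congr (_ * _%:E).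
  by apply: eq_bigr => j _; rewrite tnth_tconsS.
rewrite ge0_integralZr//.
- by rewrite hc -EFinM exprS.
- exact/measurable_EFinP.
- by move=> x _; rewrite lee_fin.
- by rewrite lee_fin exprn_ge0.
Qed.

End TupleLebesgue.

Section ContinuousMeasurable.
Context {R : realType} {m : nat}.
Notation RT := (measurableTypeR R).

(** An open set is the union of the boxes with rational centre and rational radius
    that it contains; the sigma-algebra on tuples contains the boxes. *)
Lemma measurable_row_open (O : set 'rV[R]_m) : open O ->
  measurable (@row_of_tuple R m @^-1` O).
Proof.
move=> oO.
pose B (p : 'rV[rat]_m * rat) : set (m.-tuple RT) :=
  [set t | forall j, `|ratr (p.1 0 j) - tnth t j| < ratr p.2].
pose F p : set (m.-tuple RT) := [set t | B p t /\ B p `<=` @row_of_tuple R m @^-1` O].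
have -> : @row_of_tuple R m @^-1` O = \bigcup_p F p.
  apply/seteqP; split => [t /= Ot|t [p _ [Bt sub]]]; last exact: sub.
  have /nbhs_ballP[e /= e0 He] : nbhs (row_of_tuple t) O by exact: open_nbhs_nbhs.
  have [r /andP[r0 re]] : exists r : rat, 0 < (ratr r : R) < e / 2.
    have e2 : 0 < e / 2 by rewrite divr_gt0.
    by have [r] := rat_in_itvoo e2; rewrite in_itv /= => ?; exists r.
  have ap j : exists q : rat, `|ratr q - tnth t j| < ratr r :> R.
    have lt : tnth t j - ratr r < tnth t j + ratr r :> R by lra.
    have [q] := rat_in_itvoo lt; rewrite in_itv /= => /andP[q1 q2]; exists q.
    by rewrite ltr_norml; apply/andP; split; lra.
  have [q qP] := choice ap.
  exists (\row_j q j, r) => //; split; first by move=> j; rewrite mxE.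
  move=> u Bu /=; apply: He; rewrite -ball_normE /ball_ /= /Num.norm /= mx_normrE.
  apply/bigmax_ltP; split => // -[i j] _ /=; rewrite !mxE.
  have := Bu j; rewrite /= mxE => h1; have h2 := qP j.
  rewrite (le_lt_trans (ler_distD (ratr (q j)) _ _))//.
  by rewrite [`|tnth t j - _|]distrC; lra.
apply: countable_bigcupT_measurable; first exact: countableP.
move=> p; have [sub|nsub] := pselect (B p `<=` @row_of_tuple R m @^-1` O); last first.
  by rewrite (_ : F p = set0)//; apply/seteqP; split => // t [_].
have -> : F p = \bigcap_(j in [set: 'I_m])
    [set t : m.-tuple RT | `|ratr (p.1 0 j) - tnth t j| < ratr p.2 :> R].
  apply/seteqP; split => [t [Bt _] j _|t H]; first exact: Bt.
  by split=> // j; exact: H.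
apply: fin_bigcap_measurable => // j _.
rewrite -[X in measurable X]setTI.
have -> : [set t : m.-tuple RT | `|ratr (p.1 0 j) - tnth t j| < ratr p.2 :> R] =
    (fun t : m.-tuple RT => tnth t j) @^-1` ball (ratr (p.1 0 j) : R) (ratr p.2).
  by apply/seteqP; split => t; rewrite /= -ball_normE.
exact: (@measurable_tnth _ RT m j measurableT _ (measurable_ball _ _)).
Qed.

Lemma continuous_row_measurable (f : 'rV[R]_m -> R) : continuous f ->
  measurable_fun setT (fun t : m.-tuple RT => f (row_of_tuple t)).
Proof.
move=> cf; apply: (measurability _ (RGenOpens.measurableE R)) => _ [_ [a [b ->]] <-].
rewrite setTI; apply: (measurable_row_open (O := f @^-1` `]a, b[)).
by apply: open_comp => [y _|]; [exact: cf | exact: interval_open].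
Qed.

End ContinuousMeasurable.

(** * Fourier transforms of Gaussians *)

Lemma integrable_scale d (T : measurableType d) (R : realType)
  (mu : {measure set T -> \bar R}) (D : set T) (f : T -> R) (c : R) :
  measurable D -> mu.-integrable D (EFin \o f) ->
  mu.-integrable D (EFin \o (fun y => c * f y)).
Proof. by move=> mD intf; exact: (integrableZl mD c intf). Qed.

Section TupleCalculus.
Context {R : realType} {m : nat}.
Notation RT := (measurableTypeR R).
Notation tl := (tuple_lebesgue R m).
Notation TT := (m.-tuple (measurableTypeR R)).
Implicit Types (x y : TT) (j : 'I_m).

Definition axis_shift j (h : R) y : TT :=
  tshift [tuple if k == j then h else 0 | k < m] y.
Definition sqnorm y : R := \sum_(j < m) tnth y j ^+ 2.
Definition dot y x : R := \sum_(j < m) tnth y j * tnth x j.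

Lemma tnth_axis_shift j h y k : tnth (axis_shift j h y) k = tnth y k + if k == j then h else 0.
Proof. by rewrite /axis_shift !tnth_mktuple. Qed.

Lemma axis_shift0 j y : axis_shift j 0 y = y.
Proof. by apply: eq_from_tnth => k; rewrite tnth_axis_shift if_same addr0. Qed.

Lemma sqnorm_axis_shift j h y : sqnorm (axis_shift j h y) = sqnorm y + h * (2 * tnth y j) + h * h.
Proof.
rewrite /sqnorm (bigD1 j)//= [X in _ = X + _ + _](bigD1 j)//= tnth_axis_shift eqxx.
rewrite (eq_bigr (fun k => tnth y k ^+ 2)); first by ring.
by move=> k /negPf kj; rewrite tnth_axis_shift kj addr0.
Qed.

Lemma dot_axis_shift j h y x : dot (axis_shift j h y) x = dot y x + h * tnth x j.
Proof.
rewrite /dot (bigD1 j)//= [X in _ = X + _](bigD1 j)//= tnth_axis_shift eqxx.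
rewrite (eq_bigr (fun k => tnth y k * tnth x k)); first by ring.
by move=> k /negPf kj; rewrite tnth_axis_shift kj addr0.
Qed.

Lemma sqnorm_ge0 y : 0 <= sqnorm y.
Proof. by apply: sumr_ge0 => j _; exact: sqr_ge0. Qed.

Lemma sqr_le_sqnorm y j : tnth y j ^+ 2 <= sqnorm y.
Proof. by rewrite /sqnorm (bigD1 j)//= lerDl sumr_ge0// => k _; exact: sqr_ge0. Qed.

Lemma measurable_tnthR j : measurable_fun setT (fun y : TT => tnth y j : R).
Proof. exact: measurable_tnth. Qed.

Lemma measurable_sqnorm : measurable_fun setT sqnorm.
Proof.
apply: measurable_sum => j; apply: measurable_funX; exact: measurable_tnth.
Qed.

Lemma measurable_dot x : measurable_fun setT (dot^~ x).
Proof.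
apply: measurable_sum => j; apply: measurable_funM; last exact: measurable_cst.
exact: measurable_tnth.
Qed.

(** The integral of F (y + h e_j) does not depend on h; differentiate it at h = 0. *)
Lemma integral_partial_eq0 j (F F' G : TT -> R) :
  (forall y (h : R), is_derive h 1 (fun h => F (axis_shift j h y)) (F' (axis_shift j h y))) ->
  tl.-integrable setT (EFin \o F) -> tl.-integrable setT (EFin \o G) ->
  (forall y h, `|h| < 1 -> `|F' (axis_shift j h y)| <= G y) ->
  (\int[tl]_y F' y = 0)%R.
Proof.
move=> dF iF iG bF.
have G0 y : 0 <= G y by rewrite (le_trans _ (bF y 0 _)) ?normr0.
have Ia : `]-1, 1[%classic (0 : R) by rewrite /= in_itv /= ltrN10 ltr01.
pose f (h : R) y := F (axis_shift j h y).
have cF (h : R) : (\int[tl]_y f h y)%R = (\int[tl]_y F y)%R.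
  congr fine; rewrite -[RHS](integral_tshift [tuple if k == j then h else 0 | k < m])//.
  exact: (measurable_int tl).
have if_ (h : R) : `]-1, 1[%classic h -> tl.-integrable setT (EFin \o f h).
  by move=> _; exact: (integrable_tshift [tuple if k == j then h else 0 | k < m] iF).
have df (h : R) y : `]-1, 1[%classic h -> setT y -> derivable (f^~ y) h 1.
  by move=> _ _; have [] := dF y h.
have dfE h y : partial1of2 f h y = F' (axis_shift j h y).
  by rewrite partial1of2E; have [_ ->] := dF y h.
have bf (h : R) y : `]-1, 1[%classic h -> setT y -> `|partial1of2 f h y| <= G y.
  by rewrite /= in_itv /= => h1 _; rewrite dfE bF// ltr_norml.
have := @differentiation_under_integral R _ TT tl f setT measurableT 0 _ _ Ia if_ df G G0 iG bf.
have -> : (fun h => \int[tl]_y f h y)%R = cst (\int[tl]_y F y)%R by apply/funext => h; exact: cF.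
rewrite derive1_cst => /esym; apply: etrans; apply: eq_Rintegral => y _.
by rewrite dfE axis_shift0.
Qed.

Section GaussianTransform.
Variable t : R.
Hypothesis t_gt0 : 0 < t.

Definition gaussian (s : R) y : R := expR (- (s * sqnorm y)).

Lemma gaussian_prod s y : gaussian s y = \prod_(j < m) expR (- (s * tnth y j ^+ 2)).
Proof. by rewrite /gaussian -expR_sum -mulNr mulr_sumr; under eq_bigr do rewrite mulNr. Qed.

Lemma gaussian_ge0 s y : 0 <= gaussian s y. Proof. exact: expR_ge0. Qed.

Lemma measurable_gaussian s : measurable_fun setT (gaussian s).
Proof.
apply: measurableT_comp => //; apply: measurableT_comp => //.
by apply: measurable_funM => //; exact: measurable_sqnorm.
Qed.

Lemma integral_gauss1 (s : R) : 0 < s ->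
  (\int[@lebesgue_measure R]_x (expR (- (s * x ^+ 2)))%:E = (Num.sqrt (pi / s))%:E)%E.
Proof.
move=> s0; pose g : R := Num.sqrt (2 * s)^-1.
have g0 : 0 < g by rewrite sqrtr_gt0 invr_gt0 mulr_gt0.
have g2 : g ^+ 2 = (2 * s)^-1 by rewrite sqr_sqrtr// invr_ge0 mulr_ge0// ltW.
have := @integral_normal_pdf R 0 g; rewrite normal_pdfE ?gt_eqF//.
under eq_integral do rewrite EFinM.
have np0 : 0 < normal_peak g by rewrite normal_peak_gt0// gt_eqF.
rewrite ge0_integralZl//; last 3 first.
- by apply/measurable_EFinP; exact: measurable_normal_fun.
- by move=> x _; rewrite lee_fin normal_fun_ge0.
- by rewrite lee_fin ltW.
have -> : (fun c : R => (normal_fun 0 g c)%:E) = (fun c : R => (expR (- (s * c ^+ 2)))%:E).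
  apply/funext => c; rewrite /normal_fun subr0 g2; congr (expR _)%:E.
  by field; rewrite gt_eqF.
have -> : normal_peak g = (Num.sqrt (pi / s))^-1.
  rewrite /normal_peak g2; congr (Num.sqrt _)^-1; rewrite -mulr_natl.
  by field; rewrite gt_eqF.
have sp0 : 0 < Num.sqrt (pi / s) by rewrite sqrtr_gt0 divr_gt0// pi_gt0.
move=> E; rewrite -[LHS]mul1e -(@divrr _ (Num.sqrt (pi / s))) ?unitfE ?gt_eqF//.
by rewrite EFinM -muleA E mule1.
Qed.

Lemma integral_gaussian (s : R) : 0 < s ->
  (\int[tl]_y (gaussian s y)%:E = (Num.sqrt (pi / s) ^+ m)%:E)%E.
Proof.
move=> s0; under eq_integral do rewrite gaussian_prod.
apply: (@integral_prod_tuple R m (fun c : R => expR (- (s * c ^+ 2)))).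
- apply: measurableT_comp => //; apply: measurableT_comp => //.
  by apply: measurable_funM => //; exact: exprn_measurable.
- by move=> x; exact: expR_ge0.
- exact: integral_gauss1.
Qed.

Lemma integrable_gaussian (s : R) : 0 < s -> tl.-integrable setT (EFin \o gaussian s).
Proof.
move=> s0; apply/integrableP; split; first by apply/measurable_EFinP; exact: measurable_gaussian.
rewrite (eq_integral (fun y => (gaussian s y)%:E)) ?integral_gaussian ?ltry//.
by move=> y _ /=; rewrite ger0_norm// gaussian_ge0.
Qed.

(** A polynomial factor costs half of the Gaussian rate. *)
Lemma poly_gauss (s c : R) : 0 < s ->
  (1 + c ^+ 2) * expR (- (s * c ^+ 2)) <= (1 + 2 / s) * expR (- (s / 2 * c ^+ 2)).
Proof.
move=> s0; rewrite (_ : - (s * c ^+ 2) = - (s / 2 * c ^+ 2) - (s / 2 * c ^+ 2)); last by field.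
rewrite expRD mulrA ler_wpM2r ?expR_ge0// expRN ler_pdivrMr ?expR_gt0//.
have e1 := expR_ge1Dx (s / 2 * c ^+ 2).
have c2 : 0 <= c ^+ 2 := sqr_ge0 c.
have s2 : 0 <= 2 / s by rewrite divr_ge0// ltW.
apply: (@le_trans _ _ ((1 + 2 / s) * (1 + s / 2 * c ^+ 2))); last by rewrite ler_wpM2l// addr_ge0.
rewrite mulrDl mul1r mulrDr mulr1 (_ : 2 / s * (s / 2 * c ^+ 2) = c ^+ 2); last by field; rewrite gt_eqF.
have : 0 <= s / 2 * c ^+ 2 by rewrite mulr_ge0// divr_ge0// ltW.
by lra.
Qed.

Lemma poly_gaussian (s : R) j y : 0 < s ->
  (1 + tnth y j ^+ 2) * gaussian s y <= (1 + 2 / s) * gaussian (s / 2) y.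
Proof.
move=> s0; pose r := sqnorm y - tnth y j ^+ 2.
have r0 : 0 <= r by rewrite subr_ge0 sqr_le_sqnorm.
have E c : gaussian c y = expR (- (c * tnth y j ^+ 2)) * expR (- (c * r)).
  by rewrite -expRD /gaussian /r; congr expR; ring.
rewrite (E s) (E (s / 2)) [X in X <= _]mulrA [X in _ <= X]mulrA; apply: ler_pM.
- by rewrite mulr_ge0 ?expR_ge0// addr_ge0 ?sqr_ge0.
- exact: expR_ge0.
- exact: poly_gauss.
rewrite ler_expR lerN2 ler_wpM2r//.
by lra.
Qed.

Lemma gaussian_axis_shift (s h : R) j y : 0 < s -> `|h| < 1 ->
  gaussian s (axis_shift j h y) <= expR s * gaussian (s / 2) y.
Proof.
move=> s0; rewrite ltr_norml => /andP[h1 h2].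
rewrite /gaussian -expRD ler_expR sqnorm_axis_shift.
have yj := sqr_le_sqnorm y j.
have sq1 : 0 <= (tnth y j + 2 * h) ^+ 2 := sqr_ge0 _.
have h3 : h * h <= 1 by nra.
have key : 0 <= 1 + (sqnorm y + h * (2 * tnth y j) + h * h) - sqnorm y / 2 by nra.
have := mulr_ge0 (ltW s0) key; lra.
Qed.

Lemma integrable_le_gaussian (f : TT -> R) (c s : R) : 0 < s -> measurable_fun setT f ->
  (forall y, `|f y| <= c * gaussian s y) -> tl.-integrable setT (EFin \o f).
Proof.
move=> s0 mf fc; apply: (@le_integrable _ _ _ tl setT measurableT _ (EFin \o (fun y => c * gaussian s y))).
- exact/measurable_EFinP.
- by move=> y _ /=; rewrite lee_fin (le_trans (fc y))// ler_norm.
- by apply: integrable_scale => //; exact: integrable_gaussian.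
Qed.

Definition wave x (al : R) y : R := gaussian t y * cos (dot y x + al).

Let measurable_wave x al : measurable_fun setT (wave x al).
Proof.
apply: measurable_funM; first exact: measurable_gaussian.
apply: (measurableT_comp (continuous_measurable_fun (@continuous_cos R))).
by apply: measurable_funD => //; exact: measurable_dot.
Qed.

Lemma norm_cos_le1 (c : R) : `|cos c| <= 1.
Proof. by rewrite ler_norml cos_geN1 cos_le1. Qed.

Lemma integrable_wave x al : tl.-integrable setT (EFin \o wave x al).
Proof.
apply: (@integrable_le_gaussian _ 1 t) => // y; rewrite mul1r normrM ger0_norm ?gaussian_ge0//.
by rewrite -[leRHS]mulr1 ler_wpM2l ?gaussian_ge0 ?norm_cos_le1.
Qed.

Let coord_le j y : `|tnth y j| <= 1 + tnth y j ^+ 2.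
Proof.
rewrite ler_norml; have := sqr_ge0 (tnth y j + 1); have := sqr_ge0 (tnth y j - 1).
by have := sqr_ge0 (tnth y j); rewrite !expr2 => *; apply/andP; split; nra.
Qed.

Let coord_wave_le j x al y : `|tnth y j * wave x al y| <= (1 + 2 / t) * gaussian (t / 2) y.
Proof.
apply: le_trans (poly_gaussian j y t_gt0); rewrite normrM; apply: ler_pM => //.
by rewrite normrM ger0_norm ?gaussian_ge0// -[leRHS]mulr1 ler_wpM2l ?gaussian_ge0// norm_cos_le1.
Qed.

Lemma integrable_coord_wave j x al :
  tl.-integrable setT (EFin \o (fun y => tnth y j * wave x al y)).
Proof.
apply: (@integrable_le_gaussian _ (1 + 2 / t) (t / 2)); first by rewrite divr_gt0.
  by apply: measurable_funM => //; exact: measurable_tnthR.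
exact: coord_wave_le.
Qed.

Lemma sin_cos_pihalf (c : R) : sin c = cos (c - pi / 2).
Proof. by rewrite cosB cos_pihalf sin_pihalf mulr0 add0r mulr1. Qed.

(** The integral of the partial derivative of the wave in the direction y_j is
    zero.  That derivative is - 2 t y_j times the wave, minus x_j times the wave
    with the phase lowered by pi / 2. *)
Lemma gauss_coord j x al :
  (\int[tl]_y (tnth y j * wave x al y) =
   - (tnth x j / (2 * t)) * \int[tl]_y wave x (al - pi / 2) y)%R.
Proof.
pose F' y := - (2 * t) * (tnth y j * wave x al y) + - tnth x j * wave x (al - pi / 2) y.
have i1 : tl.-integrable setT (EFin \o (fun y => - (2 * t) * (tnth y j * wave x al y))).
  by apply: integrable_scale => //; exact: integrable_coord_wave.
have i2 : tl.-integrable setT (EFin \o (fun y => - tnth x j * wave x (al - pi / 2) y)).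
  by apply: integrable_scale => //; exact: integrable_wave.
have Z : (\int[tl]_y F' y = 0)%R.
  pose K := (2 * t) * (1 + 2 / t) + `|tnth x j| * (1 + 2 / t).
  apply: (@integral_partial_eq0 j (wave x al) F' (fun y => K * expR (t / 2) * gaussian (t / 2 / 2) y)).
  - move=> y h.
    have -> : (fun h => wave x al (axis_shift j h y)) = fun h : R =>
        expR (- (t * (sqnorm y + h * (2 * tnth y j) + h * h))) * cos (dot y x + h * tnth x j + al).
      by apply/funext => k; rewrite /wave /gaussian sqnorm_axis_shift dot_axis_shift.
    apply: is_derive_eq; rewrite /F' /wave /gaussian tnth_axis_shift eqxx sqnorm_axis_shift dot_axis_shift [_ + (al - _)]addrA -sin_cos_pihalf.
    by rewrite /GRing.scale /=; ring.
  - exact: integrable_wave.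
  - by apply: integrable_scale => //; apply: integrable_gaussian; rewrite !divr_gt0.
  - move=> y h h1; move: (axis_shift j h y) (gaussian_axis_shift j y (divr_gt0 t_gt0 (ltr0n R 2)) h1) => z zy.
    apply: (@le_trans _ _ (K * gaussian (t / 2) z)); last first.
      by rewrite -mulrA ler_wpM2l// addr_ge0 ?mulr_ge0 ?addr_ge0// ?divr_ge0// ltW.
    rewrite mulrDl -!mulrA; apply: le_trans (ler_normD _ _) _; apply: lerD.
      have t2 : 0 <= 2 * t by rewrite mulr_ge0// ltW.
      by rewrite normrM normrN (ger0_norm t2) [X in _ <= X]mulrA ler_wpM2l// coord_wave_le.
    rewrite normrM normrN ler_wpM2l//.
    apply: le_trans (poly_gaussian j z t_gt0); rewrite normrM ger0_norm ?gaussian_ge0// mulrC.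
    by rewrite ler_wpM2r ?gaussian_ge0// (le_trans (norm_cos_le1 _))// lerDl sqr_ge0.
move: Z; rewrite /F' (RintegralD measurableT i1 i2).
rewrite (RintegralZl _ measurableT (integrable_coord_wave j x al)).
rewrite (RintegralZl _ measurableT (integrable_wave x (al - pi / 2))).
set P := (\int[_]_y _)%R; set Q := (\int[_]_y _)%R => /eqP.
rewrite mulNr addrC subr_eq0 => /eqP E.
have t2 : 2 * t != 0 by rewrite mulf_neq0// gt_eqF.
apply: (mulfI t2); rewrite -E.
by field; rewrite gt_eqF.
Qed.

Definition tscale (s : R) x : TT := [tuple s * tnth x j | j < m].

Let dot_tscale s y x : dot y (tscale s x) = s * dot y x.
Proof.
by rewrite /dot mulr_sumr; apply: eq_bigr => j _; rewrite tnth_mktuple; ring.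
Qed.

Let waveE s x al y : wave (tscale s x) al y = gaussian t y * cos (s * dot y x + al).
Proof. by rewrite /wave dot_tscale. Qed.

Let J x al s := (\int[tl]_y wave (tscale s x) al y)%R.

Let dwave x al (s : R) y : is_derive s 1 (fun s => wave (tscale s x) al y)
  (\sum_(j < m) - tnth x j * (tnth y j * wave (tscale s x) (al - pi / 2) y)).
Proof.
have -> : (fun s => wave (tscale s x) al y) = fun s => gaussian t y * cos (s * dot y x + al).
  by apply/funext => c; rewrite waveE.
apply: is_derive_eq; rewrite waveE addrA -sin_cos_pihalf /GRing.scale /=.
move: (sin _) (gaussian t y) => S g.
transitivity (- (g * S) * dot y x); first by ring.
by rewrite /dot mulr_sumr; apply: eq_bigr => j _; ring.
Qed.

(** By gauss_coord the function s |-> J x al s, the transform along the ray through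
    x, solves a linear differential equation. *)
Let dJ x al (s : R) : is_derive s 1 (J x al) (- (s * sqnorm x / (2 * t)) * J x al s).
Proof.
pose f s y := wave (tscale s x) al y.
pose X := \sum_(j < m) `|tnth x j|.
pose G y := X * (1 + 2 / t) * gaussian (t / 2) y.
have t2 : 0 < t / 2 by rewrite divr_gt0.
have c0 : 0 <= 1 + 2 / t by rewrite addr_ge0// divr_ge0// ltW.
have X0 : 0 <= X by apply: sumr_ge0 => j _.
have Is : `](s - 1), (s + 1)[%classic s by rewrite /= in_itv /=; apply/andP; split; lra.
have if_ c : `](s - 1), (s + 1)[%classic c -> tl.-integrable setT (EFin \o f c).
  by move=> _; exact: integrable_wave.
have df c y : `](s - 1), (s + 1)[%classic c -> setT y -> derivable (f^~ y) c 1.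
  by move=> _ _; have [] := dwave x al c y.
have G0 y : 0 <= G y by rewrite /G mulr_ge0 ?gaussian_ge0// mulr_ge0.
have iG : tl.-integrable setT (EFin \o G).
  by apply: integrable_scale => //; exact: integrable_gaussian.
have dfE c y : partial1of2 f c y =
    \sum_(j < m) - tnth x j * (tnth y j * wave (tscale c x) (al - pi / 2) y).
  by rewrite partial1of2E; have [_ ->] := dwave x al c y.
have bf c y : `](s - 1), (s + 1)[%classic c -> setT y -> `|partial1of2 f c y| <= G y.
  move=> _ _; rewrite dfE /G /X -mulrA mulr_suml.
  apply: le_trans (ler_norm_sum _ _ _) _; apply: ler_sum => j _.
  by rewrite normrM normrN ler_wpM2l// coord_wave_le.
have dF := @derivable_under_integral R _ TT tl f setT measurableT s _ _ Is if_ df G G0 iG bf.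
have := @differentiation_under_integral R _ TT tl f setT measurableT s _ _ Is if_ df G G0 iG bf.
rewrite derive1E => E; apply: DeriveDef; first exact: dF.
rewrite {}E.
under eq_Rintegral do rewrite dfE.
have step (r : seq 'I_m) : tl.-integrable setT (EFin \o (fun y => \sum_(j <- r) - tnth x j * (tnth y j * wave (tscale s x) (al - pi / 2) y))) /\
   (\int[tl]_y (\sum_(j <- r) - tnth x j * (tnth y j * wave (tscale s x) (al - pi / 2) y)) =
   \sum_(j <- r) - tnth x j * \int[tl]_y (tnth y j * wave (tscale s x) (al - pi / 2) y))%R.
  elim: r => [|j r [IH1 IH2]].
    split; last by rewrite big_nil; under eq_Rintegral do rewrite big_nil; rewrite Rintegral_cst//= mul0r.
    by under [X in EFin \o X]eq_fun do rewrite big_nil; exact: integrable0.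
  have i1 : tl.-integrable setT (EFin \o (fun y => - tnth x j * (tnth y j * wave (tscale s x) (al - pi / 2) y))).
    by apply: integrable_scale => //; exact: integrable_coord_wave.
  split.
    under [X in EFin \o X]eq_fun do rewrite big_cons.
    exact: (integrableD measurableT i1 IH1).
  under eq_Rintegral do rewrite big_cons.
  rewrite (RintegralD measurableT i1 IH1) IH2 big_cons; congr (_ + _).
  by rewrite (RintegralZl _ measurableT (integrable_coord_wave _ _ _)).
rewrite (step _).2.
have pp : al - pi / 2 - pi / 2 = al - pi by field.
under eq_bigr do rewrite gauss_coord pp tnth_mktuple.
have -> : (\int[tl]_y wave (tscale s x) (al - pi) y)%R = - J x al s.
  rewrite /J -[RHS]mulN1r -(RintegralZl _ measurableT (integrable_wave _ _)).
  apply: eq_Rintegral => y _; rewrite !waveE addrA cosB cospi sinpi mulr0 addr0; ring.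
move: (J x al s) => K.
transitivity (sqnorm x * (- (s / (2 * t)) * K)); last by ring.
rewrite /sqnorm mulr_suml; apply: eq_bigr => j _; ring.
Qed.

(** J times the inverse of the expected Gaussian has derivative zero; compare the
    values at s = 1 and s = 0. *)
Lemma gauss_wave x al :
  (\int[tl]_y wave x al y =
   Num.sqrt (pi / t) ^+ m * expR (- (sqnorm x / (4 * t))) * cos al)%R.
Proof.
pose q := sqnorm x / (4 * t).
have dH (s : R) : is_derive s 1 (fun s => J x al s * expR (s * s * q)) 0.
  have := dJ x al s => dJs.
  apply: is_derive_eq; rewrite /GRing.scale /= /q; field.
  by rewrite gt_eqF.
have := is_derive_0_is_cst 1 0 dH.
rewrite !mul1r !mul0r expR0 mulr1.
have -> : J x al 1 = (\int[tl]_y wave x al y)%R.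
  congr Rintegral; apply/funext => y.
  by rewrite waveE mul1r.
have -> : J x al 0 = Num.sqrt (pi / t) ^+ m * cos al.
  have -> : J x al 0 = (\int[tl]_y (gaussian t y * cos al))%R.
    by apply: eq_Rintegral => y _; rewrite waveE mul0r add0r.
  rewrite (RintegralZr _ measurableT (integrable_gaussian t_gt0)).
  by rewrite /Rintegral integral_gaussian.
by move=> E; rewrite -/q mulrAC -E expRN -mulrA mulfV ?mulr1// gt_eqF// expR_gt0.
Qed.

End GaussianTransform.

End TupleCalculus.

(** * Superposition of Gaussians *)

Section SubordinationKernels.
Context {R : realType}.
Notation RT := (measurableTypeR R).
Notation mu := (@lebesgue_measure R).

Let cvg_at_right0 (f : R -> R) (C : R) : 0 < C ->
  (forall u : R, 0 < u -> `|f u| <= C * u) -> f u @[u --> 0^'+] --> (0 : R).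
Proof.
move=> C0 fC; apply/cvgrPdist_le => e e0; near=> u.
have u0 : 0 < u by near: u; exact: nbhs_right_gt.
rewrite sub0r normrN (le_trans (fC u u0))// mulrC -ler_pdivlMr//.
by near: u; apply: nbhs_right_le; rewrite divr_gt0.
Unshelve. all: by end_near. Qed.

Let is_derive_pos_branch (f : R -> R) (d u : R) : 0 < u -> is_derive u 1 f d ->
  is_derive u 1 (fun v => if 0 < v then f v else 0) d.
Proof.
move=> u0 df; apply: (@near_eq_is_derive _ _ _ f _ u 1 d).
by near=> v; rewrite ifT//; near: v; exact: lt_nbhsr.
Unshelve. all: by end_near. Qed.

(** The Gaussian of rate 1 / (4 u) in r = |y|^2, with the weight for which the
    integral over u is 1 / r. *)
Definition newton_density (u r : R) : R :=
  if 0 < u then expR (- (r / (4 * u))) / (4 * u ^+ 2) else 0.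

Let expRN_le (x : R) k : 0 < x -> expR (- x) <= k.+1`!%:R / x ^+ k.+1.
Proof.
move=> x0; rewrite expRN -invf_div lef_pV2 ?posrE ?expR_gt0//; last first.
  by rewrite divr_gt0 ?exprn_gt0// ltr0n fact_gt0.
by have := expR_ge1Dxn k (ltW x0); lra.
Qed.

Lemma newton_density_ge0 u r : 0 <= newton_density u r.
Proof.
by rewrite /newton_density; case: ifP => // u0; rewrite divr_ge0 ?expR_ge0// mulr_ge0// sqr_ge0.
Qed.

(** An antiderivative is e^(- r / (4 u)) / r, which tends to 0 at u = 0 and to 1 / r
    at infinity. *)
Lemma integral_newton_density (r : R) : 0 < r ->
  (\int[mu]_u (newton_density u r)%:E = (r^-1)%:E)%E.
Proof.
move=> r0.
pose F (u : R) := if 0 < u then expR (- (r / (4 * u))) / r else 0.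
have dpos (u : R) : 0 < u -> is_derive u 1 (fun u : R => expR (- (r / (4 * u))) / r) (newton_density u r).
  move=> u0; have u40 : 4 * u != 0 by rewrite gt_eqF// mulr_gt0.
  apply: is_derive_eq; rewrite /newton_density u0 /GRing.scale /=.
  by field; rewrite !gt_eqF.
have dF (u : R) : 0 < u -> is_derive u 1 F (newton_density u r).
  by move=> u0; exact: (is_derive_pos_branch u0 (dpos u u0)).
have xle (u : R) : 0 < u -> 0 < r / (4 * u) by move=> u0; rewrite divr_gt0// mulr_gt0.
transitivity (\int[mu]_(u in `[0%R, +oo[) (newton_density u r)%:E)%E.
  rewrite [RHS]integral_mkcond; apply: eq_integral => u _; rewrite patchE.
  case: ifPn => // /negP; rewrite inE /= in_itv /= andbT /newton_density => /negP; rewrite -ltNge => u0.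
  by rewrite ltNge ltW.
rewrite (@ge0_continuous_FTC2y R (newton_density^~ r) F 0 r^-1); first by rewrite /F ltxx sube0.
- by move=> u _; exact: newton_density_ge0.
- apply/continuous_within_itvcyP; split.
    move=> u; rewrite in_itv /= andbT => u0.
    have u40 : 4 * u != 0 by rewrite gt_eqF// mulr_gt0.
    have u42 : 4 * u ^+ 2 != 0 by rewrite gt_eqF// mulr_gt0// exprn_gt0.
    apply: (@is_derive_continuous R (newton_density^~ r) u _).
    by apply: (is_derive_pos_branch u0); exact: is_deriveM.
  rewrite {2}/newton_density ltxx; apply: (@cvg_at_right0 _ (96 / r ^+ 3)).
    by rewrite divr_gt0// exprn_gt0.
  move=> u u0; rewrite ger0_norm ?newton_density_ge0// /newton_density u0.
  rewrite ler_pdivrMr ?mulr_gt0 ?exprn_gt0//.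
  apply: le_trans (expRN_le 2 (xle u u0)) _; rewrite le_eqVlt; apply/orP; left; apply/eqP.
  by rewrite (_ : 3`!%:R = 6 :> R)//; field; rewrite !gt_eqF.
- apply/cvgrPdist_le => e e0; near=> u.
  have u0 : 0 < u by near: u; apply: nbhs_pinfty_gt; rewrite num_real.
  rewrite /F u0 -[X in `|X - _|]mul1r -mulrBl normrM (@gtr0_norm _ r^-1) ?invr_gt0//.
  have x0 := xle u u0; have e1 := expR_ge1Dx (- (r / (4 * u))).
  have e2 : expR (- (r / (4 * u))) <= 1 by rewrite -[leRHS]expR0 ler_expR oppr_le0 ltW.
  rewrite ger0_norm ?subr_ge0// ler_pdivrMr//.
  apply: (@le_trans _ _ (r / (4 * u))); first by lra.
  rewrite [leRHS]mulrC ler_pM2l// invf_ple ?posrE ?mulr_gt0//.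
  apply: (@le_trans _ _ u); first by near: u; apply: nbhs_pinfty_ge; rewrite num_real.
  by rewrite ler_peMl ?(ltW u0)// ler1n.
- by move=> u u0; have [] := dF u u0.
- rewrite {2}/F ltxx; apply: (@cvg_at_right0 _ (4 / r ^+ 2)).
    by rewrite divr_gt0// exprn_gt0.
  move=> u u0; rewrite /F u0 ger0_norm ?divr_ge0 ?expR_ge0 ?(ltW r0)//.
  rewrite ler_pdivrMr//.
  apply: le_trans (expRN_le 0 (xle u u0)) _; rewrite le_eqVlt; apply/orP; left; apply/eqP.
  by rewrite expr1 (_ : 1`!%:R = 1 :> R)//; field; rewrite !gt_eqF.
- by move=> u; rewrite in_itv /= andbT => u0; rewrite derive1E; have [_ ->] := dF u u0.
Unshelve. all: by end_near. Qed.

End SubordinationKernels.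

Section GammaDensity.
Context {R : realType}.
Notation RT := (measurableTypeR R).
Notation mu := (@lebesgue_measure R).

Lemma lebesgue_measure_dilate (c : R) (A : set RT) : 0 < c -> measurable A ->
  (c%:E * mu ((fun x : RT => (c * x)%R) @^-1` A) = mu A)%E.
Proof.
move=> c0; have mdil : measurable_fun setT (fun x : RT => (c * x)%R : RT).
  by apply: measurable_funM => //; exact: measurable_cst.
move=> mA.
pose nu : {measure set RT -> \bar R} := mscale (NngNum (ltW c0)) (measure_function_pushforward__canonical__measure_function_Measure mu mdil).
rewrite -[LHS]/(nu A); apply/esym; apply: (@lebesgue_measure_unique R nu) => // X.
move=> [[x y] /= _ <-].
rewrite /nu /= /mscale /= /pushforward.
have -> : (fun x0 : RT => (c * x0)%R) @^-1` `]x, y] = `](x / c)%R, (y / c)%R]%classic.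
  by apply/seteqP; split => z /=; rewrite !in_itv /= ltr_pdivrMr// ler_pdivlMr// mulrC.
rewrite !lebesgue_measure_itv /= !lte_fin ltr_pM2r ?invr_gt0//.
case: ifP => _; last by rewrite mule0.
by rewrite -EFinM; congr EFin; field; rewrite gt_eqF.
Qed.

Lemma ge0_integral_dilate (c : R) (f : RT -> \bar R) : 0 < c -> measurable_fun setT f ->
  (forall x, 0 <= f x)%E -> (c%:E * \int[mu]_x f (c * x)%R = \int[mu]_x f x)%E.
Proof.
move=> c0 mf f0.
have mdil : measurable_fun setT (fun x : RT => (c * x)%R : RT).
  by apply: measurable_funM => //; exact: measurable_cst.
pose nu := measure_function_pushforward__canonical__measure_function_Measure mu mdil.
have := @ge0_integral_pushforward _ _ _ _ R _ mdil mu setT f measurableT mf (fun x _ => f0 x).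
rewrite preimage_setT => <-.
rewrite -[LHS](@ge0_integral_mscale _ _ R nu setT measurableT (NngNum (ltW c0)) f)//.
apply: (@eq_measure_integral _ _ _ setT mu (mscale (NngNum (ltW c0)) nu)) => A mA _.
exact: lebesgue_measure_dilate.
Qed.

Let sqrt_powR (x : R) k : 0 <= x -> Num.sqrt x ^+ k = x `^ (k%:R / 2).
Proof.
move=> x0; rewrite -powR12_sqrt// -powR_mulrn ?powR_ge0// -powRrM mulrC.
by rewrite mulrC.
Qed.

Let powR_pred (a x : R) : 0 < x -> x `^ a = x `^ (a - 1) * x.
Proof.
move=> x0; rewrite -[X in _ = _ * X]powRr1 ?(ltW x0)// -powRD ?subrK//.
by rewrite (gt_eqF x0) implybT.
Qed.

Let integral_exp_half : (\int[mu]_(t in `[0%R, +oo[) (expR (- (t / 2)))%:E = 2%:E)%E.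
Proof.
pose F (t : R) := - 2 * expR (- (t / 2)).
have dF (t : R) : is_derive t 1 F (expR (- (t / 2))).
  by apply: is_derive_eq; rewrite /GRing.scale /=; field.
rewrite (@ge0_continuous_FTC2y R (fun t => expR (- (t / 2))) F 0 0).
- by rewrite /F mul0r oppr0 expR0 mulr1 -EFinB sub0r opprK.
- by move=> t _; exact: expR_ge0.
- apply: continuous_subspaceT => t; apply: (@is_derive_continuous R (fun t : R => expR (- (t / 2))) t _).
- apply/cvgrPdist_le => e e0; near=> t.
  have t0 : 0 < t by near: t; apply: nbhs_pinfty_gt; rewrite num_real.
  rewrite sub0r normrN /F normrM normrN !ger0_norm ?expR_ge0// expRN.
  have := expR_ge1Dx (t / 2) => h.
  rewrite ler_pdivrMr ?expR_gt0//.
  apply: (@le_trans _ _ (e * (1 + t / 2))); last by rewrite ler_wpM2l// ltW.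
  rewrite mulrC -ler_pdivrMr//; apply: (@le_trans _ _ (t / 2)); last by rewrite lerDr.
  rewrite ler_pdivlMr//; near: t.
- by move=> t _; have [] := dF t.
- by apply: cvg_at_right_filter; apply: (@is_derive_continuous R F 0 _ (dF 0)).
- by move=> t _; rewrite derive1E; have [_ ->] := dF t.
Unshelve. all: by end_near. Qed.

(** The integrand of Gamma is dominated by an exponential, so Gamma is the value of
    a convergent integral. *)
Let powR_exp_le (n : nat) (t : R) : 0 < t -> (0 < n)%N ->
  t `^ (n.+1%:R / 2 - 1) * expR (- t) <= (2 * n)%:R ^+ n * expR (- (t / 2)).
Proof.
move=> t0 n0; have c1 : 1 <= (2 * n)%:R :> R by rewrite ler1n muln_gt0.
have c0 : 0 < (2 * n)%:R :> R by rewrite (lt_le_trans ltr01).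
rewrite [- t](_ : _ = t / 2 - (t + t / 2) + t / 2 - t / 2); last by field.
rewrite (_ : t / 2 - _ + _ = - (t / 2)); last by field.
rewrite expRD mulrA ler_wpM2r ?expR_ge0// expRN ler_pdivrMr ?expR_gt0//.
apply: (@le_trans _ _ ((1 + t) ^+ n)).
  rewrite -powR_mulrn; last by rewrite addr_ge0// ltW.
  apply: (@le_trans _ _ ((1 + t) `^ (n.+1%:R / 2 - 1))).
    apply: ge0_ler_powR; rewrite ?nnegrE.
    - by rewrite subr_ge0 ler_pdivlMr// mul1r (ler_nat _ 2).
    - exact: ltW.
    - by rewrite addr_ge0// ltW.
    - by rewrite lerDr.
  apply: ler_powR; first by rewrite lerDl ltW.
  rewrite -natr1; have : 0 <= n%:R :> R by [].
  lra.
rewrite (_ : t / 2 = t / (2 * n)%:R * n%:R); last first.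
  by rewrite natrM; field; rewrite pnatr_eq0 -lt0n.
rewrite expRM_natr -exprMn; apply: lerXn2r; rewrite ?nnegrE.
- by rewrite addr_ge0// ltW.
- by rewrite mulr_ge0 ?expR_ge0// ltW.
apply: (@le_trans _ _ ((2 * n)%:R * (1 + t / (2 * n)%:R))).
  by rewrite mulrDr mulr1 mulrCA mulfV ?gt_eqF// mulr1 lerD2r.
by rewrite ler_pM2l// expR_ge1Dx.
Qed.

Let measurable_gamma (a : R) : measurable_fun setT (fun t : R => t `^ a * expR (- t)).
Proof.
apply: measurable_funM; first exact: measurable_powR.
by apply: measurableT_comp => //; exact: measurableT_comp.
Qed.

Lemma integral_Gamma (n : nat) : (0 < n)%N ->
  (\int[mu]_(t in `]0%R, +oo[) (t `^ (n.+1%:R / 2 - 1) * expR (- t))%:E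
    = (Gamma (n.+1%:R / 2 : R))%:E)%E.
Proof.
move=> n0; rewrite /Gamma /Rintegral fineK//.
have f0 (t : R) : (0 <= (t `^ (n.+1%:R / 2 - 1) * expR (- t))%:E)%E.
  by rewrite lee_fin mulr_ge0 ?powR_ge0 ?expR_ge0.
rewrite ge0_fin_numE; last by apply: integral_ge0.
apply: (@le_lt_trans _ _ (\int[mu]_(t in `]0%R, +oo[) ((2 * n)%:R ^+ n * expR (- (t / 2)))%:E)%E).
  apply: ge0_le_integral => //.
  - by apply/measurable_EFinP; apply: measurable_funS (measurable_gamma _).
  - apply/measurable_EFinP; apply: measurable_funM => //; apply: measurableT_comp => //.
    by apply: measurableT_comp => //; apply: measurable_funM.
  - by move=> t; rewrite /= in_itv /= andbT => t0; rewrite lee_fin powR_exp_le.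
apply: (@le_lt_trans _ _ (\int[mu]_(t in `[0%R, +oo[) ((2 * n)%:R ^+ n * expR (- (t / 2)))%:E)%E).
  apply: ge0_subset_integral => //.
  - apply/measurable_EFinP; apply: measurable_funM => //; apply: measurableT_comp => //.
    by apply: measurableT_comp => //; apply: measurable_funM.
  - by move=> t /=; rewrite !in_itv /= !andbT => /ltW.
under eq_integral do rewrite EFinM.
rewrite ge0_integralZl//.
- by rewrite integral_exp_half -EFinM ltry.
- apply/measurable_EFinP; apply: measurableT_comp => //.
  by apply: measurableT_comp => //; apply: measurable_funM.
Qed.

(** The weight with which Gaussians e^(- u r) appear after the transform of
    [newton_density] on R^m: the factor sqrt (4 pi u)^m is the Gaussian integral of
    rate 1 / (4 u). *)
Definition euler_density (m : nat) (u r : R) : R :=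
  if 0 < u then Num.sqrt (4 * pi * u) ^+ m / (2 * u) * expR (- (u * r)) else 0.

Lemma euler_density_ge0 m u r : 0 <= euler_density m u r.
Proof.
rewrite /euler_density; case: ifP => // u0.
by rewrite mulr_ge0 ?expR_ge0// divr_ge0 ?exprn_ge0 ?sqrtr_ge0// mulr_ge0// ltW.
Qed.

(** The substitution u = t / r turns the integrand into t^(a - 1) e^(- t) with
    a = (n + 1) / 2. *)
Lemma integral_euler_density (n : nat) (r : R) : (0 < n)%N -> 0 < r ->
  (\int[mu]_u (euler_density n.+1 u r)%:E =
   (2 ^+ n * pi `^ (n.+1%:R / 2) * Gamma (n.+1%:R / 2) / r `^ (n.+1%:R / 2))%:E)%E.
Proof.
move=> n0 r0; set a : R := n.+1%:R / 2.
pose c := 2 ^+ n * pi `^ a.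
pose f (t : R) := (if 0 < t then t `^ (a - 1) * expR (- t) else 0).
have f0 t : (0 <= (f t)%:E)%E.
  by rewrite lee_fin /f; case: ifP => // _; rewrite mulr_ge0 ?powR_ge0 ?expR_ge0.
have mf : measurable_fun setT (fun t : RT => (f t)%:E).
  apply/measurable_EFinP; apply: measurable_fun_ifT => //.
    by apply: measurable_fun_ltr.
  exact: measurable_gamma.
have If : (\int[mu]_t (f t)%:E = (Gamma a)%:E)%E.
  rewrite -integral_Gamma// [RHS]integral_mkcond; apply: eq_integral => u _; rewrite patchE /f.
  rewrite mem_setE /= in_itv /= andbT; by case: ifP.
have E u : euler_density n.+1 u r = (c / r `^ (a - 1)) * f (r * u).
  rewrite /euler_density /f pmulr_rgt0//; case: ifP => u0; last by rewrite mulr0.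
  rewrite powRM ?(ltW r0) ?(ltW u0)// sqrt_powR; last by rewrite !mulr_ge0 ?pi_ge0 ?ltW.
  rewrite -/a powRM ?(ltW u0) ?mulr_ge0 ?pi_ge0// powRM ?pi_ge0//.
  rewrite (powR_pred a u0).
  have -> : 4 `^ a = 2 * 2 ^+ n :> R.
    rewrite -exprS (_ : 4 = 2 `^ 2%:R); last by rewrite powR_mulrn// expr2 -natrM.
    by rewrite -powRrM /a mulrC divfK// powR_mulrn.
  rewrite (mulrC u r) /c; field.
  by rewrite !gt_eqF// ?powR_gt0.
under eq_integral do rewrite E EFinM.
have c0 : 0 <= c / r `^ (a - 1) by rewrite divr_ge0 ?powR_ge0// mulr_ge0 ?exprn_ge0 ?powR_ge0.
rewrite ge0_integralZl//; last first.
- apply: (measurableT_comp mf); by apply: measurable_funM.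
have D := @ge0_integral_dilate r (fun t => (f t)%:E) r0 mf f0.
have -> : (\int[mu]_x (f (r * x))%:E = (Gamma a / r)%:E)%E.
  rewrite If in D; rewrite -[LHS]mul1e -(@mulVf _ r) ?gt_eqF// EFinM -muleA D -EFinM.
  by rewrite mulrC.
rewrite -EFinM; congr EFin.
rewrite (powR_pred a r0).
by rewrite /c; field; rewrite !gt_eqF// ?powR_gt0.
Qed.

End GammaDensity.

(** * The fields y_j / |y|^2 and xi_j / |xi|^(n+1) *)

Section KernelFields.
Context {R : realType} {m : nat}.
Notation RT := (measurableTypeR R).
Notation mu := (@lebesgue_measure R).
Notation tl := (tuple_lebesgue R m).
Notation TT := (m.-tuple (measurableTypeR R)).
Implicit Types (x y : TT) (j : 'I_m).

Lemma measurable_newton_density d (T : measurableType d) (f g : T -> R) :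
  measurable_fun setT f -> measurable_fun setT g ->
  measurable_fun setT (fun z => newton_density (f z) (g z)).
Proof.
move=> mf mg.
have -> : (fun z => newton_density (f z) (g z)) = fun z => if 0 < f z then
    expR (- (g z * (4 * f z) `^ (-1))) * (4 * f z ^+ 2) `^ (-1) else 0.
  apply/funext => z; rewrite /newton_density; case: ifP => // f0.
  by rewrite !powR_inv1// mulr_ge0// ?ltW// exprn_gt0.
apply: measurable_fun_ifT => //; first exact: measurable_fun_ltr.
apply: measurable_funM.
  apply: measurableT_comp => //; apply: measurableT_comp => //; apply: measurable_funM => //.
  by apply: (measurableT_comp (measurable_powR _)); apply: measurable_funM.
apply: (measurableT_comp (measurable_powR _)); apply: measurable_funM => //.
exact: measurable_funX.
Qed.

Lemma measurable_euler_density k d (T : measurableType d) (f g : T -> R) :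
  measurable_fun setT f -> measurable_fun setT g ->
  measurable_fun setT (fun z => euler_density k (f z) (g z)).
Proof.
move=> mf mg.
have -> : (fun z => euler_density k (f z) (g z)) = fun z => if 0 < f z then
    Num.sqrt (4 * pi * f z) ^+ k * (2 * f z) `^ (-1) * expR (- (f z * g z)) else 0.
  apply/funext => z; rewrite /euler_density; case: ifP => // f0.
  by rewrite powR_inv1// mulr_ge0// ltW.
apply: measurable_fun_ifT => //; first exact: measurable_fun_ltr.
apply: measurable_funM; first apply: measurable_funM.
- apply: measurable_funX; apply: (measurableT_comp (continuous_measurable_fun (@sqrt_continuous R))).
  exact: measurable_funM.
- by apply: (measurableT_comp (measurable_powR _)); apply: measurable_funM.
- by apply: measurableT_comp => //; apply: measurableT_comp => //; exact: measurable_funM.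
Qed.

(** For every u the two Gaussians are exchanged by the Fourier transform: this is
    [gauss_coord] and [gauss_wave] with t = 1 / (4 u). *)
Lemma newton_euler_transform j (u : R) x (al : R) :
  (\int[tl]_y (tnth y j * newton_density u (sqnorm y) * cos (dot y x + al)) =
   - (tnth x j * euler_density m u (sqnorm x) * sin al))%R.
Proof.
rewrite /newton_density /euler_density; case: ifP => u0; last first.
  under eq_Rintegral do rewrite mulr0 mul0r.
  by rewrite mulr0 mul0r oppr0 Rintegral_cst//= mul0r.
have t0 : 0 < (4 * u)^-1 by rewrite invr_gt0 mulr_gt0.
have E y : tnth y j * (expR (- (sqnorm y / (4 * u))) / (4 * u ^+ 2)) * cos (dot y x + al) =
    (4 * u ^+ 2)^-1 * (tnth y j * wave (4 * u)^-1 x al y).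
  by rewrite /wave /gaussian (mulrC (sqnorm y)); ring.
under eq_Rintegral do rewrite E.
rewrite (RintegralZl _ measurableT (integrable_coord_wave t0 j x al)).
rewrite (gauss_coord t0) (gauss_wave t0) -sin_cos_pihalf.
have -> : pi / (4 * u)^-1 = 4 * pi * u by rewrite invrK; ring.
have -> : sqnorm x / (4 * (4 * u)^-1) = u * sqnorm x by field; rewrite gt_eqF.
by field; rewrite gt_eqF.
Qed.

End KernelFields.

Section KernelIntegrability.
Context {R : realType} {n : nat}.
Notation RT := (measurableTypeR R).
Notation mu := (@lebesgue_measure R).
Notation tl := (tuple_lebesgue R n.+1).
Notation TT := (n.+1.-tuple (measurableTypeR R)).
Implicit Types (x y : TT) (j : 'I_n.+1).
Hypothesis n_gt0 : (0 < n)%N.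

Definition riesz_const : R := 2 ^+ n * pi `^ (n.+1%:R / 2) * Gamma (n.+1%:R / 2).

Definition newton_field j y : R := tnth y j / sqnorm y.
Definition riesz_field j x : R := tnth x j / sqnorm x `^ (n.+1%:R / 2).

(** On [1, 2] the integrand is at least e^(-2), the exponent being nonnegative. *)
Lemma Gamma_half_gt0 : 0 < Gamma (n.+1%:R / 2 : R).
Proof.
rewrite -lte_fin -integral_Gamma//.
have f0 (t : R) : (0 <= (t `^ (n.+1%:R / 2 - 1) * expR (- t))%:E)%E.
  by rewrite lee_fin mulr_ge0 ?powR_ge0 ?expR_ge0.
have mf : measurable_fun setT (fun t : R => (t `^ (n.+1%:R / 2 - 1) * expR (- t))%:E).
  apply/measurable_EFinP; apply: measurable_funM; first exact: measurable_powR.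
  by apply: measurableT_comp => //; exact: measurableT_comp.
apply: (@lt_le_trans _ _ (\int[mu]_(t in `[1%R, 2%R]) (expR (- 2))%:E)%E).
  rewrite integral_cst// [X in (_ * X)%E]lebesgue_measure_itv /= lte_fin ltr1n /= -EFinB -EFinM lte_fin.
  by rewrite mulr_gt0 ?expR_gt0// subr_gt0 ltr1n.
apply: (@le_trans _ _ (\int[mu]_(t in `[1%R, 2%R]) (t `^ (n.+1%:R / 2 - 1) * expR (- t))%:E)%E).
  apply: ge0_le_integral => //.
  - exact: measurable_funS mf.
  - move=> t; rewrite /= in_itv /= => /andP[t1 t2]; rewrite lee_fin.
    apply: (@le_trans _ _ (1 * expR (- t))); first by rewrite mul1r ler_expR lerN2.
    rewrite ler_wpM2r ?expR_ge0// -[leLHS](powRr0 t) ler_powR//.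
    by rewrite subr_ge0 ler_pdivlMr// mul1r (ler_nat _ 2).
apply: ge0_subset_integral => //; first exact: measurable_funS mf.
by move=> t /=; rewrite !in_itv /= andbT => /andP[+ _]; exact: lt_le_trans.
Qed.

Lemma riesz_const_gt0 : 0 < riesz_const.
Proof. by rewrite /riesz_const !mulr_gt0 ?exprn_gt0 ?powR_gt0 ?pi_gt0 ?Gamma_half_gt0. Qed.

Lemma sqnorm_eq0_coord j y : sqnorm y = 0 -> tnth y j = 0.
Proof.
move=> y0; apply/eqP; rewrite -sqrf_eq0; apply/eqP/le_anti.
by rewrite sqr_ge0 andbT (le_trans (sqr_le_sqnorm y j))// y0.
Qed.

(** The case a = 0 covers the origin, where the coordinate vanishes and the
    integral of the density diverges. *)
Let superpose (a v : R) (k : R -> R) : measurable_fun setT k -> (forall u, 0 <= k u) ->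
  0 <= v -> (a = 0 \/ (\int[mu]_u (k u)%:E = v%:E)%E) ->
  (\int[mu]_u (a * k u)%:E = (a * v)%:E)%E /\ (\int[mu]_u `|(a * k u)%:E| = `|a * v|%:E)%E.
Proof.
move=> mk k0 v0 H; have [->|ne] := eqVneq a 0.
  split; last by rewrite mul0r normr0; apply: integral0_eq => u _; rewrite mul0r abse0.
  by rewrite mul0r; apply: integral0_eq => u _; rewrite mul0r.
case: H => [/eqP|H]; first by rewrite (negPf ne).
have mk' : measurable_fun setT (fun u => (k u)%:E) by exact/measurable_EFinP.
split.
  under eq_integral do rewrite EFinM.
  rewrite integralZl ?H// ; apply/integrableP; split => //.
  by under eq_integral => u _ do rewrite gee0_abs ?lee_fin//; rewrite H ltry.
rewrite normrM (ger0_norm v0).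
under eq_integral => u _ do rewrite abse_EFin normrM (ger0_norm (k0 u)) EFinM.
by rewrite ge0_integralZl// ?H// => u _; rewrite lee_fin.
Qed.

Lemma newton_superpose (c : R) j y :
  (\int[mu]_u (c * tnth y j * newton_density u (sqnorm y))%:E = (c * newton_field j y)%:E)%E /\
  (\int[mu]_u `|(c * tnth y j * newton_density u (sqnorm y))%:E| = `|c * newton_field j y|%:E)%E.
Proof.
have -> : c * newton_field j y = c * tnth y j * (sqnorm y)^-1 by rewrite /newton_field; ring.
apply: superpose.
- exact: measurable_newton_density.
- by move=> u; exact: newton_density_ge0.
- by rewrite invr_ge0 sqnorm_ge0.
have [/sqnorm_eq0_coord -> |ne] := eqVneq (sqnorm y) 0; first by left; rewrite mulr0.
by right; apply: integral_newton_density; rewrite lt_neqAle eq_sym ne sqnorm_ge0.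
Qed.

Lemma euler_superpose (c : R) j x :
  (\int[mu]_u (c * tnth x j * euler_density n.+1 u (sqnorm x))%:E =
    (c * (riesz_const * riesz_field j x))%:E)%E /\
  (\int[mu]_u `|(c * tnth x j * euler_density n.+1 u (sqnorm x))%:E| =
    `|c * (riesz_const * riesz_field j x)|%:E)%E.
Proof.
have -> : c * (riesz_const * riesz_field j x) =
    c * tnth x j * (riesz_const / sqnorm x `^ (n.+1%:R / 2)).
  by rewrite /riesz_field; ring.
apply: superpose.
- exact: measurable_euler_density.
- by move=> u; exact: euler_density_ge0.
- by rewrite divr_ge0 ?powR_ge0// ltW// riesz_const_gt0.
have [/sqnorm_eq0_coord -> |ne] := eqVneq (sqnorm x) 0; first by left; rewrite mulr0.
by right; apply: integral_euler_density => //; rewrite lt_neqAle eq_sym ne sqnorm_ge0.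
Qed.

Lemma measurable_newton_field j : measurable_fun setT (newton_field j).
Proof.
have -> : newton_field j = fun y => tnth y j * sqnorm y `^ (-1).
  by apply/funext => y; rewrite powR_inv1// sqnorm_ge0.
apply: measurable_funM; first exact: measurable_tnthR.
by apply: (measurableT_comp (measurable_powR _)); exact: measurable_sqnorm.
Qed.

Lemma measurable_riesz_field j : measurable_fun setT (riesz_field j).
Proof.
have -> : riesz_field j = fun y => tnth y j * sqnorm y `^ (- (n.+1%:R / 2)).
  by apply/funext => y; rewrite /riesz_field powRN.
apply: measurable_funM; first exact: measurable_tnthR.
by apply: (measurableT_comp (measurable_powR _)); exact: measurable_sqnorm.
Qed.

(** Since s <= e^(s^2 / 2) for s = sqrt a |x_j|. *)
Let coord_gaussian_le j (a : R) x : 0 < a -> `|tnth x j| * gaussian a x <= (Num.sqrt a)^-1 * gaussian (a / 2) x.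
Proof.
move=> a0; have s0 : 0 < Num.sqrt a by rewrite sqrtr_gt0.
have -> : gaussian a x = expR (- (a / 2 * sqnorm x)) * gaussian (a / 2) x.
  by rewrite /gaussian -expRD; congr expR; field.
rewrite mulrA ler_wpM2r ?gaussian_ge0// expRN ler_pdivrMr ?expR_gt0// -ler_pdivrMl ?invr_gt0// invrK.
have := sqr_le_sqnorm x j; have := expR_ge1Dx (a / 2 * sqnorm x).
have s2 : Num.sqrt a ^+ 2 = a by rewrite sqr_sqrtr// ltW.
have := sqr_ge0 (Num.sqrt a * `|tnth x j| - 1).
rewrite -(real_normK (num_real (tnth x j))).
move: (expR (_ * _)) => E; move: (`|_|) (sqnorm x) => c q; move: (Num.sqrt a) s0 s2 => s s0 <- h1 h2 h3.
have : 0 <= s ^+ 2 * (q - c ^+ 2) by rewrite mulr_ge0 ?sqr_ge0// subr_ge0.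
lra.
Qed.

(** Majorant, up to the constant K, of the integral over x of
    e^(- |x|^2) |x_j| euler_density u. *)
Let tail (u : R) : R := if 0 <= u then ((1 + u) * Num.sqrt (1 + u))^-1 else 0.

Let integral_tail : (\int[mu]_u (tail u)%:E = 2%:E)%E.
Proof.
pose f (u : R) : R := ((1 + u) * Num.sqrt (1 + u))^-1.
pose F (u : R) : R := - 2 * (Num.sqrt (1 + u))^-1.
have s0 (u : R) : 0 <= u -> 0 < Num.sqrt (1 + u) by move=> u0; rewrite sqrtr_gt0 ltr_pwDl.
have dF (u : R) : 0 <= u -> is_derive u 1 F (f u).
  move=> u0; have u1 : 0 < 1 + u by rewrite ltr_pwDl.
  have ds : is_derive u 1 (fun u : R => Num.sqrt (1 + u)) (2 * Num.sqrt (1 + u))^-1.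
    have := is_derive1_sqrt u1 => d1.
    by apply: is_derive_eq; rewrite /GRing.scale /=; ring.
  have sn0 : Num.sqrt (1 + u) != 0 by rewrite gt_eqF// s0.
  apply: is_derive_eq; rewrite /f /GRing.scale /=.
  have s2 : Num.sqrt (1 + u) ^+ 2 = 1 + u by rewrite sqr_sqrtr// ltW.
  by move: (Num.sqrt (1 + u)) s2 sn0 => s <- sn0; field.
have tf : (\int[mu]_u (tail u)%:E = \int[mu]_(u in `[0%R, +oo[) (f u)%:E)%E.
  rewrite [RHS]integral_mkcond.
  apply: eq_integral => u _; rewrite patchE mem_setE /= in_itv /= andbT /tail.
  by case: ifP.
rewrite tf (@ge0_continuous_FTC2y R f F 0 0).
- by rewrite /F addr0 sqrtr1 invr1 mulr1 -EFinB sub0r opprK.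
- by move=> u u0; rewrite invr_ge0 mulr_ge0 ?sqrtr_ge0// addr_ge0.
- apply: continuous_in_subspaceT => u; rewrite inE /= in_itv /= andbT => u0.
  have u1 : 0 < 1 + u by rewrite ltr_pwDl.
  apply: cvgV; first by rewrite gt_eqF// mulr_gt0// s0.
  apply: cvgM; first by apply: cvgD; [exact: cvg_cst|exact: cvg_id].
  apply: continuous_comp; last exact: sqrt_continuous.
  by apply: cvgD; [exact: cvg_cst|exact: cvg_id].
- apply/cvgrPdist_le => e e0; near=> u.
  have u0 : 0 <= u by near: u; apply: nbhs_pinfty_ge; rewrite num_real.
  rewrite sub0r normrN /F normrM normrN normfV !ger0_norm ?sqrtr_ge0//.
  rewrite ler_pdivrMr ?s0// mulrC -ler_pdivrMr//.
  have e2 : 0 <= 2 / e by rewrite divr_ge0// ltW.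
  rewrite -[leLHS](ger0_norm e2) -sqrtr_sqr ler_sqrt; last by rewrite addr_ge0.
  apply: (@le_trans _ _ u); last by rewrite lerDr.
  by near: u; apply: nbhs_pinfty_ge; rewrite num_real.
- by move=> u /ltW u0; have [] := dF u u0.
- by apply: cvg_at_right_filter; apply: (@is_derive_continuous R F 0 _ (dF 0 _)).
- by move=> u; rewrite in_itv /= andbT => /ltW u0; rewrite derive1E; have [_ ->] := dF u u0.
Unshelve. all: by end_near. Qed.

Let K : R := 4 * pi ^+ 2 * Num.sqrt (8 * pi ^+ 2) ^+ n.-1.

Let K_ge0 : 0 <= K.
Proof. by rewrite /K !mulr_ge0 ?pi_ge0 ?exprn_ge0 ?sqrtr_ge0. Qed.

Let tail_ge0 u : 0 <= tail u.
Proof.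
by rewrite /tail; case: ifP => // u0; rewrite invr_ge0 mulr_ge0 ?sqrtr_ge0// addr_ge0.
Qed.

Let measurable_tail : measurable_fun setT tail.
Proof.
have -> : tail = fun u => if 0 <= u then ((1 + u) * Num.sqrt (1 + u)) `^ (-1) else 0.
  apply/funext => u; rewrite /tail; case: ifP => // u0.
  by rewrite powR_inv1// mulr_ge0 ?sqrtr_ge0// addr_ge0.
have m1 : measurable_fun setT (fun u : R => 1 + u) by exact: measurable_funD.
apply: measurable_fun_ifT => //; first exact: measurable_fun_ler.
apply: (measurableT_comp (measurable_powR _)); apply: measurable_funM => //.
exact: (measurableT_comp (continuous_measurable_fun (@sqrt_continuous R))).
Qed.

(** As n + 1 >= 2, two of the n + 1 factors sqrt u cancel the 1 / u in the density;
    each of the other n - 1 is bounded by sqrt (1 + u). *)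
Let euler_tail (u : R) : (Num.sqrt (1 + u))^-1 * Num.sqrt (pi / ((1 + u) / 2)) ^+ n.+1 *
  (if 0 < u then Num.sqrt (4 * pi * u) ^+ n.+1 / (2 * u) else 0) <= K * tail u.
Proof.
rewrite /tail; case: ifP => u0; last first.
  rewrite mulr0; case: ifP => u1; last by rewrite mulr0.
  by rewrite divr_ge0 ?K_ge0// mulr_ge0 ?sqrtr_ge0// addr_ge0.
rewrite (ltW u0).
have pi0 := @pi_gt0 R; have pi_pos := ltW pi0.
have u1 : 0 < 1 + u by rewrite addr_gt0.
have A : n.+1 = (2 + n.-1)%N by rewrite add2n prednK.
rewrite A !exprD !sqr_sqrtr; last 2 first.
- by rewrite !mulr_ge0// ltW.
- by rewrite divr_ge0 ?divr_ge0// ltW.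
have s0 : 0 < Num.sqrt (1 + u) by rewrite sqrtr_gt0.
have -> : (Num.sqrt (1 + u))^-1 *
  (pi / ((1 + u) / 2) * Num.sqrt (pi / ((1 + u) / 2)) ^+ n.-1) *
  (4 * pi * u * Num.sqrt (4 * pi * u) ^+ n.-1 / (2 * u)) =
  4 * pi ^+ 2 * (Num.sqrt (pi / ((1 + u) / 2)) * Num.sqrt (4 * pi * u)) ^+ n.-1 *
  ((1 + u) * Num.sqrt (1 + u))^-1.
  by rewrite exprMn; field; rewrite !gt_eqF.
rewrite ler_wpM2r ?invr_ge0 ?mulr_ge0 ?(ltW u1) ?(ltW s0)//.
rewrite /K ler_wpM2l ?mulr_ge0 ?sqr_ge0//.
have q0 : 0 <= pi / ((1 + u) / 2) by rewrite divr_ge0 ?divr_ge0// ltW.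
rewrite -sqrtrM//; apply: lerXn2r; rewrite ?nnegrE ?sqrtr_ge0// ler_sqrt; last first.
  by rewrite mulr_ge0// exprn_ge0.
have -> : pi / ((1 + u) / 2) * (4 * pi * u) = 8 * pi ^+ 2 * (u / (1 + u)) by field; rewrite gt_eqF.
rewrite ler_piMr ?mulr_ge0 ?sqr_ge0// ler_pdivrMr// mul1r.
by rewrite lerDr.
Qed.

Let integral_gaussian_riesz j :
  (\int[tl]_x \int[mu]_u `|(gaussian 1 x * tnth x j * euler_density n.+1 u (sqnorm x))%:E| < +oo)%E.
Proof.
have mf : measurable_fun setT (fun z : TT * RT =>
    `|(gaussian 1 z.1 * tnth z.1 j * euler_density n.+1 z.2 (sqnorm z.1))%:E|%E).
  apply: measurableT_comp => //; apply/measurable_EFinP.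
  apply: measurable_funM; first apply: measurable_funM.
  - by apply: (measurableT_comp (@measurable_gaussian R n.+1 1)).
  - by apply: (measurableT_comp (@measurable_tnthR R n.+1 j)).
  - by apply: measurable_euler_density => //; apply: (measurableT_comp (@measurable_sqnorm R n.+1)).
rewrite (@fubini_tonelli _ _ _ _ R tl mu _ mf) => [|z]; last exact: abse_ge0.
apply: (@le_lt_trans _ _ (\int[mu]_u (K * tail u)%:E)%E); last first.
  under eq_integral do rewrite EFinM.
  rewrite ge0_integralZl ?integral_tail ?ltry//.
  - exact/measurable_EFinP.
  - by move=> u _; rewrite lee_fin.
apply: ge0_le_integral => //.
- by move=> u _; apply: integral_ge0 => x _; exact: abse_ge0.
- by apply: (@measurable_fun_fubini_tonelli_G _ _ _ _ R tl _ mf) => z; exact: abse_ge0.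
- by apply/measurable_EFinP; exact: measurable_funM.
move=> u _; pose c : R := if 0 < u then Num.sqrt (4 * pi * u) ^+ n.+1 / (2 * u) else 0.
have c0 : 0 <= c.
  rewrite /c; case: ifP => // u0; rewrite divr_ge0 ?exprn_ge0 ?sqrtr_ge0//.
  by rewrite mulr_ge0// ltW.
have [u0|u0] := lerP u 0.
  rewrite integral0_eq => [|x _]; first by rewrite lee_fin; exact: (mulr_ge0 K_ge0 (tail_ge0 u)).
  by rewrite /euler_density ltNge u0 /= mulr0 normr0.
have a0 : 0 < 1 + u by rewrite addr_gt0.
apply: (@le_trans _ _ (\int[tl]_x ((Num.sqrt (1 + u))^-1 * c * gaussian ((1 + u) / 2) x)%:E)%E).
  apply: ge0_le_integral => //.
  - apply/measurableT_comp => //; apply/measurable_EFinP; apply: measurable_funM.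
      by apply: measurable_funM; [exact: measurable_gaussian|exact: measurable_tnthR].
    by apply: measurable_euler_density => //; exact: measurable_sqnorm.
  - by apply/measurable_EFinP; apply: measurable_funM => //; exact: measurable_gaussian.
  move=> x _; rewrite lee_fin /euler_density u0.
  rewrite !normrM (ger0_norm (gaussian_ge0 _ _)) [X in X <= _](_ : _ =
      c * (`|tnth x j| * gaussian (1 + u) x)); last first.
    have -> : gaussian (1 + u) x = gaussian 1 x * expR (- (u * sqnorm x)).
      by rewrite /gaussian -expRD; congr expR; ring.
    rewrite -normrM -/c; move: c0; rewrite /c u0 => c0.
    rewrite (ger0_norm c0) (ger0_norm (expR_ge0 _)); ring.
  by rewrite (mulrC _ c) -mulrA ler_wpM2l// coord_gaussian_le.
under eq_integral do rewrite EFinM.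
rewrite ge0_integralZl//; last 3 first.
- by apply/measurable_EFinP; exact: measurable_gaussian.
- by move=> x _; rewrite lee_fin gaussian_ge0.
- by rewrite lee_fin mulr_ge0// invr_ge0 sqrtr_ge0.
rewrite integral_gaussian ?divr_gt0// -EFinM lee_fin.
by rewrite mulrAC euler_tail.
Qed.

(** Write the field as a superposition of Gaussians and integrate first over x
    (Tonelli): the remaining integral over u converges by [euler_tail]. *)
Lemma integrable_gaussian_riesz j :
  tl.-integrable setT (EFin \o (fun x => gaussian 1 x * riesz_field j x)).
Proof.
have mg : measurable_fun setT (fun x => gaussian 1 x * riesz_field j x).
  by apply: measurable_funM; [exact: measurable_gaussian|exact: measurable_riesz_field].
have := integral_gaussian_riesz j.
under eq_integral => x _ do rewrite (euler_superpose (gaussian 1 x) j x).2.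
move=> fin.
have : tl.-integrable setT (EFin \o (fun x => gaussian 1 x * (riesz_const * riesz_field j x))).
  apply/integrableP; split => //; apply/measurable_EFinP.
  by apply: measurable_funM; [exact: measurable_gaussian|apply: measurable_funM => //; exact: measurable_riesz_field].
move/(integrable_scale riesz_const^-1 measurableT).
have -> // : (fun x => riesz_const^-1 * (gaussian 1 x * (riesz_const * riesz_field j x))) =
   (fun x => gaussian 1 x * riesz_field j x).
by apply/funext => x; field; rewrite gt_eqF// riesz_const_gt0.
Qed.

Let half_ge1 : 1 <= n.+1%:R / 2 :> R.
Proof. by rewrite ler_pdivlMr// mul1r (ler_nat _ 2). Qed.

Let coord_le_sqnorm j x : 1 <= sqnorm x -> `|tnth x j| <= sqnorm x.
Proof.
move=> x1; have := sqr_le_sqnorm x j; rewrite -(real_normK (num_real (tnth x j))).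
have := normr_ge0 (tnth x j); move: (`|_|) (sqnorm x) x1 => c q; nra.
Qed.

(** For |x| <= 1 the Gaussian is at least 1 / e; outside the unit ball the field is
    bounded by 1. *)
Lemma riesz_field_bound j x : `|riesz_field j x| <= expR 1 * `|gaussian 1 x * riesz_field j x| + 1.
Proof.
rewrite (normrM (gaussian 1 x)) (ger0_norm (gaussian_ge0 _ _)) mulrA -expRD mul1r.
have [x1|x1] := lerP (sqnorm x) 1.
  apply: (@le_trans _ _ (1 * `|riesz_field j x|)); first by rewrite mul1r.
  apply: (@le_trans _ _ (expR (1 - sqnorm x) * `|riesz_field j x|)); last by rewrite lerDl.
  by rewrite ler_wpM2r// -[leLHS]expR0 ler_expR subr_ge0.
apply: (@le_trans _ _ 1); last by rewrite lerDr mulr_ge0 ?expR_ge0.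
rewrite /riesz_field normrM normfV (ger0_norm (powR_ge0 _ _)).
rewrite ler_pdivrMr ?powR_gt0 ?(lt_trans ltr01)// mul1r.
apply: (le_trans (coord_le_sqnorm j (ltW x1))).
exact: (le1r_powR (ltW x1) half_ge1).
Qed.

(** In the unit ball |y|^2 >= |y|^(n+1) because n >= 1. *)
Lemma newton_field_bound j y : `|newton_field j y| <= `|riesz_field j y| + 1.
Proof.
have [y0|y0] := eqVneq (sqnorm y) 0.
  by rewrite /newton_field y0 invr0 mulr0 normr0 addr_ge0.
have q0 : 0 < sqnorm y by rewrite lt_neqAle eq_sym y0 sqnorm_ge0.
rewrite /newton_field /riesz_field !normrM !normfV (ger0_norm (powR_ge0 _ _)) (gtr0_norm q0).
have [y1|y1] := lerP (sqnorm y) 1.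
  apply: (@le_trans _ _ (`|tnth y j| / sqnorm y `^ (n.+1%:R / 2))); last by rewrite lerDl.
  rewrite ler_wpM2l// lef_pV2 ?posrE ?powR_gt0//.
  by apply: ge1r_powR; rewrite ?q0.
apply: (@le_trans _ _ 1); last by rewrite lerDr mulr_ge0// invr_ge0 powR_ge0.
by rewrite ler_pdivrMr// mul1r coord_le_sqnorm// ltW.
Qed.

Section BoundedIntegrable.
Variables (psi : TT -> R) (M : R).
Hypothesis psi_int : tl.-integrable setT (EFin \o psi).
Hypothesis psi_le : forall x, `|psi x| <= M.

Let mpsi : measurable_fun setT psi.
Proof. by apply/measurable_EFinP; exact: measurable_int psi_int. Qed.

Let psi_abs : tl.-integrable setT (EFin \o (fun x => `|psi x|)).
Proof. exact: (integrable_abse psi_int). Qed.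

Let gr_abs j : tl.-integrable setT (EFin \o (fun x => `|gaussian 1 x * riesz_field j x|)).
Proof. exact: (integrable_abse (integrable_gaussian_riesz j)). Qed.

Lemma integrable_riesz_field j : tl.-integrable setT (EFin \o (fun x => psi x * riesz_field j x)).
Proof.
apply: (@le_integrable _ _ _ tl setT measurableT _
  (EFin \o (fun x => (M * expR 1) * `|gaussian 1 x * riesz_field j x| + `|psi x|))).
- by apply/measurable_EFinP; apply: measurable_funM => //; exact: measurable_riesz_field.
- move=> x _ /=; rewrite lee_fin normrM.
  have M0 : 0 <= M by rewrite (le_trans _ (psi_le x)).
  rewrite (@ger0_norm _ (_ + _)); last by rewrite addr_ge0// !mulr_ge0 ?expR_ge0.
  apply: (le_trans (ler_wpM2l (normr_ge0 _) (riesz_field_bound j x))).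
  rewrite mulrDr mulr1 lerD2r// -mulrA ler_wpM2r// mulr_ge0 ?expR_ge0//.
- exact: (integrableD measurableT (integrable_scale _ measurableT (gr_abs j)) psi_abs).
Qed.

Lemma integrable_newton_field j : tl.-integrable setT (EFin \o (fun y => psi y * newton_field j y)).
Proof.
have i1 : tl.-integrable setT (EFin \o (fun x => `|psi x * riesz_field j x|)).
  exact: (integrable_abse (integrable_riesz_field j)).
apply: (@le_integrable _ _ _ tl setT measurableT _
  (EFin \o (fun x => `|psi x * riesz_field j x| + `|psi x|))).
- by apply/measurable_EFinP; apply: measurable_funM => //; exact: measurable_newton_field.
- move=> x _ /=; rewrite lee_fin (@ger0_norm _ (_ + _)); last by rewrite addr_ge0.
  rewrite !(normrM (psi x)); apply: (le_trans (ler_wpM2l (normr_ge0 _) (newton_field_bound j x))).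
  by rewrite mulrDr mulr1.
- exact: (integrableD measurableT i1 psi_abs).
Qed.

End BoundedIntegrable.

End KernelIntegrability.

(** * Pairing with y_j / |y|^2 *)

Lemma EFin_Rintegral d (T : measurableType d) (R : realType)
  (mu : {measure set T -> \bar R}) (f : T -> R) : mu.-integrable setT (EFin \o f) ->
  ((\int[mu]_x f x)%R%:E = \int[mu]_x (f x)%:E)%E.
Proof. by move=> fi; rewrite /Rintegral fineK//; exact: integrable_fin_num. Qed.

(** The form in which Fubini's theorem is applied below: an oscillating kernel c
    between two integrable functions of separate variables. *)
Lemma integrable_product_kernel d1 d2 (T1 : measurableType d1) (T2 : measurableType d2)
  (R : realType) (m1 : {sigma_finite_measure set T1 -> \bar R})
  (m2 : {sigma_finite_measure set T2 -> \bar R}) (h : T1 -> R) (g : T2 -> R)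
  (c : T1 * T2 -> R) : m1.-integrable setT (EFin \o h) -> m2.-integrable setT (EFin \o g) ->
  measurable_fun setT c -> (forall z, `|c z| <= 1) ->
  (m1 \x m2)%E.-integrable setT (EFin \o (fun z => h z.1 * g z.2 * c z)).
Proof.
move=> hi gi mc c1.
have mh : measurable_fun setT h by apply/measurable_EFinP; exact: measurable_int hi.
have mg : measurable_fun setT g by apply/measurable_EFinP; exact: measurable_int gi.
have mf : measurable_fun setT (fun z : T1 * T2 => (h z.1 * g z.2 * c z)%:E).
  apply/measurable_EFinP; apply: measurable_funM => //; apply: measurable_funM.
    exact: (measurableT_comp mh measurable_fst).
  exact: (measurableT_comp mg measurable_snd).
apply/integrable12ltyP => //.
have gfin := integrable_fin_num measurableT (integrable_abse gi).
have hfin := integrable_fin_num measurableT (integrable_abse hi).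
set N := (\int[m2]_x _)%E in gfin; set P := (\int[m1]_x _)%E in hfin.
apply: (@le_lt_trans _ _ (\int[m1]_x (`|(h x)%:E| * N))%E).
  apply: ge0_le_integral => //.
  - by move=> x _; apply: integral_ge0 => y _; exact: abse_ge0.
  - apply: (@measurable_fun_fubini_tonelli_F _ _ _ _ R m2 (fun z => `|(h z.1 * g z.2 * c z)%:E|%E)).
      exact: measurableT_comp mf.
    by move=> z; exact: abse_ge0.
  - by apply: emeasurable_funM => //; apply: measurableT_comp => //; exact/measurable_EFinP.
  move=> x _ /=; rewrite -ge0_integralZl//; last first.
  - by move=> y _; exact: abse_ge0.
  - by apply: measurableT_comp => //; exact/measurable_EFinP.
  apply: ge0_le_integral => //.
  - apply/measurable_EFinP; apply: measurableT_comp => //; apply: measurable_funM.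
      by apply: measurable_funM.
    by apply: (measurableT_comp mc); exact: measurable_fun_pair.
  - apply: emeasurable_funM => //; apply: measurableT_comp => //; exact/measurable_EFinP.
  move=> y _; rewrite /= -EFinM lee_fin !normrM -[leRHS]mulr1 ler_wpM2l// mulr_ge0.
rewrite ge0_integralZr//.
- by rewrite ltey_eq fin_numM.
- by apply: measurableT_comp => //; exact/measurable_EFinP.
- by apply: integral_ge0 => y _; exact: abse_ge0.
Qed.

Section WavePairing.
Context {R : realType} {n : nat}.
Notation RT := (measurableTypeR R).
Notation mu := (@lebesgue_measure R).
Notation tl := (tuple_lebesgue R n.+1).
Notation TT := (n.+1.-tuple (measurableTypeR R)).
Implicit Types (x y : TT) (j : 'I_n.+1).
Hypothesis n_gt0 : (0 < n)%N.
Variables (psi beta : TT -> R) (M : R).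
Hypothesis psi_int : tl.-integrable setT (EFin \o psi).
Hypothesis psi_le : forall x, `|psi x| <= M.
Hypothesis mbeta : measurable_fun setT beta.

Definition wave_integral y : R := (\int[tl]_x (psi x * cos (dot y x + beta x)))%R.

Let mpsi : measurable_fun setT psi.
Proof. by apply/measurable_EFinP; exact: measurable_int psi_int. Qed.

Let measurable_dot2 : measurable_fun setT (fun z : TT * TT => dot z.1 z.2).
Proof.
apply: measurable_sum => j; apply: measurable_funM.
  exact: (measurableT_comp (@measurable_tnthR R n.+1 j) measurable_fst).
exact: (measurableT_comp (@measurable_tnthR R n.+1 j) measurable_snd).
Qed.

Let mcos : measurable_fun setT (@cos R).
Proof. exact: (continuous_measurable_fun (@continuous_cos R)). Qed.

Let measurable_phase : measurable_fun setT (fun z : TT * TT => cos (dot z.1 z.2 + beta z.2)).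
Proof.
apply: (measurableT_comp mcos); apply: measurable_funD => //.
exact: (measurableT_comp mbeta measurable_snd).
Qed.

Let integrable_phase y : tl.-integrable setT (EFin \o (fun x => psi x * cos (dot y x + beta x))).
Proof.
apply: (@le_integrable _ _ _ tl setT measurableT _ (EFin \o psi)) => //.
  apply/measurable_EFinP; apply: measurable_funM => //; apply: (measurableT_comp mcos).
  apply: measurable_funD => //; apply: measurable_sum => j.
  by apply: measurable_funM => //; exact: measurable_tnthR.
by move=> x _; rewrite lee_fin normrM -[leRHS]mulr1 ler_wpM2l// norm_cos_le1.
Qed.

Lemma wave_integral_bound y : `|wave_integral y| <= (\int[tl]_x `|psi x|)%R.
Proof.
apply: (le_trans (le_normr_Rintegral measurableT (integrable_phase y))).
apply: le_Rintegral => //.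
- exact: (integrable_abse (integrable_phase y)).
- exact: (integrable_abse psi_int).
by move=> x _; rewrite normrM -[leRHS]mulr1 ler_wpM2l// norm_cos_le1.
Qed.

(** A Gaussian factor in y makes the integrand integrable in both variables, so that
    Fubini's theorem gives measurability; divide by the Gaussian. *)
Lemma measurable_wave_integral : measurable_fun setT wave_integral.
Proof.
have K := integrable_product_kernel (@integrable_gaussian R n.+1 1 ltr01) psi_int
  measurable_phase (fun z => norm_cos_le1 _).
have mF := measurable_int _ (integrable_fubini_F K).
have E y : wave_integral y = expR (sqnorm y) * fine (fubini_F tl (EFin \o
    (fun z => gaussian 1 z.1 * psi z.2 * cos (dot z.1 z.2 + beta z.2))) y).
  rewrite /fubini_F -/(Rintegral _ _ _) /=.
  under eq_Rintegral do rewrite -mulrA.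
  rewrite (RintegralZl _ measurableT (integrable_phase y)) mulrA /gaussian mul1r -expRD addrN expR0 mul1r//.
rewrite (funext E); apply: measurable_funM.
  by apply: measurableT_comp => //; exact: measurable_sqnorm.
by apply: measurableT_comp mF.
Qed.

Hypothesis wave_int : tl.-integrable setT (EFin \o wave_integral).

Let wave_newton_int j := integrable_newton_field n_gt0 wave_int wave_integral_bound j.

Let integrable_newton_coord j (u : R) :
  tl.-integrable setT (EFin \o (fun y => tnth y j * newton_density u (sqnorm y))).
Proof.
have [u0|u0] := lerP u 0.
  have -> : (fun y => tnth y j * newton_density u (sqnorm y)) = cst 0.
    by apply/funext => y; rewrite /newton_density ltNge u0 mulr0.
  exact: integrable0.
have t0 : 0 < (4 * u)^-1 by rewrite invr_gt0 mulr_gt0.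
have -> : (fun y => tnth y j * newton_density u (sqnorm y)) = (fun y => (4 * u ^+ 2)^-1 *
    (tnth y j * wave (4 * u)^-1 [tuple 0 | i < n.+1] 0 y)).
  apply/funext => y; rewrite /newton_density u0 /wave /gaussian.
  have -> : dot y [tuple 0 | i < n.+1] = 0.
    by rewrite /dot big1// => i _; rewrite tnth_mktuple mulr0.
  by rewrite addr0 cos0 (mulrC (sqnorm y)); ring.
by apply: integrable_scale => //; exact: integrable_coord_wave.
Qed.

(** For a fixed u the order of the integrals over y and x is exchanged, and the
    inner integral over y is the transform of a Gaussian. *)
Let wave_slice j (u : R) :
  (\int[tl]_y (wave_integral y * tnth y j * newton_density u (sqnorm y))%:E =
   \int[tl]_x (psi x * - sin (beta x) * tnth x j * euler_density n.+1 u (sqnorm x))%:E)%E.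
Proof.
have K := integrable_product_kernel (integrable_newton_coord j u) psi_int
  measurable_phase (fun z => norm_cos_le1 _).
have F := Fubini K.
transitivity (\int[tl]_y \int[tl]_x (tnth y j * newton_density u (sqnorm y) * psi x * cos (dot y x + beta x))%:E)%E.
  apply: eq_integral => y _.
  rewrite -EFin_Rintegral; last first.
    under [X in EFin \o X]eq_fun do rewrite -mulrA.
    by apply: integrable_scale => //; exact: integrable_phase.
  under [in RHS]eq_Rintegral do rewrite -mulrA.
  rewrite (RintegralZl _ measurableT (integrable_phase y)); congr EFin.
  by rewrite /wave_integral; ring.
rewrite [LHS]F; apply: eq_integral => x _.
transitivity ((psi x * \int[tl]_y (tnth y j * newton_density u (sqnorm y) * cos (dot y x + beta x)))%R%:E)%E.
  have i1 : tl.-integrable setT (EFin \o (fun y => tnth y j * newton_density u (sqnorm y) * cos (dot y x + beta x))).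
    apply: (@le_integrable _ _ _ tl setT measurableT _ (EFin \o (fun y => tnth y j * newton_density u (sqnorm y)))) => //.
      apply/measurable_EFinP; apply: measurable_funM.
        by apply: measurable_funM; [exact: measurable_tnthR|apply: measurable_newton_density => //; exact: measurable_sqnorm].
      by apply: (measurableT_comp mcos); apply: measurable_funD => //; exact: measurable_dot.
    by move=> y _; rewrite lee_fin normrM -[leRHS]mulr1 ler_wpM2l// norm_cos_le1.
  rewrite -(RintegralZl _ measurableT i1) EFin_Rintegral; last exact: integrable_scale.
  by apply: eq_integral => y _; congr EFin => /=; ring.
by rewrite newton_euler_transform; congr EFin; ring.
Qed.

(** Superpose Gaussians, exchange the integrals over y and u, transform each Gaussian
    ([wave_slice]), exchange back and recognise Euler's integral. *)
Lemma wave_integral_pairing j :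
  (\int[tl]_y (wave_integral y * newton_field j y) =
   \int[tl]_x (psi x * - sin (beta x) * (@riesz_const R n * riesz_field j x)))%R.
Proof.
congr fine.
have mW := measurable_wave_integral.
have m1 : measurable_fun setT (fun z : TT * RT =>
    (wave_integral z.1 * tnth z.1 j * newton_density z.2 (sqnorm z.1))%:E).
  apply/measurable_EFinP; apply: measurable_funM; first apply: measurable_funM.
  - exact: (measurableT_comp mW measurable_fst).
  - exact: (measurableT_comp (@measurable_tnthR R n.+1 j) measurable_fst).
  - by apply: measurable_newton_density => //; exact: (measurableT_comp (@measurable_sqnorm R n.+1) measurable_fst).
have i1 : (tl \x mu)%E.-integrable setT (fun z : TT * RT =>
    (wave_integral z.1 * tnth z.1 j * newton_density z.2 (sqnorm z.1))%:E).
  apply/integrable12ltyP => //=.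
  under eq_integral => y _ do rewrite (newton_superpose (wave_integral y) j y).2.
  by have /integrableP[_] := wave_newton_int j.
under eq_integral => y _ do rewrite -(newton_superpose (wave_integral y) j y).1.
rewrite [LHS](Fubini i1).
have psi'_int : tl.-integrable setT (EFin \o (fun x => psi x * - sin (beta x))).
  apply: (@le_integrable _ _ _ tl setT measurableT _ (EFin \o psi)) => //.
    apply/measurable_EFinP; apply: measurable_funM => //; apply: measurableT_comp => //.
    exact: (measurableT_comp (continuous_measurable_fun (@continuous_sin R))).
  by move=> x _; rewrite lee_fin normrM normrN -[leRHS]mulr1 ler_wpM2l// sin_cos_pihalf norm_cos_le1.
have psi'_le x : `|psi x * - sin (beta x)| <= M.
  by rewrite normrM normrN (le_trans _ (psi_le x))// -[leRHS]mulr1 ler_wpM2l// sin_cos_pihalf norm_cos_le1.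
have i2 : (tl \x mu)%E.-integrable setT (fun z : TT * RT =>
    (psi z.1 * - sin (beta z.1) * tnth z.1 j * euler_density n.+1 z.2 (sqnorm z.1))%:E).
  apply/integrable12ltyP => /=.
    apply/measurable_EFinP; apply: measurable_funM; first apply: measurable_funM.
    - have /measurable_EFinP m := measurable_int _ psi'_int.
      exact: (measurableT_comp m measurable_fst).
    - exact: (measurableT_comp (@measurable_tnthR R n.+1 j) measurable_fst).
    - by apply: measurable_euler_density => //; exact: (measurableT_comp (@measurable_sqnorm R n.+1) measurable_fst).
  under eq_integral => x _ do rewrite (euler_superpose n_gt0 (psi x * - sin (beta x)) j x).2.
  have := integrable_scale (@riesz_const R n) measurableT (integrable_riesz_field n_gt0 psi'_int psi'_le j).
  move=> /integrableP[_]; apply: le_lt_trans; rewrite le_eqVlt; apply/orP; left; apply/eqP.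
  by apply: eq_integral => x _; rewrite /= mulrCA.
under [RHS]eq_integral => x _ do rewrite -(euler_superpose n_gt0 (psi x * - sin (beta x)) j x).1.
rewrite [RHS](Fubini i2); apply: eq_integral => u _; exact: wave_slice.
Qed.

Lemma integrable_wave_newton j :
  tl.-integrable setT (EFin \o (fun y => wave_integral y * newton_field j y)).
Proof. exact: wave_newton_int. Qed.

End WavePairing.

(** * Fourier transforms of Schwartz functions *)

Section SchwartzWaves.
Context {R : realType} {n : nat}.
Local Notation m := n.+1.
Notation RT := (measurableTypeR R).
Notation mu := (@lebesgue_measure R).
Notation tl := (tuple_lebesgue R m).
Notation TT := (m.-tuple (measurableTypeR R)).
Implicit Types (x y : TT) (j : 'I_m) (F : 'rV[R]_m -> R).

(** An integrable function to which Schwartz functions and their transforms are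
    compared; a product, so that integrability reduces to dimension one. *)
Definition weight y : R := \prod_(j < m) (oneDsqr (tnth y j))^-1.

Let oneDsqr_gt0 (c : R) : 0 < oneDsqr c.
Proof. exact: lt_le_trans ltr01 (oneDsqr_ge1 c). Qed.

Let oneDsqrV_gt0 (c : R) : 0 < (oneDsqr c)^-1.
Proof. by rewrite invr_gt0 oneDsqr_gt0. Qed.

Lemma weight_gt0 y : 0 < weight y.
Proof. by apply: prodr_gt0 => j _. Qed.

Lemma integral_oneDsqr : (\int[mu]_x ((oneDsqr x)^-1)%:E = (pi : R)%:E)%E.
Proof.
rewrite ge0_symfun_integralT//=.
- rewrite (_ : [set x | _] = `[0, +oo[%classic); last first.
    by apply/seteqP; split => x/=; rewrite in_itv/= andbT.
  by rewrite integral0y_oneDsqr -EFinM mulrC divfK.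
- exact: continuous_oneDsqrV.
- by move=> c /=; rewrite /oneDsqr sqrrN.
Qed.

Lemma measurable_weight : measurable_fun setT weight.
Proof.
apply: (@measurable_prod_tuple R m (fun c => (oneDsqr c)^-1)).
exact: (continuous_measurable_fun (@continuous_oneDsqrV R)).
Qed.

Lemma integrable_weight : tl.-integrable setT (EFin \o weight).
Proof.
apply/integrableP; split; first by apply/measurable_EFinP; exact: measurable_weight.
under eq_integral => y _ do rewrite gee0_abs ?lee_fin ?ltW ?weight_gt0//.
rewrite (@integral_prod_tuple R m (fun c => (oneDsqr c)^-1) pi) ?ltry//.
- exact: (continuous_measurable_fun (@continuous_oneDsqrV R)).
- exact: integral_oneDsqr.
Qed.

Lemma integrable_le_weight (f : TT -> R) (c : R) : measurable_fun setT f ->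
  (forall y, `|f y| <= c * weight y) -> tl.-integrable setT (EFin \o f).
Proof.
move=> mf fc; apply: (@le_integrable _ _ _ tl setT measurableT _ (EFin \o (fun y => c * weight y))).
- exact/measurable_EFinP.
- by move=> y _ /=; rewrite lee_fin (le_trans (fc y))// ler_norm.
- by apply: integrable_scale => //; exact: integrable_weight.
Qed.

(** The majorant for differentiation under the integral sign. *)
Lemma weight_axis_shift j (h : R) y : `|h| <= 1 -> weight (axis_shift j h y) <= 3 * weight y.
Proof.
rewrite ler_norml => /andP[h1 h2].
rewrite /weight (bigD1 j)//= [X in _ <= 3 * X](bigD1 j)//= mulrA tnth_axis_shift eqxx.
rewrite (eq_bigr (fun k => (oneDsqr (tnth y k))^-1)); last first.
  by move=> k /negPf kj; rewrite tnth_axis_shift kj addr0.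
rewrite ler_wpM2r//; first by apply: prodr_ge0 => k _; rewrite ltW.
rewrite ler_pdivlMr ?oneDsqr_gt0// mulrC ler_pdivrMr ?oneDsqr_gt0// /oneDsqr.
have key (c : R) : 1 + c ^+ 2 <= 3 * (1 + (c + h) ^+ 2).
  have h3 : h * h <= 1 by nra.
  have := sqr_ge0 (c + 2 * h); have := sqr_ge0 (c + h); rewrite !expr2; lra.
exact: key.
Qed.

Lemma real_schwartz_partials F s : real_schwartz F -> real_schwartz (partials s F).
Proof.
have E s' : partials s' (partials s F) = partials (s' ++ s) F by rewrite /partials foldr_cat.
by move=> [d b]; split => [s'|k s']; rewrite E; [exact: d|exact: b].
Qed.

Lemma real_schwartz_continuous F : real_schwartz F -> continuous F.
Proof. by move=> [d _] x; apply: differentiable_continuous; exact: (d [::] x). Qed.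

Lemma real_schwartz_measurable F : real_schwartz F ->
  measurable_fun setT (fun y : TT => F (row_of_tuple y)).
Proof. by move=> sF; apply: continuous_row_measurable; exact: real_schwartz_continuous. Qed.

Lemma coord_le_norm j y : `|tnth y j| <= `|row_of_tuple y|.
Proof.
have -> : tnth y j = row_of_tuple y 0 j by rewrite mxE.
rewrite [leRHS]mx_normrE.
exact: (le_bigmax _ (fun i : 'I_1 * 'I_m => `|row_of_tuple y i.1 i.2|) (0, j)).
Qed.

(** The norm of row vectors is the maximum of the coordinates, hence the inverse of
    the weight is at most (1 + |y|^2)^m <= 2^m (1 + |y|^(2 m)). *)
Lemma real_schwartz_decay F : real_schwartz F ->
  exists C : R, forall y, `|F (row_of_tuple y)| <= C * weight y.
Proof.
move=> [_ b]; have [M0 h0] := b 0%N [::]; have [M1 h1] := b (2 * m)%N [::].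
exists (2 ^+ m * (M0 + M1)) => y.
have W : (weight y)^-1 <= (1 + `|row_of_tuple y| ^+ 2) ^+ m.
  have -> : (1 + `|row_of_tuple y| ^+ 2) ^+ m = \prod_(j < m) (1 + `|row_of_tuple y| ^+ 2).
    by rewrite prodr_const card_ord.
  rewrite /weight -prodfV; apply: ler_prod => j _.
  rewrite invrK ltW ?oneDsqr_gt0//= /oneDsqr lerD2l -real_normK ?num_real//.
  by apply: lerXn2r; rewrite ?nnegrE// coord_le_norm.
have q0 : 0 <= `|row_of_tuple y| ^+ 2 by exact: sqr_ge0.
have B (q : R) : 0 <= q -> (1 + q) ^+ m <= 2 ^+ m * (1 + q ^+ m).
  move=> q0'; have [q1|q1] := lerP q 1.
    apply: (@le_trans _ _ (2 ^+ m)); last by rewrite ler_peMr ?exprn_ge0// lerDl exprn_ge0.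
    by apply: lerXn2r; rewrite ?nnegrE ?addr_ge0// -[2]/(1 + 1) lerD2l.
  apply: (@le_trans _ _ ((2 * q) ^+ m)).
    by apply: lerXn2r; rewrite ?nnegrE ?addr_ge0 ?mulr_ge0// mulr_natl mulr2n lerD2r ltW.
  by rewrite exprMn ler_wpM2l ?exprn_ge0// lerDr.
rewrite -ler_pdivrMr ?weight_gt0// mulrC.
apply: (le_trans (ler_wpM2r (normr_ge0 _) W)).
apply: (le_trans (ler_wpM2r (normr_ge0 _) (B _ q0))).
rewrite -mulrA ler_wpM2l ?exprn_ge0// mulrDl lerD//.
- by have := h0 (row_of_tuple y); rewrite expr0.
- by rewrite -exprM; exact: h1.
Qed.

Lemma real_schwartz_integrable F : real_schwartz F ->
  tl.-integrable setT (EFin \o (fun y => F (row_of_tuple y))).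
Proof.
move=> sF; have [C hC] := real_schwartz_decay sF.
exact: (integrable_le_weight (real_schwartz_measurable sF) hC).
Qed.

Lemma real_schwartz_bounded F : real_schwartz F ->
  exists M : R, forall y, `|F (row_of_tuple y)| <= M.
Proof.
move=> [_ b]; have [M hM] := b 0%N [::]; exists M => y.
by have := hM (row_of_tuple y); rewrite expr0 mul1r.
Qed.

Lemma is_derive_line F (a v : 'rV[R]_m) (h : R) : derivable F (a + h *: v) v ->
  is_derive h 1 (fun h => F (a + h *: v)) ('D_v F (a + h *: v)).
Proof.
have E : (fun e : R => e^-1 *: (((fun h => F (a + h *: v)) \o shift h) (e *: 1) - F (a + h *: v))) =
    (fun e : R => e^-1 *: ((F \o shift (a + h *: v)) (e *: v) - F (a + h *: v))).
  apply/funext => e /=; congr (_ *: (F _ - _)).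
  have -> : e%:A = e :> R by rewrite /GRing.scale /= mulr1.
  by rewrite scalerDl addrCA.
by move=> d; apply: DeriveDef; rewrite /derivable /derive E.
Qed.

Lemma row_of_tuple_axis_shift j (h : R) y :
  row_of_tuple (axis_shift j h y) = row_of_tuple y + h *: delta_mx 0 j.
Proof.
apply/rowP => k; rewrite !mxE tnth_axis_shift eqxx /= [in RHS]eq_sym eq_sym.
by case: eqP => _ /=; rewrite ?mulr1 ?mulr0.
Qed.

Definition schwartz_wave F (al : R) x : R :=
  (\int[tl]_y (F (row_of_tuple y) * cos (dot x y + al)))%R.

Let mcos : measurable_fun setT (@cos R).
Proof. exact: (continuous_measurable_fun (@continuous_cos R)). Qed.

Let dotC x y : dot x y = dot y x.
Proof. by apply: eq_bigr => j _; rewrite mulrC. Qed.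

Lemma integrable_schwartz_cos F al x : real_schwartz F ->
  tl.-integrable setT (EFin \o (fun y => F (row_of_tuple y) * cos (dot x y + al))).
Proof.
move=> sF; apply: (@le_integrable _ _ _ tl setT measurableT _ (EFin \o (fun y => F (row_of_tuple y)))).
- apply/measurable_EFinP; apply: measurable_funM; first exact: real_schwartz_measurable.
  apply: (measurableT_comp mcos); apply: measurable_funD => //.
  by rewrite (funext (dotC x)); exact: measurable_dot.
- by move=> y _; rewrite lee_fin normrM -[leRHS]mulr1 ler_wpM2l// norm_cos_le1.
- exact: real_schwartz_integrable.
Qed.

(** Integration by parts moves the derivative to the cosine. *)
Lemma schwartz_wave_partial F j (al : R) x : real_schwartz F ->
  schwartz_wave (partials [:: j] F) al x = tnth x j * schwartz_wave F (al - pi / 2) x.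
Proof.
move=> sF; have sF' := real_schwartz_partials [:: j] sF.
have i1 := integrable_schwartz_cos al x sF'.
have i0 := integrable_schwartz_cos (al - pi / 2) x sF.
have [C0 h0] := real_schwartz_decay sF; have [C1 h1] := real_schwartz_decay sF'.
pose F' y := partials [:: j] F (row_of_tuple y) * cos (dot x y + al) +
   - tnth x j * (F (row_of_tuple y) * cos (dot x y + (al - pi / 2))).
have i2 := integrable_scale (- tnth x j) measurableT i0.
have Z : (\int[tl]_y F' y = 0)%R.
  apply: (@integral_partial_eq0 _ _ j (fun y => F (row_of_tuple y) * cos (dot x y + al)) F'
    (fun y => (C1 + `|tnth x j| * C0) * 3 * weight y)).
  - move=> y h.
    have -> : (fun h : R => F (row_of_tuple (axis_shift j h y)) * cos (dot x (axis_shift j h y) + al)) =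
        fun h : R => F (row_of_tuple y + h *: delta_mx 0 j) * cos (dot x y + h * tnth x j + al).
      by apply/funext => k; rewrite row_of_tuple_axis_shift dotC dot_axis_shift dotC.
    have dF := @is_derive_line F (row_of_tuple y) (delta_mx 0 j) h.
    have := dF (diff_derivable (sF.1 [::] _)) => {}dF.
    apply: is_derive_eq; rewrite /F' /= row_of_tuple_axis_shift (dotC x (axis_shift j h y)) dot_axis_shift (dotC y) [_ + (al - _)]addrA -sin_cos_pihalf.
    by rewrite /GRing.scale /=; ring.
  - exact: integrable_schwartz_cos.
  - by apply: integrable_scale => //; exact: integrable_weight.
  - move=> y h hh; have wz := weight_axis_shift j y (ltW hh).
    move: (axis_shift j h y) wz => z wz.
    apply: (@le_trans _ _ ((C1 + `|tnth x j| * C0) * weight z)).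
      rewrite mulrDl -!mulrA; apply: le_trans (ler_normD _ _) _; apply: lerD.
        by rewrite normrM (le_trans _ (h1 z))// -[leRHS]mulr1 ler_wpM2l// norm_cos_le1.
      by rewrite normrM normrN ler_wpM2l// normrM (le_trans _ (h0 z))// -[leRHS]mulr1 ler_wpM2l// norm_cos_le1.
    rewrite -mulrA ler_wpM2l// addr_ge0 ?mulr_ge0//.
    + by rewrite -(@pmulr_lge0 _ (weight z)) ?weight_gt0// (le_trans _ (h1 z)).
    + by rewrite -(@pmulr_lge0 _ (weight z)) ?weight_gt0// (le_trans _ (h0 z)).
move: Z; rewrite /F' (RintegralD measurableT i1 i2) (RintegralZl _ measurableT i0).
by rewrite mulNr => /eqP; rewrite subr_eq0 => /eqP.
Qed.

(** Two integrations by parts shift the phase by pi and give the factor - x_j^2. *)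
Lemma schwartz_wave_laplace F j (al : R) x : real_schwartz F ->
  oneDsqr (tnth x j) * schwartz_wave F al x =
  schwartz_wave F al x - schwartz_wave (partials [:: j; j] F) al x.
Proof.
move=> sF; have sF' := real_schwartz_partials [:: j] sF.
rewrite -[partials [:: j; j] F]/(partials [:: j] (partials [:: j] F)).
rewrite (schwartz_wave_partial j al x sF') (schwartz_wave_partial j _ x sF).
have -> : schwartz_wave F (al - pi / 2 - pi / 2) x = - schwartz_wave F al x.
  rewrite /schwartz_wave -[RHS]mulN1r -(RintegralZl _ measurableT (integrable_schwartz_cos al x sF)).
  apply: eq_Rintegral => y _; rewrite (_ : dot x y + _ = dot x y + al - pi); last by field.
  by rewrite cosB cospi sinpi mulr0 addr0; ring.
by rewrite /oneDsqr; ring.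
Qed.

(** Induction on the coordinates: each factor 1 + x_j^2 is absorbed by
    schwartz_wave_laplace, at the price of two more derivatives. *)
Let schwartz_wave_bound F (al : R) (s : seq 'I_m) : real_schwartz F ->
  exists C : R, forall x, \prod_(j <- s) oneDsqr (tnth x j) * `|schwartz_wave F al x| <= C.
Proof.
elim: s F => [|j s IH] F sF.
  exists (\int[tl]_y `|F (row_of_tuple y)|)%R => x; rewrite big_nil mul1r.
  have i1 := integrable_schwartz_cos al x sF.
  apply: (le_trans (le_normr_Rintegral measurableT i1)).
  apply: le_Rintegral => //.
  - exact: (integrable_abse i1).
  - exact: (integrable_abse (real_schwartz_integrable sF)).
  by move=> y _; rewrite normrM -[leRHS]mulr1 ler_wpM2l// norm_cos_le1.
have [C0 h0] := IH _ sF; have [C1 h1] := IH _ (real_schwartz_partials [:: j; j] sF).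
exists (C0 + C1) => x; rewrite big_cons (mulrC (oneDsqr _)) -mulrA.
rewrite -[X in X * `|_|](gtr0_norm (oneDsqr_gt0 _)) -normrM (schwartz_wave_laplace j al x sF).
apply: (@le_trans _ _ (\prod_(k <- s) oneDsqr (tnth x k) * `|schwartz_wave F al x| +
   \prod_(k <- s) oneDsqr (tnth x k) * `|schwartz_wave (partials [:: j; j] F) al x|)).
  by rewrite -mulrDr ler_wpM2l ?ler_normB// prodr_ge0// => k _; rewrite ltW.
by rewrite lerD.
Qed.

Lemma measurable_schwartz_wave F (al : R) : real_schwartz F ->
  measurable_fun setT (schwartz_wave F al).
Proof.
move=> sF.
exact: (@measurable_wave_integral R n (fun y => F (row_of_tuple y)) (cst al)
  (real_schwartz_integrable sF) (measurable_cst al)).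
Qed.

Lemma integrable_schwartz_wave F (al : R) : real_schwartz F ->
  tl.-integrable setT (EFin \o schwartz_wave F al).
Proof.
move=> sF; have [C hC] := schwartz_wave_bound al (index_enum 'I_m) sF.
apply: (integrable_le_weight (measurable_schwartz_wave al sF) (c := C)) => x.
rewrite -ler_pdivrMr ?weight_gt0// mulrC /weight -prodfV.
by under eq_bigr do rewrite invrK; exact: hC.
Qed.

End SchwartzWaves.

(** * The Fourier transform of the Cauchy kernels *)

Section ShiftedPairing.
Context {R : realType} {n : nat}.
Notation RT := (measurableTypeR R).
Notation tl := (tuple_lebesgue R n.+1).
Notation TT := (n.+1.-tuple (measurableTypeR R)).
Implicit Types (x y : TT) (j : 'I_n.+1) (F : 'rV[R]_n.+1 -> R).
Hypothesis n_gt0 : (0 < n)%N.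
Variables (s0 al : R) (F : 'rV[R]_n.+1 -> R).
Hypothesis sF : real_schwartz F.

Let psi y := F (row_of_tuple y).
Let beta y : R := s0 * tnth y ord0 + al.

Let mbeta : measurable_fun setT beta.
Proof. by apply: measurable_funD => //; apply: measurable_funM => //; exact: measurable_tnthR. Qed.

Let axis_shiftK (h : R) y : axis_shift ord0 h (axis_shift ord0 (- h) y) = y.
Proof. by apply: eq_from_tnth => k; rewrite !tnth_axis_shift; case: ifP => _; rewrite ?addr0 ?subrK. Qed.

Let wave_shift y : wave_integral psi beta y = schwartz_wave F al (axis_shift ord0 s0 y).
Proof.
by apply: eq_Rintegral => x _; rewrite dot_axis_shift addrA.
Qed.

Let wave_int : tl.-integrable setT (EFin \o wave_integral psi beta).
Proof.
rewrite (funext wave_shift).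
exact: (@integrable_tshift R n.+1 _ (EFin \o schwartz_wave F al) (integrable_schwartz_wave al sF)).
Qed.

Lemma integrable_shifted_pairing j : tl.-integrable setT
  (EFin \o (fun x => schwartz_wave F al x * newton_field j (axis_shift ord0 (- s0) x))).
Proof.
have iw := integrable_wave_newton n_gt0 (real_schwartz_integrable sF) mbeta wave_int j.
have := @integrable_tshift R n.+1 [tuple if k == ord0 then - s0 else 0 | k < n.+1] _ iw.
rewrite (_ : (fun t => _) = (EFin \o (fun x => schwartz_wave F al x * newton_field j (axis_shift ord0 (- s0) x))))//.
apply/funext => x /=; congr (_ * _)%:E.
by rewrite -[LHS]/(wave_integral psi beta (axis_shift ord0 (- s0) x)) wave_shift axis_shiftK.
Qed.

(** The translation by s0 along the real axis is absorbed into the phase of the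
    wave. *)
Lemma shifted_pairing j :
  (\int[tl]_x (schwartz_wave F al x * newton_field j (axis_shift ord0 (- s0) x)) =
   \int[tl]_x (F (row_of_tuple x) * - sin (s0 * tnth x ord0 + al) * (@riesz_const R n * riesz_field j x)))%R.
Proof.
have [M hM] := real_schwartz_bounded sF.
have iw := integrable_wave_newton n_gt0 (real_schwartz_integrable sF) mbeta wave_int j.
rewrite -[RHS](wave_integral_pairing n_gt0 (real_schwartz_integrable sF) hM mbeta wave_int j).
congr fine; rewrite -[RHS](integral_tshift [tuple if k == ord0 then - s0 else 0 | k < n.+1]); last exact: measurable_int iw.
apply: eq_integral => x _; congr (_ * _)%:E.
by rewrite -[RHS]/(wave_integral psi beta (axis_shift ord0 (- s0) x)) wave_shift axis_shiftK.
Qed.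

Lemma integrable_schwartz_riesz (b : TT -> R) j : measurable_fun setT b -> (forall x, `|b x| <= 1) ->
  tl.-integrable setT (EFin \o (fun x => F (row_of_tuple x) * b x * (@riesz_const R n * riesz_field j x))).
Proof.
move=> mb b1; have [M hM] := real_schwartz_bounded sF.
have -> : (fun x => F (row_of_tuple x) * b x * (@riesz_const R n * riesz_field j x)) =
    (fun x => @riesz_const R n * (F (row_of_tuple x) * b x * riesz_field j x)).
  by apply/funext => x; ring.
apply: integrable_scale => //; apply: (@integrable_riesz_field R n n_gt0 _ M).
- apply: (@le_integrable _ _ _ tl setT measurableT _ (EFin \o psi)).
  + by apply/measurable_EFinP; apply: measurable_funM => //; exact: real_schwartz_measurable.
  + by move=> x _; rewrite lee_fin normrM -[leRHS]mulr1 ler_wpM2l.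
  + exact: real_schwartz_integrable.
- by move=> x; rewrite normrM (le_trans _ (hM x))// -[leRHS]mulr1 ler_wpM2l.
Qed.

End ShiftedPairing.

Section KernelTransform.
Context {R : realType} {n : nat}.
Notation RT := (measurableTypeR R).
Notation tl := (tuple_lebesgue R n.+1).
Notation TT := (n.+1.-tuple (measurableTypeR R)).
Local Notation CC := (clifford R[i] n).
Implicit Types (x y t : TT) (j : 'I_n.+1) (A : {set 'I_n}) (v : 'rV[R]_n.+1).
Hypothesis n_gt0 : (0 < n)%N.

(** A uniform description of the coefficients, with e = 1, -1 or 0, so that no case
    distinction on A is needed in what follows. *)
Lemma paravector_pconj_coef A : exists j (e : R),
  forall v, paravector (pconj v) A = (e * v 0 j)%:C.
Proof.
have E v : paravector v A = (v 0 0 * (A == finset.set0)%:R)%:C +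
    \sum_(l < n) (v 0 (lift ord0 l) * (A == [set l]%SET)%:R)%:C.
  rewrite /paravector cl_coefD cl_coefZ [X in _ * X]mk_cliffordE /cl_vector cl_coef_sum; congr (_ + _).
    by case: eqP; rewrite ?mulr1 ?mulr0.
  apply: eq_bigr => l _; rewrite cl_coefZ /cl_unit mk_cliffordE mxE.
  by case: eqP; rewrite ?mulr1 ?mulr0.
have [A0|A0] := eqVneq A finset.set0.
  exists ord0, 1 => v; rewrite E A0 eqxx mulr1 big1 => [|l _]; last first.
    rewrite (_ : (_ == _) = false) ?mulr0//; apply/negbTE/eqP => /setP/(_ l).
    by rewrite !inE eqxx.
  by rewrite addr0 mul1r mxE eqxx.
have [/existsP[l /eqP Al]|/existsPn nl] := boolP [exists l, A == [set l]%SET].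
  exists (lift ord0 l), (-1) => v; rewrite E (negPf A0) mulr0 add0r (bigD1 l)//= Al eqxx.
  rewrite big1 => [|k kl]; last first.
    rewrite (_ : (_ == _) = false) ?mulr0//; apply/negbTE/eqP => /setP/(_ k).
    by rewrite !inE eqxx (negPf kl).
  by rewrite addr0 mulr1 mxE mulN1r.
exists ord0, 0 => v; rewrite E (negPf A0) mulr0 add0r mul0r big1// => l _.
by rewrite (negPf (nl l)) mulr0.
Qed.

Lemma enorm_row t : row_of_tuple t 0 0 ^+ 2 + enorm (imag_part (row_of_tuple t)) ^+ 2 = sqnorm t.
Proof.
rewrite /enorm sqr_sqrtr; last by apply: sumr_ge0 => k _; exact: sqr_ge0.
rewrite /sqnorm big_ord_recl mxE; congr (_ + _).
by apply: eq_bigr => l _; rewrite !mxE.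
Qed.

Lemma cauchy_denominator (s0 : R) t :
  s0 ^+ 2 - 2 * row_of_tuple t 0 0 * s0 + enorm (row_of_tuple t) ^+ 2 = sqnorm (axis_shift ord0 (- s0) t).
Proof.
rewrite sqnorm_axis_shift /enorm sqr_sqrtr; last by apply: sumr_ge0 => k _; exact: sqr_ge0.
rewrite (_ : \sum_j _ = sqnorm t); last by apply: eq_bigr => k _; rewrite mxE.
by rewrite mxE; ring.
Qed.

Lemma SR_kernelE (s0 : R) : SR_kernel s0 = SL_kernel s0 :> ('rV[R]_n.+1 -> CC).
Proof. by apply/funext => v; rewrite /SR_kernel /SL_kernel mulr_algl mulr_algr. Qed.

Lemma SL_kernel_coef (s0 : R) A j (e : R) :
  (forall v, paravector (pconj v) A = (e * v 0 j)%:C) -> forall t,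
  SL_kernel s0 (row_of_tuple t) A = (- e * newton_field j (axis_shift ord0 (- s0) t))%:C.
Proof.
move=> eA t; rewrite /SL_kernel mulr_algr cl_coefZ cauchy_denominator cl_coefD cl_coefN eA.
have -> : ((s0%:C)%:A : CC) A = (e * real_point n s0 0 j)%:C.
  rewrite -eA; congr (cl_fun _ A).
  have -> : pconj (real_point n s0) = real_point n s0.
    by apply/rowP => k; rewrite !mxE eqxx /=; case: eqP => //= _; rewrite mulr0 oppr0.
  by rewrite -(real_pointE s0 0) paravector_slice scale0r addr0.
rewrite -rmorphB -rmorphM /newton_field tnth_axis_shift !mxE eqxx /=; congr (_%:C).
by case: eqP => _; rewrite ?mulr1 ?mulr0; ring.
Qed.

(** The coefficient e i kappa xi_j / |xi|^(n+1) e^(- i s0 xi_0) of the transform,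
    with kappa = [riesz_const], split into real and imaginary parts. *)
Definition transform_coef (s0 e : R) j t : R[i] :=
  (e * (@riesz_const R n * riesz_field j t) * sin (s0 * tnth t ord0)) +i*
  (e * (@riesz_const R n * riesz_field j t) * cos (s0 * tnth t ord0)).

Lemma kernel_transform_coef (s0 : R) A j (e : R) :
  (forall v, paravector (pconj v) A = (e * v 0 j)%:C) -> forall t,
  let xi := row_of_tuple t in
  (c_const R n *: ((((xi 0 0 ^+ 2 + enorm (imag_part xi) ^+ 2) `^ (n.+1%:R / 2))^-1)%:C
      *: paravector (pconj xi)) * (expi (- (s0 * xi 0 0)))%:A : CC) A =
  transform_coef s0 e j t.
Proof.
move=> eA t xi; rewrite /xi mulr_algr cl_coefZ cl_coefZ cl_coefZ eA enorm_row.
rewrite /c_const -/(@riesz_const R n) /transform_coef /riesz_field !mxE /expi cosN sinN.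
move: (cos _) (sin _) (@riesz_const R n) (sqnorm t `^ _)^-1 (tnth t j) => C S K p c.
apply/eqP; rewrite eq_complex /=; apply/andP; split; apply/eqP; ring.
Qed.

Lemma fourier_row (phi : 'rV[R]_n.+1 -> R[i]) t : schwartz phi ->
  fourier phi (row_of_tuple t) =
  (schwartz_wave (fun v => complex.Re (phi v)) 0 t +
   schwartz_wave (fun v => complex.Im (phi v)) (- (pi / 2)) t) +i*
  (schwartz_wave (fun v => complex.Im (phi v)) 0 t -
   schwartz_wave (fun v => complex.Re (phi v)) (- (pi / 2)) t).
Proof.
move=> [s1 s2].
have dE x : dotprod (row_of_tuple x) (row_of_tuple t) = dot t x.
  by rewrite /dotprod /dot; apply: eq_bigr => j _; rewrite !mxE mulrC.
have i1 al := integrable_schwartz_cos al t s1.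
have i2 al := integrable_schwartz_cos al t s2.
rewrite /fourier /cx_integral /rv_integral /schwartz_wave; congr (_ +i* _).
  rewrite -(RintegralD measurableT (i1 0) (i2 (- (pi / 2)))).
  apply: eq_Rintegral => x _; rewrite dE addr0 -sin_cos_pihalf.
  by case: (phi _) => a b; rewrite /expi /= cosN sinN; ring.
rewrite -(RintegralB measurableT (i2 0) (i1 (- (pi / 2)))).
apply: eq_Rintegral => x _; rewrite dE addr0 -sin_cos_pihalf.
by case: (phi _) => a b; rewrite /expi /= cosN sinN; ring.
Qed.

Lemma compact_sqnorm_bound (K : set 'rV[R]_n.+1) : compact K ->
  exists B : R, forall t, K (row_of_tuple t) -> sqnorm t <= B.
Proof.
move=> /compact_bounded [M [_ hM]].
exists (\sum_(j < n.+1) (M + 1) ^+ 2) => t Kt; apply: ler_sum => j _.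
rewrite -(real_normK (num_real (tnth t j))).
have tM : `|tnth t j| <= M + 1.
  apply: (le_trans (coord_le_norm j t)); apply: hM => //.
  by rewrite ltrDl.
by apply: lerXn2r; rewrite ?nnegrE// (le_trans _ tM).
Qed.

Lemma measurable_row_compact (K : set 'rV[R]_n.+1) : compact K ->
  measurable (@row_of_tuple R n.+1 @^-1` K).
Proof.
move=> cK; rewrite -[X in measurable X]setCK; apply: measurableC.
rewrite preimage_setC; apply: measurable_row_open; apply: closed_openC.
by apply: compact_closed => //; exact: norm_hausdorff.
Qed.

(** On a bounded set the Gaussian is bounded from below. *)
Lemma locally_integrable_riesz (K : set 'rV[R]_n.+1) (b : TT -> R) (e : R) j :
  compact K -> measurable_fun setT b -> (forall t, `|b t| <= 1) ->
  tl.-integrable (@row_of_tuple R n.+1 @^-1` K)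
    (EFin \o (fun t => e * (@riesz_const R n * riesz_field j t) * b t)).
Proof.
move=> cK mb b1; have mK := measurable_row_compact cK; have [B hB] := compact_sqnorm_bound cK.
pose L := `|e * @riesz_const R n| * expR B.
apply: (@le_integrable _ _ _ tl _ mK _ (EFin \o (fun t => L * (gaussian 1 t * riesz_field j t)))).
- apply: (@measurable_funS _ _ _ _ setT) => //.
  apply/measurable_EFinP; apply: measurable_funM => //; apply: measurable_funM => //.
  by apply: measurable_funM => //; exact: measurable_riesz_field.
- move=> t Kt; rewrite lee_fin mulrA /L normrM.
  rewrite normrM.
  apply: (@le_trans _ _ (`|e * @riesz_const R n| * `|riesz_field j t| * 1)).
    by apply: ler_pM => //; rewrite normrM.
  rewrite mulr1 (normrM (L)) /L (normrM `|_|) normr_id (ger0_norm (expR_ge0 _)).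
  rewrite -mulrA ler_wpM2l// (normrM (gaussian 1 t)) (ger0_norm (gaussian_ge0 _ _)) mulrA.
  rewrite /gaussian mul1r -expRD -[leLHS]mul1r ler_wpM2r// -expR0 ler_expR subr_ge0.
  exact: hB.
apply: integrableS (measurableT) mK _ _ => //.
by apply: integrable_scale => //; exact: integrable_gaussian_riesz.
Qed.

Let cx_integral_combination (f : 'rV[R]_n.+1 -> R[i]) (e : R) (p q r s : TT -> R) :
  (forall t, f (row_of_tuple t) = (- e * p t + - e * q t) +i* (- e * r t + e * s t)) ->
  tl.-integrable setT (EFin \o p) -> tl.-integrable setT (EFin \o q) ->
  tl.-integrable setT (EFin \o r) -> tl.-integrable setT (EFin \o s) ->
  cx_integrable_on setT f /\
  cx_integral f = (- e * (\int[tl]_t p t)%R + - e * (\int[tl]_t q t)%R) +i*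
                  (- e * (\int[tl]_t r t)%R + e * (\int[tl]_t s t)%R).
Proof.
move=> fE ip iq ir is_.
have Ip := integrable_scale (- e) measurableT ip; have Iq := integrable_scale (- e) measurableT iq.
have Ir := integrable_scale (- e) measurableT ir; have Is := integrable_scale e measurableT is_.
have E1 : (fun t => complex.Re (f (row_of_tuple t))) = (fun t => - e * p t + - e * q t).
  by apply/funext => t; rewrite fE.
have E2 : (fun t => complex.Im (f (row_of_tuple t))) = (fun t => - e * r t + e * s t).
  by apply/funext => t; rewrite fE.
split.
  split; rewrite /integrable_on.
    rewrite -[X in _.-integrable _ X]/(EFin \o (fun t => complex.Re (f (row_of_tuple t)))) E1.
    exact: (integrableD measurableT Ip Iq).
  rewrite -[X in _.-integrable _ X]/(EFin \o (fun t => complex.Im (f (row_of_tuple t)))) E2.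
  exact: (integrableD measurableT Ir Is).
rewrite /cx_integral /rv_integral E1 E2.
rewrite (RintegralD measurableT Ip Iq) (RintegralD measurableT Ir Is).
by rewrite (RintegralZl _ measurableT ip) (RintegralZl _ measurableT iq)
  (RintegralZl _ measurableT ir) (RintegralZl _ measurableT is_).
Qed.

(** P and Q are the integrands on the two sides of [shifted_pairing].  The real and
    imaginary parts of both sides of the weak formulation are the same combinations
    of P and of Q for the real and imaginary parts of phi with the phases 0 and
    - pi / 2. *)
Lemma kernel_fourier_transform (s0 : R) :
  is_fourier_transform (SL_kernel s0 : 'rV[R]_n.+1 -> CC)
   (fun xi => c_const R n *: ((((xi 0 0 ^+ 2 + enorm (imag_part xi) ^+ 2) `^ (n.+1%:R / 2))^-1)%:C
      *: paravector (pconj xi)) * (expi (- (s0 * xi 0 0)))%:A).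
Proof.
have msigma : measurable_fun setT (fun t : TT => s0 * tnth t ord0).
  by apply: measurable_funM => //; exact: measurable_tnthR.
have mcos := continuous_measurable_fun (@continuous_cos R).
have msin := continuous_measurable_fun (@continuous_sin R).
have sin_le (c : R) : `|sin c| <= 1 by rewrite sin_cos_pihalf norm_cos_le1.
split.
  move=> K cK A; have [j [e eA]] := paravector_pconj_coef A.
  split; rewrite /integrable_on.
    rewrite (_ : (fun t => _) = EFin \o (fun t => e * (@riesz_const R n * riesz_field j t) * sin (s0 * tnth t ord0))).
      by apply: locally_integrable_riesz => //; exact: (measurableT_comp msin msigma).
    by apply/funext => t; rewrite (kernel_transform_coef s0 eA).
  rewrite (_ : (fun t => _) = EFin \o (fun t => e * (@riesz_const R n * riesz_field j t) * cos (s0 * tnth t ord0))).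
    apply: locally_integrable_riesz => //; first exact: (measurableT_comp mcos msigma).
    by move=> t; exact: norm_cos_le1.
  by apply/funext => t; rewrite (kernel_transform_coef s0 eA).
move=> phi sphi; have [s1 s2] := sphi.
pose G (xi : 'rV[R]_n.+1) : CC := c_const R n *: ((((xi 0 0 ^+ 2 + enorm (imag_part xi) ^+ 2) `^ (n.+1%:R / 2))^-1)%:C
      *: paravector (pconj xi)) * (expi (- (s0 * xi 0 0)))%:A.
pose P (F : 'rV[R]_n.+1 -> R) (al : R) j t := schwartz_wave F al t * newton_field j (axis_shift ord0 (- s0) t).
pose Q (F : 'rV[R]_n.+1 -> R) (al : R) j t := F (row_of_tuple t) * - sin (s0 * tnth t ord0 + al) *
  (@riesz_const R n * riesz_field j t).
have iP F al j : real_schwartz F -> tl.-integrable setT (EFin \o P F al j).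
  by move=> sF; exact: integrable_shifted_pairing.
have iQ F al j : real_schwartz F -> tl.-integrable setT (EFin \o Q F al j).
  move=> sF; apply: (@integrable_schwartz_riesz R n n_gt0 F sF (fun t => - sin (s0 * tnth t ord0 + al))).
    by apply: measurableT_comp => //; apply: (measurableT_comp msin); exact: measurable_funD.
  by move=> t; rewrite normrN.
have PQ F al j : real_schwartz F -> (\int[tl]_t P F al j t = \int[tl]_t Q F al j t)%R.
  by move=> sF; exact: shifted_pairing.
pose ph1 v := complex.Re (phi v); pose ph2 v := complex.Im (phi v).
have HP A j e : (forall v, paravector (pconj v) A = (e * v 0 j)%:C) ->
  cx_integrable_on setT (fun v => (fourier phi v *: SL_kernel s0 v) A) /\
  cx_integral (fun v => (fourier phi v *: SL_kernel s0 v) A) =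
   (- e * (\int[tl]_t P ph1 0 j t)%R + - e * (\int[tl]_t P ph2 (- (pi / 2)) j t)%R) +i*
   (- e * (\int[tl]_t P ph2 0 j t)%R + e * (\int[tl]_t P ph1 (- (pi / 2)) j t)%R).
  move=> eA; apply: cx_integral_combination; [|exact: iP..] => t.
  rewrite cl_coefZ (SL_kernel_coef s0 eA) fourier_row// /P -/ph1 -/ph2.
  apply/eqP; rewrite eq_complex /=; apply/andP; split; apply/eqP; ring.
have HQ A j e : (forall v, paravector (pconj v) A = (e * v 0 j)%:C) ->
  cx_integrable_on setT (fun v => (phi v *: G v) A) /\
  cx_integral (fun v => (phi v *: G v) A) =
   (- e * (\int[tl]_t Q ph1 0 j t)%R + - e * (\int[tl]_t Q ph2 (- (pi / 2)) j t)%R) +i*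
   (- e * (\int[tl]_t Q ph2 0 j t)%R + e * (\int[tl]_t Q ph1 (- (pi / 2)) j t)%R).
  move=> eA; apply: cx_integral_combination; [|exact: iQ..] => t.
  rewrite cl_coefZ (kernel_transform_coef s0 eA) /Q /ph1 /ph2 /transform_coef.
  rewrite addr0 sinB cos_pihalf sin_pihalf mulr0 mulr1 sub0r opprK.
  case: (phi _) => a b /=.
  apply/eqP; rewrite eq_complex /=; apply/andP; split; apply/eqP; ring.
split.
- by move=> A; have [j [e eA]] := paravector_pconj_coef A; have [] := HP A j e eA.
- by move=> A; have [j [e eA]] := paravector_pconj_coef A; have [] := HQ A j e eA.
apply/cliffordP => A; rewrite [LHS]mk_cliffordE [RHS]mk_cliffordE.
have [j [e eA]] := paravector_pconj_coef A.
by rewrite (HP A j e eA).2 (HQ A j e eA).2 !PQ.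
Qed.

End KernelTransform.

Theorem theorem3p7 (R : realType) (n : nat) (hn : (1 <= n)%N) :
  let c : R[i] := c_const R n in
  let E : 'rV[R]_n.+1 -> clifford R[i] n := fun xi =>
    (((xi 0 0 ^+ 2 + enorm (imag_part xi) ^+ 2) `^ (n.+1%:R / 2))^-1)%:C
      *: paravector (pconj xi) in
  let Fhat : R -> 'rV[R]_n.+1 -> clifford R[i] n := fun s0 xi =>
    c *: E xi * (expi (- (s0 * xi 0 0)))%:A in
  (forall s0 : R,
     is_fourier_transform (SL_kernel s0) (Fhat s0) /\
     is_fourier_transform (SR_kernel s0) (Fhat s0)) /\
  (forall xi : 'rV[R]_n.+1, xi != 0 ->
     let e : 'rV[R]_n.+1 -> clifford R[i] n := fun s =>
       cl_exp (- (Complex 0 1 * (xi 0 0)%:C) *: paravector s) in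
     [/\ intrinsic_slice_monogenic setT e,
         forall s0 : R, e (real_point n s0) = (expi (- (s0 * xi 0 0)))%:A,
         unique (right_slice_extension (fun s0 => Fhat s0 xi))
                (fun s => c *: E xi * e s)
       & unique (left_slice_extension (fun s0 => Fhat s0 xi))
                (fun s => c *: e s * E xi)]).
Proof.
move=> c E Fhat; split=> [s0|xi _ e].
  by rewrite SR_kernelE; split; exact: kernel_fourier_transform.
split.
- exact: cl_exp_intrinsic.
- by move=> s0; exact: cl_exp_real_point.
- by apply: exp_right_extension.
have -> : (fun s => c *: e s * E xi) = fun s => e s * (c *: E xi).
  by apply/funext => s; rewrite -scalerAl scalerAr.
by apply: (@exp_left_extension R n hn (xi 0 0) (c *: E xi)) => s0; rewrite mulr_algl; exact: mulr_algr.
Qed.
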